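(* Let $\beta>0$ and assume the following. (1) $G:\mathbb{R}\to[0,+\infty)$ is locally Lipschitz continuous and $\lim_{p\to\pm\infty}G(p)=+\infty$. (2) $G(0)=0$, $G_1:=G|_{(-\infty,0]}$ is strictly decreasing and $G_2:=G|_{[0,+\infty)}$ is strictly increasing. (3) $a:\mathbb{R}\times\Omega\to(0,1]$ and $V:\mathbb{R}\times\Omega\to[0,1]$ are stationary, i.e. $a(x,\omega)=a(0,\tau_x\omega)$ and $V(x,\omega)=V(0,\tau_x\omega)$ for every $(x,\omega)$. (4) $\inf_{x\in\mathbb{R}}V(x,\omega)=0$ and $\sup_{x\in\mathbb{R}}V(x,\omega)=1$ for $\mathbb{P}$-a.e. $\omega$. (5) For every $\omega\in\Omega$ and $\theta\in\mathbb{R}$, the equation $$\partial_tu=a(x,\omega)\partial^2_{xx}u+G(\partial_xu)+\beta V(x,\omega),\quad(t,x)\in(0,+\infty)\times\mathbb{R},$$ has a unique viscosity solution $u_\theta(\cdot,\cdot,\omega)\in\mathrm{UC}([0,+\infty)\times\mathbb{R})$ such that $u_\theta(0,x,\omega)=\theta x$ for all $x\in\mathbb{R}$. (6) $\sqrt{a(\cdot,\omega)}$ is Lipschitz continuous on $\mathbb{R}$ and $V(\cdot,\omega)$ is uniformly continuous on $\mathbb{R}$ for every $\omega\in\Omega$. (7) (Scaled hill condition) For every $h\in(0,1)$, $C>0$ and $\mathbb{P}$-a.e. $\omega$, there is an interval $[L_1,L_2]$ such that $\int_{L_1}^{L_2}\frac{dy}{a(y,\omega)}\ge C$ and $V(\cdot,\omega)\ge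 h$ on $[L_1,L_2]$. (8) For every $\omega\in\Omega$ and $\theta\in\mathbb{R}$ there exists $\ell_\theta=\ell_\theta(\omega)>0$ such that $|u_\theta(t,x,\omega)-u_\theta(t,y,\omega)|\le\ell_\theta|x-y|$ for all $t\in[0,+\infty)$ and $x,y\in\mathbb{R}$. With $\theta_1,\theta_2$ the continuous bijections defined in the context, define $\overline H:\mathbb{R}\to\mathbb{R}$, which is locally Lipschitz continuous, by $$\overline H(\theta)=\begin{cases}\theta_1^{-1}(\theta)&\text{for }\theta\in(-\infty,\theta_1(\beta)]\quad(\text{strictly decreasing}),\\ \beta&\text{for }\theta\in(\theta_1(\beta),\theta_2(\beta))\quad(\text{flat piece}),\\ \theta_2^{-1}(\theta)&\text{for }\theta\in[\theta_2(\beta),+\infty)\quad(\text{strictly increasing}).\end{cases}$$ Then there exists $\Omega_0\in\mathcal{F}$ with $\mathbb{P}(\Omega_0)=1$ such that, for every $\omega\in\Omega_0$ and $\theta\in\mathbb{R}$, as $\epsilon\to0$, the unique viscosity solution $u_\theta^\epsilon(\cdot,\cdot,\omega)$ of $$\partial_tu^\epsilon=\epsilon\, a\!\left(\tfrac x\epsilon,\omega\right)\partial^2_{xx}u^\epsilon+G(\partial_xu^\epsilon)+\beta V\!\left(\tfrac x\epsilon,\omega\right),\quad(t,x)\in(0,+\infty)\times\mathbb{R},$$ with initial condition $u_\theta^\epsilon(0,x,\omega)=\theta x$, $x\in\mathbb{R}$, converges locally uniformly on $[0,+\infty)\times\mathbb{R}$ to $$\overline u_\theta(t,x)=t\overline H(\theta)+\theta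 x,$$ which is the unique (classical and hence viscosity) solution in $\mathrm{UC}([0,+\infty)\times\mathbb{R})$ of the equation $\partial_t\overline u=\overline H(\partial_x\overline u)$, $(t,x)\in(0,+\infty)\times\mathbb{R}$, with the same initial condition.
   Context: $(\Omega,\mathcal{F},\mathbb{P})$ is a probability space equipped with a group of measure-preserving transformations $\tau_x:\Omega\to\Omega$, $x\in\mathbb{R}$ (so $\tau_0=\mathrm{id}$, $\tau_{x+y}=\tau_x\circ\tau_y$), such that $(x,\omega)\mapsto\tau_x\omega$ is measurable, and $\mathbb{P}$ is ergodic: $\mathbb{P}(A)\in\{0,1\}$ whenever $A\in\mathcal{F}$ satisfies $\tau_xA=A$ for all $x\in\mathbb{R}$. $\mathbb{E}$ is expectation under $\mathbb{P}$. The functions $a(0,\cdot)$ and $V(0,\cdot)$ are measurable. $\mathrm{UC}(X)$ is the space of uniformly continuous real-valued functions on $X$. $G_1^{-1}:[0,+\infty)\to(-\infty,0]$ and $G_2^{-1}:[0,+\infty)\to[0,+\infty)$ denote the inverses of $G_1$ and $G_2$. Viscosity solutions: for an equation $\partial_tu=A(x)\partial^2_{xx}u+H(\partial_xu)+W(x)$ on $(0,+\infty)\times\mathbb{R}$ with $A\ge0$, a continuous function $v$ is a viscosity subsolution (resp. supersolution) if for every $(t_0,x_0)$ and $\varphi\in C^2((0,+\infty)\times\mathbb{R})$ such that $v-\varphi$ attains a local maximum (resp. minimum) at $(t_0,x_0)$, one has $\partial_t\varphi\le$ (resp. $\ge$) $A(x_0)\partial^2_{xx}\varphi+H(\partial_x\varphi)+W(x_0)$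 at $(t_0,x_0)$; a viscosity solution is both. Because of (5), for every $\epsilon>0$ the unique viscosity solution in $\mathrm{UC}([0,+\infty)\times\mathbb{R})$ of the $\epsilon$-equation with initial condition $x\mapsto\theta x$ is $u_\theta^\epsilon(t,x,\omega)=\epsilon u_\theta(t/\epsilon,x/\epsilon,\omega)$. Functions $\theta_1,\theta_2$: under (1)–(4) and continuity of $a(\cdot,\omega),V(\cdot,\omega)$, for every $\lambda\ge\beta$ and $\omega\in\Omega$ the equation $a(x,\omega)F''+G(F')+\beta V(x,\omega)=\lambda$, $x\in\mathbb{R}$, has a unique solution $F_1^\lambda(\cdot,\omega)\in C^2(\mathbb{R})$ with $F_1^\lambda(0,\omega)=0$ and $(F_1^\lambda)'(x,\omega)\in[G_1^{-1}(\lambda),G_1^{-1}(\lambda-\beta)]$ for all $x$, and a unique solution $F_2^\lambda(\cdot,\omega)\in C^2(\mathbb{R})$ with $F_2^\lambda(0,\omega)=0$ and $(F_2^\lambda)'(x,\omega)\in[G_2^{-1}(\lambda-\beta),G_2^{-1}(\lambda)]$ for all $x$; the derivatives $(F_i^\lambda)'$ are stationary. Set $\theta_i(\lambda):=\mathbb{E}[(F_i^\lambda)'(0,\omega)]$, $i\in\{1,2\}$. Then $\theta_1:[\beta,+\infty)\to(-\infty,\theta_1(\beta)]$ and $\theta_2:[\beta,+\infty)\to[\theta_2(\beta),+\infty)$ are continuous bijections, decreasing and increasing respectively, with locally Lipschitz inverses, and $\theta_1(\beta)<0<\theta_2(\beta)$. *)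

(* Defs.v *)
From HB Require Import structures.
From mathcomp Require Import all_boot all_order all_algebra.
From mathcomp Require Import all_classical all_reals all_analysis.
Export Order.TTheory GRing.Theory Num.Theory.
Export numFieldNormedType.Exports.

Set Implicit Arguments.
Unset Strict Implicit.
Unset Printing Implicit Defensive.

Local Open Scope ring_scope.
Local Open Scope classical_set_scope.

Section RealFunctions.
Variable R : realType.
Implicit Types (f G : R -> R).

Definition locally_lipschitz f : Prop :=
  forall x : R, exists2 U : set R, nbhs x U & [lipschitz f y | y in U].

Definition C2_line f : Prop :=
  [/\ forall x, derivable f x 1,
      forall x, derivable (derive1 f) x 1 &
      continuous (derive1 (derive1 f))].

(* The inverses of the restrictions of G to the half-lines; the default value
   is only taken outside the image of the half-line. *)
Definition G1_inv G : R -> R := 'pinv_(fun=> 0) `]-oo, 0] G.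
Definition G2_inv G : R -> R := 'pinv_(fun=> 0) `[0, +oo[ G.

End RealFunctions.

(* Points of space-time are pairs z = (t, x). A function on [0, +oo) x R is
   represented by a total function of z, whose values for t < 0 are
   irrelevant. *)
Section SpaceTime.
Variable R : realType.
Implicit Types (u v phi : R * R -> R) (A W g H : R -> R).

Definition open_half_plane : set (R * R) := [set z | 0 < z.1].
Definition closed_half_plane : set (R * R) := [set z | 0 <= z.1].

Definition d_t phi : R * R -> R := fun z => 'D_(1, 0) phi z.
Definition d_x phi : R * R -> R := fun z => 'D_(0, 1) phi z.

Definition C1_half_plane phi : Prop := forall z, open_half_plane z ->
  [/\ derivable phi z (1, 0), derivable phi z (0, 1),
      {for z, continuous (d_t phi)} & {for z, continuous (d_x phi)}].

Definition C2_half_plane phi : Prop :=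
  [/\ C1_half_plane phi, C1_half_plane (d_t phi) & C1_half_plane (d_x phi)].

Definition continuous_half_plane v : Prop :=
  forall z, open_half_plane z -> {for z, continuous v}.

(* The right-hand side A(x) u_xx + H(u_x) + W(x). *)
Definition rhs A H W phi (z : R * R) : R :=
  A z.2 * d_x (d_x phi) z + H (d_x phi z) + W z.2.

Definition viscosity_subsolution A H W v : Prop :=
  continuous_half_plane v /\
  forall z0 phi, open_half_plane z0 -> C2_half_plane phi ->
    (\forall z \near z0, v z - phi z <= v z0 - phi z0) ->
    d_t phi z0 <= rhs A H W phi z0.

Definition viscosity_supersolution A H W v : Prop :=
  continuous_half_plane v /\
  forall z0 phi, open_half_plane z0 -> C2_half_plane phi ->
    (\forall z \near z0, v z0 - phi z0 <= v z - phi z) ->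
    rhs A H W phi z0 <= d_t phi z0.

Definition viscosity_solution A H W v : Prop :=
  viscosity_subsolution A H W v /\ viscosity_supersolution A H W v.

Definition UC_half_plane v : Prop :=
  forall e, 0 < e -> exists2 del, 0 < del &
    forall z z', closed_half_plane z -> closed_half_plane z' ->
      `|z - z'| < del -> `|v z - v z'| < e.

Definition UC_viscosity_solution A H W g v : Prop :=
  [/\ UC_half_plane v, viscosity_solution A H W v & forall x, v (0, x) = g x].

(* Uniqueness is equality on [0, +oo) x R only. *)
Definition unique_UC_viscosity_solution A H W g v : Prop :=
  UC_viscosity_solution A H W g v /\
  forall v', UC_viscosity_solution A H W g v' ->
    {in closed_half_plane, v' =1 v}.

Definition classical_solution H v : Prop :=
  C1_half_plane v /\
  forall z, open_half_plane z -> d_t v z = H (d_x v z).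

Definition cvg_locally_uniformly (v : R -> R * R -> R) (F : set_system R)
    (w : R * R -> R) : Prop :=
  forall K : set (R * R), compact K -> K `<=` closed_half_plane ->
    {uniform K, v @ F --> w}.

End SpaceTime.

Section Environment.
Context (R : realType) (d : measure_display) (Omega : measurableType d).
Variables (P : probability Omega R) (tau : R -> Omega -> Omega).

Definition measure_preserving_group : Prop :=
  [/\ tau 0 = id,
      forall x y, tau (x + y) = tau x \o tau y,
      measurable_fun setT
        (fun p : measurableTypeR R * Omega => tau p.1 p.2) &
      forall x (A : set Omega), measurable A -> P (tau x @^-1` A) = P A].

Definition ergodic : Prop :=
  forall A : set Omega, measurable A -> (forall x, tau x @` A = A) ->
    P A = 0%E \/ P A = 1%E.

Definition stationary (f : R -> Omega -> R) : Prop :=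
  forall x w, f x w = f 0 (tau x w).

End Environment.

Section EffectiveHamiltonian.
Context (R : realType) (d : measure_display) (Omega : measurableType d).
Variables (P : probability Omega R).
Variables (G : R -> R) (a V : R -> Omega -> R) (beta : R).

Definition corrector (I : R -> set R) (lambda : R) (w : Omega) : set (R -> R) :=
  [set F | [/\ C2_line F, F 0 = 0,
      forall x, a x w * derive1 (derive1 F) x + G (derive1 F x)
                + beta * V x w = lambda &
      forall x, I lambda (derive1 F x)]].

Definition slopes1 (lambda : R) : set R :=
  `[G1_inv G lambda, G1_inv G (lambda - beta)].
Definition slopes2 (lambda : R) : set R :=
  `[G2_inv G (lambda - beta), G2_inv G lambda].

(* The unique element of corrector, selected by choice; the default value is
   only taken when there is none. *)
Definition F1 (lambda : R) (w : Omega) : R -> R :=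
  xget (cst 0) (corrector slopes1 lambda w).
Definition F2 (lambda : R) (w : Omega) : R -> R :=
  xget (cst 0) (corrector slopes2 lambda w).

Definition theta1 (lambda : R) : R :=
  fine ('E_P[fun w => derive1 (F1 lambda w) 0])%E.
Definition theta2 (lambda : R) : R :=
  fine ('E_P[fun w => derive1 (F2 lambda w) 0])%E.

Definition theta1_inv : R -> R := 'pinv_(fun=> beta) `[beta, +oo[ theta1.
Definition theta2_inv : R -> R := 'pinv_(fun=> beta) `[beta, +oo[ theta2.

Definition Hbar (theta : R) : R :=
  if theta <= theta1 beta then theta1_inv theta
  else if theta < theta2 beta then beta
  else theta2_inv theta.

End EffectiveHamiltonian.

(* Main.v *)
Require Import Defs.
From HB Require Import structures.
From mathcomp Require Import all_boot all_order all_algebra.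
From mathcomp Require Import all_classical all_reals all_analysis.
From mathcomp Require Import measurable_realfun ring lra.

Import Order.TTheory GRing.Theory Num.Theory numFieldNormedType.Exports.

Set Implicit Arguments.
Unset Strict Implicit.
Unset Printing Implicit Defensive.

Local Open Scope ring_scope.
Local Open Scope classical_set_scope.

(** The solution starting from [theta * x] stays within [o(t + |x|) + C] of
    [theta * x + t * Hbar theta], and the theorem follows by scaling. When
    [theta = theta_i lambda], the function [F_i^lambda x + lambda * t], corrected by a
    small multiple of [sqrt (1 + x ^ 2)], is a smooth barrier lying above or below
    the solution: comparing with it uses only the definition of viscosity
    solutions, without doubling of variables. By the ergodic theorem
    [F_i^lambda x - theta * x] is sublinear in [x]. When [theta] lies between
    [theta_1 beta] and [theta_2 beta], the upper barrier has the minimal slope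
    [f1 <= 0] to the left of a hill and [f2 >= 0] to its right. On a hill with
    [V] close to 1 and large [\int 1/a], both slopes are nearly zero in the
    middle, where they can be interpolated at a small cost; the lower barrier
    exchanges the roles of [f1] and [f2]. Such hills occur with positive density,
    hence within [o(|x|) + C] of every point [x]. *)

(** * Real functions *)

(** A barrier is of class C^2, so it serves directly as a test function. What remains is to make its
    difference with the solution attain a maximum, and to keep barrier slopes bounded, so that a
    local Lipschitz constant of [G] prices the small corrections. The diffusion [a] may approach 0,
    but [a <= 1], and dividing the corrector equation by [a] only strengthens the differential
    inequalities used. [F1] and [F2] are picked by choice, without measurability in the environment:
    the slopes are therefore built as decreasing limits of explicit, jointly measurable iterates,
    and uniqueness identifies them with the derivatives of the chosen correctors. The branch of
    [theta1] is that of [theta2] reflected by [x -> - x]. On the flat piece, a barrier bent at one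
    hill leaves the line [th * x] linearly on both sides of it. Hence the barrier changes with the
    point: for each [z] it is bent at a hill near [z.2], and the constants must not depend on the
    hill. Only countably many null sets are discarded, so that one set of environments serves every
    [theta]. *)

Section RealLine.
Variable R : realType.
Implicit Types f g w : R -> R.

Lemma lipschitz_inP f (U : set R) :
  [lipschitz f y | y in U] <->
  exists2 L : R, 0 < L &
    forall x y, U x -> U y -> `|f x - f y| <= L * `|x - y|.
Proof.
split.
- move=> fL.
  have : exists2 L : R, 0 < L & L.-lipschitz_U f.
    near (+oo_R) => M; exists M => //; near: M.
    exact: fL.
  move=> [L L0 fLU]; exists L => // x y Ux Uy.
  exact: (fLU (x, y)).
- move=> [L L0 fL]; rewrite /lipschitz_on; near=> M => -[x y] [/= Ux Uy].
  change (`|f x - f y| <= M * `|x - y|).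
  apply: (le_trans (fL _ _ Ux Uy)); rewrite ler_wpM2r//.
Unshelve. all: by end_near. Qed.

Lemma locally_lipschitz_continuous f : locally_lipschitz f -> continuous f.
Proof.
move=> fL x; have [U Ux /lipschitz_inP[L L0 fLU]] := fL x.
apply/cvgrPdist_le => e e0; near=> y.
apply: (@le_trans _ _ (L * `|x - y|)).
  by apply: fLU; [exact: nbhs_singleton|near: y].
rewrite -ler_pdivlMl//; near: y.
by apply: cvgr_dist_le; [exact: cvg_id|rewrite mulr_gt0 ?invr_gt0].
Unshelve. all: by end_near. Qed.

Lemma near_continuous f x e : {for x, continuous f} -> 0 < e ->
  \forall z \near x, `|f x - f z| < e.
Proof. by move=> fx e0; move: fx => /cvgrPdist_lt; exact. Qed.

Lemma near_ball (x e : R) : 0 < e -> \forall z \near x, `|x - z| < e.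
Proof. by move=> e0; apply: (@near_continuous id) => //; exact: cvg_id. Qed.

(** Compactness is used on the square of pairs rather than on the segment. Near the diagonal a local
    constant works; away from it distances are bounded below and increments are bounded by
    continuity. *)
Lemma locally_lipschitz_segment f : locally_lipschitz f ->
  forall M : R, exists2 L : R, 0 < L &
    forall x y, `|x| <= M -> `|y| <= M -> `|f x - f y| <= L * `|x - y|.
Proof.
move=> fL M.
have fc := locally_lipschitz_continuous fL.
pose K := (`[- M, M] `*` `[- M, M])%classic : set (R * R).
have /compact_near_coveringP cvr : compact K.
  by apply: compact_setX; exact: segment_compact.
have H : \forall L \near +oo_R,
    K `<=` [set z | `|f z.1 - f z.2| <= L * `|z.1 - z.2|].
  apply: (cvr R +oo_R
    (fun L z => `|f z.1 - f z.2| <= L * `|z.1 - z.2|)) => -[x y] _ /=.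
  have [<-|xy] := eqVneq x y.
    have [U Ux /lipschitz_inP[L L0 fLU]] := fL x.
    exists (U `*` U, [set L' | L <= L']) => /=.
      split; first by exists (U, U).
      by apply: nbhs_pinfty_ge; exact: num_real.
    move=> -[[z1 z2] L'] /= [[Uz1 Uz2] LL'].
    by rewrite (le_trans (fLU _ _ Uz1 Uz2))// ler_wpM2r.
  have d0 : 0 < `|x - y| by rewrite normr_gt0 subr_eq0.
  (* With this radius the perturbed points stay at distance at least half of [|x - y|]. *)
  pose r := `|x - y| / 4.
  have r0 : 0 < r by rewrite divr_gt0.
  pose U1 := [set z | `|x - z| < r] `&` [set z | `|f x - f z| < 1].
  pose U2 := [set z | `|y - z| < r] `&` [set z | `|f y - f z| < 1].
  exists (U1 `*` U2, [set L' | (`|f x - f y| + 2) / (`|x - y| / 2) <= L']) => /=.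
    split; last by apply: nbhs_pinfty_ge; exact: num_real.
    exists (U1, U2) => //=; split; apply: filterI.
    - by apply: near_ball.
    - by apply: near_continuous => //; exact: fc.
    - by apply: near_ball.
    - by apply: near_continuous => //; exact: fc.
  move=> -[[z1 z2] L'] /= [[[xz fxz] [yz fyz]] LL'].
  have h1 : `|x - y| / 2 <= `|z1 - z2|.
    have := ler_distD z1 x y; have := ler_distD z2 z1 y.
    by move: xz yz; rewrite (distrC z2 y) /r/=; lra.
  have h2 : `|f z1 - f z2| <= `|f x - f y| + 2.
    have := ler_distD (f x) (f z1) (f z2); have := ler_distD (f y) (f x) (f z2).
    by move: fxz fyz; rewrite (distrC (f z1) (f x))/=; lra.
  apply: (le_trans h2).
  have q0 : 0 <= (`|f x - f y| + 2) / (`|x - y| / 2).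
    by rewrite divr_ge0// ?addr_ge0// divr_ge0.
  apply: (@le_trans _ _ ((`|f x - f y| + 2) / (`|x - y| / 2) * (`|x - y| / 2))).
    by rewrite divfK// gt_eqF// divr_gt0.
  by apply: ler_pM => //; rewrite divr_ge0.
have : exists2 L : R, 0 < L & K `<=` [set z | `|f z.1 - f z.2| <= L * `|z.1 - z.2|].
  by near (+oo_R) => L; exists L => //; near: L.
move=> [L L0 KL]; exists L => // x y xM yM.
by apply: (KL (x, y)); split; rewrite /= in_itv/= -ler_norml.
Unshelve. all: by end_near. Qed.

Lemma locally_lipschitz_of_segment f :
  (forall M : R, exists2 L : R, 0 < L &
    forall x y, `|x| <= M -> `|y| <= M -> `|f x - f y| <= L * `|x - y|) ->
  locally_lipschitz f.
Proof.
move=> fL x; have [L L0 H] := fL (`|x| + 1).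
exists (ball x 1); first exact: nbhsx_ballx.
have B y : ball x 1 y -> `|y| <= `|x| + 1.
  rewrite /ball/= => xy; have := ler_normD (y - x) x.
  by rewrite subrK distrC; lra.
by apply/lipschitz_inP; exists L => // y z /B yx /B zx; exact: H.
Qed.

(** The maximum of [g] over the segment is attained at [y]: at a maximum [z > y] the left difference
    quotients are nonnegative, against the sign assumed for the derivative. Only left quotients
    enter, so [z = x] is covered. *)
Lemma argmax_left_growth g y x : y <= x ->
  (forall z, y <= z <= x -> derivable g z 1) ->
  (forall z, y <= z <= x -> g x <= g z -> derive1 g z < 0) ->
  g x <= g y.
Proof.
move=> yx dg g'lt.
have gc : {within `[y, x], continuous g}.
  by apply: derivable_within_continuous => z; rewrite in_itv/= => zi; exact: dg.
have [z] := EVT_max yx gc.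
rewrite in_itv/= => /andP[yz zx] zmax.
have gxz : g x <= g z by apply: zmax; rewrite in_itv/= yx lexx.
move: yz; rewrite le_eqVlt => /orP[/eqP -> //|yz].
have zi : y <= z <= x by rewrite ltW.
have /cvg_ex[l gl] := dg z zi.
have lE : derive1 g z = l by rewrite derive1E; apply/cvg_lim.
have := g'lt z zi gxz; rewrite lE ltNge => /negP; case.
have gl' := cvg_dnbhs_at_left gl.
rewrite -(cvg_lim _ gl')//; apply: limr_ge; first by apply/cvg_ex; exists l.
near=> h.
have h0 : h < 0 by near: h; exact: nbhs_left_lt.
rewrite /GRing.scale/= mulr_le0//; first by rewrite invr_le0 ltW.
rewrite mulr1 subr_le0; apply: zmax; rewrite in_itv/=; apply/andP; split.
  by rewrite -lerBlDr ltW//; near: h; apply: nbhs_left_gt; lra.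
by rewrite (le_trans _ zx)// gerDr ltW.
Unshelve. all: by end_near. Qed.

(** Above the level [c] the function grows at rate at least [m] when followed to the left, so it
    stays above [c] and eventually exceeds its bound. Boundedness thus plays the part of a condition
    at minus infinity. *)
Lemma entire_comparison w (c m M : R) : 0 < m ->
  (forall x : R, derivable w x 1) -> (forall x, `|w x| <= M) ->
  (forall x, c < w x -> derive1 w x <= - m) -> forall x, w x <= c.
Proof.
move=> m0 dw wM w'm x; rewrite leNgt; apply/negP => cwx.
(* Over this length a slope of [m / 2] gains [2 * M + 1], more than [w] can oscillate. *)
pose y := x - (2 * M + 1) * 2 / m.
have M0 : 0 <= M by exact: le_trans (normr_ge0 _) (wM x).
have yx : y <= x.
  by rewrite /y gerBl; apply: divr_ge0; [apply: mulr_ge0; lra|exact: ltW].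
pose g z := w z + (m / 2) * z.
have dg (z : R) : is_derive z (1 : R) g (derive1 w z + m / 2).
  have dwz : is_derive z (1 : R) w (derive1 w z) by rewrite derive1E; apply: derivableP.
  by rewrite -[m / 2 in X in is_derive _ _ _ X]mulr1; apply: is_deriveD.
have := @argmax_left_growth g y x yx.
have H1 : forall z, y <= z <= x -> derivable g z 1 by [].
move=> /(_ H1) H.
have : g x <= g y.
  apply: H => z /andP[yz zx] gxz; rewrite derive1E derive_val.
  have : c < w z.
    apply: (lt_le_trans cwx).
    have : m / 2 * z <= m / 2 * x by rewrite ler_wpM2l// divr_ge0// ltW.
    by move: gxz; rewrite /g; lra.
  by move=> /w'm; lra.
rewrite /g /y mulrBr.
have -> : m / 2 * ((2 * M + 1) * 2 / m) = 2 * M + 1 by field; rewrite gt_eqF.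
have := wM x; have := wM (x - (2 * M + 1) * 2 / m).
by rewrite !ler_norml => /andP[_ ?] /andP[? _]; lra.
Qed.

End RealLine.

Section Calculus1.
Variable R : realType.
Implicit Types f g S T : R -> R.

Lemma is_derive1 f (x df : R) : is_derive x (1 : R) f df -> derive1 f x = df.
Proof. by move=> fdf; rewrite derive1E derive_val. Qed.

Lemma derivable_is_derive f (x : R) :
  derivable f x 1 -> is_derive x (1 : R) f (derive1 f x).
Proof. by move=> df; rewrite derive1E; exact: derivableP. Qed.

Definition C1_line f := (forall x : R, derivable f x 1) /\ continuous (derive1 f).

Lemma derivable_continuous f : (forall x : R, derivable f x 1) -> continuous f.
Proof.
by move=> df x; apply: differentiable_continuous; apply/derivable1_diffP.
Qed.

Lemma C2_line_of f df ddf : (forall x : R, is_derive x (1 : R) f (df x)) ->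
  (forall x : R, is_derive x (1 : R) df (ddf x)) -> continuous ddf ->
  [/\ C2_line f, derive1 f = df & derive1 (derive1 f) = ddf].
Proof.
move=> f1 f2 cf.
have E1 : derive1 f = df by apply/funext => x; apply: is_derive1.
have E2 : derive1 df = ddf by apply/funext => x; apply: is_derive1.
by rewrite E1 E2; split => //; split; rewrite ?E1 ?E2// => x.
Qed.

Lemma C1_line_of f df : (forall x : R, is_derive x (1 : R) f (df x)) ->
  continuous df -> C1_line f /\ derive1 f = df.
Proof.
move=> f1 cf.
have E1 : derive1 f = df by apply/funext => x; apply: is_derive1.
by rewrite /C1_line E1; split => //; split => // x.
Qed.

Lemma C1_line_cst (c : R) : C1_line (cst c).
Proof.
split => [x|]; first exact: derivable_cst.
rewrite (_ : derive1 _ = cst 0); first by move=> x; exact: cvg_cst.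
by apply/funext => x; rewrite derive1_cst.
Qed.

Lemma C2_lineW S : C2_line S -> C1_line S /\ C1_line (derive1 S).
Proof.
move=> [dS ddS cS].
have cdS := derivable_continuous ddS.
by split; [exact: (conj dS cdS)|exact: (conj ddS cS)].
Qed.

End Calculus1.

(** * Barriers for viscosity solutions *)

Section HalfPlane.
Variable R : realType.
Implicit Types (phi v : R * R -> R) (S T : R -> R).

(** The two quotients are the same function of [h], so partial derivatives on pairs become
    one-variable derivatives of slices. *)
Lemma quotient_t phi (z : R * R) :
  (fun h : R => h^-1 *: ((phi \o shift z) (h *: (1, 0)) - phi z)) =
  (fun h : R => h^-1 *:
     (((fun t => phi (t, z.2)) \o shift z.1) (h *: 1) - phi (z.1, z.2))).
Proof.
case: z => t x; apply/funext => h /=; congr (_ *: (phi _ - _)).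
by congr (_, _); rewrite /= /GRing.scale/= mulr0 add0r.
Qed.

Lemma quotient_x phi (z : R * R) :
  (fun h : R => h^-1 *: ((phi \o shift z) (h *: (0, 1)) - phi z)) =
  (fun h : R => h^-1 *:
     (((fun x => phi (z.1, x)) \o shift z.2) (h *: 1) - phi (z.1, z.2))).
Proof.
case: z => t x; apply/funext => h /=; congr (_ *: (phi _ - _)).
by congr (_, _); rewrite /= /GRing.scale/= mulr0 add0r.
Qed.

Lemma d_tE phi z : d_t phi z = derive1 (fun t => phi (t, z.2)) z.1.
Proof. by rewrite derive1E /d_t /derive quotient_t. Qed.

Lemma d_xE phi z : d_x phi z = derive1 (fun x => phi (z.1, x)) z.2.
Proof. by rewrite derive1E /d_x /derive quotient_x. Qed.

Lemma derivable_tE phi (z : R * R) :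
  derivable phi z (1, 0) = derivable (fun t => phi (t, z.2)) z.1 1.
Proof. by rewrite /derivable quotient_t. Qed.

Lemma derivable_xE phi (z : R * R) :
  derivable phi z (0, 1) = derivable (fun x => phi (z.1, x)) z.2 1.
Proof. by rewrite /derivable quotient_x. Qed.

Lemma continuous_fst T (z : R * R) : {for z.1, continuous T} ->
  {for z, continuous (fun z => T z.1)}.
Proof.
move=> cT A /cT TA; exists (T @^-1` A, setT) => [/=|[a b] [] //].
by split => //; exact: filterT.
Qed.

Lemma continuous_snd S (z : R * R) : {for z.2, continuous S} ->
  {for z, continuous (fun z => S z.2)}.
Proof.
move=> cS A /cS SA; exists (setT, S @^-1` A) => [/=|[a b] [] //].
by split => //; exact: filterT.
Qed.

Lemma continuous_sep S T : continuous S -> continuous T ->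
  continuous (fun z : R * R => T z.1 + S z.2).
Proof.
move=> cS cT z; apply: cvgD; first exact: (continuous_fst (cT z.1)).
exact: (continuous_snd (cS z.2)).
Qed.

(** Every barrier is the sum of a function of time and a function of space. *)
Lemma C1_half_plane_sep T S : C1_line T -> C1_line S ->
  [/\ C1_half_plane (fun z => T z.1 + S z.2),
      d_t (fun z => T z.1 + S z.2) = (fun z => derive1 T z.1) &
      d_x (fun z => T z.1 + S z.2) = (fun z => derive1 S z.2)].
Proof.
move=> [dT cT] [dS cS].
have dtE : d_t (fun z => T z.1 + S z.2) = (fun z => derive1 T z.1).
  apply/funext => -[t x]; rewrite d_tE/=; apply: is_derive1.
  rewrite -[derive1 T t]addr0; apply: is_deriveD.
  exact: derivable_is_derive.
have dxE : d_x (fun z => T z.1 + S z.2) = (fun z => derive1 S z.2).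
  apply/funext => -[t x]; rewrite d_xE/=; apply: is_derive1.
  rewrite -[derive1 S x]add0r; apply: is_deriveD.
  exact: derivable_is_derive.
split=> // -[t x] _; split.
- by rewrite derivable_tE/=; apply: derivableD.
- by rewrite derivable_xE/=; apply: derivableD.
- by rewrite dtE; apply: (@continuous_fst (derive1 T) (t, x)); exact: cT.
- by rewrite dxE; apply: (@continuous_snd (derive1 S) (t, x)); exact: cS.
Qed.

Lemma C2_half_plane_sep T S : C2_line T -> C2_line S ->
  [/\ C2_half_plane (fun z => T z.1 + S z.2),
      d_t (fun z => T z.1 + S z.2) = (fun z => derive1 T z.1),
      d_x (fun z => T z.1 + S z.2) = (fun z => derive1 S z.2) &
      d_x (d_x (fun z => T z.1 + S z.2)) = (fun z => derive1 (derive1 S) z.2)].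
Proof.
move=> /C2_lineW[T1 T2] /C2_lineW[S1 S2].
have [P1 P2 P3] := C1_half_plane_sep T1 S1.
have E1 : (fun z : R * R => derive1 T z.1) = (fun z => derive1 T z.1 + cst 0 z.2).
  by apply/funext => z; rewrite addr0.
have E2 : (fun z : R * R => derive1 S z.2) = (fun z => cst 0 z.1 + derive1 S z.2).
  by apply/funext => z; rewrite add0r.
have [Q1 Q2 Q3] := C1_half_plane_sep T2 (C1_line_cst 0).
have [N1 N2 N3] := C1_half_plane_sep (C1_line_cst 0) S2.
rewrite -E1 in Q1; rewrite -E2 in N1 N3.
split; [|exact: P2|exact: P3|exact: (etrans (congr1 (@d_x R) P3) N3)].
by split; [exact: P1|rewrite P2; exact: Q1|rewrite P3; exact: N1].
Qed.

Lemma UC_near v z e : UC_half_plane v -> closed_half_plane z -> 0 < e ->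
  \forall z' \near z, closed_half_plane z' -> `|v z - v z'| < e.
Proof.
move=> ucv z0 /ucv[del del0 H]; near=> z' => z'0; apply: H => //.
Unshelve. all: by end_near. Qed.

Lemma UC_continuous_within v : UC_half_plane v ->
  {within @closed_half_plane R, continuous v}.
Proof.
move=> ucv; apply/subspace_continuousP => z z0.
apply/cvgrPdist_lt => e e0; exact: UC_near.
Qed.

Lemma open_half_plane_open : open (@open_half_plane R).
Proof.
rewrite (_ : @open_half_plane R = fst @^-1` [set t : R | 0 < t]) //.
apply: open_comp; last exact: open_gt.
by move=> z _; exact: cvg_fst.
Qed.

(** If [v - phi] were positive somewhere, it would have a positive maximum over the box cut out by
    [B], at a positive time because of the initial inequality. There [phi] is an admissible test
    function, and its strict inequality contradicts the definition of a subsolution. *)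
Lemma viscosity_subsolution_le (A H W : R -> R) v phi (B : R) :
  viscosity_subsolution A H W v -> UC_half_plane v ->
  C2_half_plane phi -> continuous phi ->
  (forall z, open_half_plane z -> rhs A H W phi z < d_t phi z) ->
  (forall x, v (0, x) <= phi (0, x)) ->
  (forall z, closed_half_plane z -> B < z.1 \/ B < `|z.2| -> v z <= phi z) ->
  forall z, closed_half_plane z -> v z <= phi z.
Proof.
move=> [_ sub] ucv C2phi cphi strict init out z z0.
rewrite leNgt; apply/negP => vz.
pose K := (`[0, B] `*` `[- B, B])%classic : set (R * R).
have KP (y : R * R) : closed_half_plane y -> ~ K y -> v y <= phi y.
  move=> y0 Ky; apply: out => //.
  have [h|h] := ltP B y.1; first by left.
  right; rewrite ltNge; apply/negP => h2; apply: Ky; split => /=.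
    by rewrite in_itv/=; apply/andP; split.
  by rewrite in_itv/= -ler_norml.
have Kz : K z.
  by apply: contrapT => /(KP _ z0); rewrite leNgt vz.
have cK : compact K by apply: compact_setX; exact: segment_compact.
have Kc : K `<=` @closed_half_plane R.
  by move=> -[t x] [/=]; rewrite in_itv/= => /andP[].
have cw : {within K, continuous (fun y => v y - phi y)}.
  move=> y; apply: (@cvgB _ R^o).
    exact: (continuous_subspaceW Kc (UC_continuous_within ucv)).
  exact: (continuous_subspaceT cphi).
have [c] := compact_EVT_max (ex_intro _ z Kz) cK cw.
rewrite inE => Kcc cmax.
have wc : v z - phi z <= v c - phi c by apply: cmax; rewrite inE.
have c0 : open_half_plane c.
  have := Kc _ Kcc; rewrite /closed_half_plane/open_half_plane/= le_eqVlt.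
  move=> /orP[/eqP c1|//]; have := init c.2.
  by rewrite [X in (X, _)]c1 -surjective_pairing; lra.
have := sub c phi c0 C2phi.
rewrite leNgt strict//=; move=> /(_ _)/negP; case=> //.
(* The maximum point may lie on the edge of the box; it is still a local maximum, because [v - phi]
   is nonpositive outside the box and positive at the maximum. *)
have := open_half_plane_open; rewrite openE => /(_ _ c0); rewrite /interior.
apply: filterS => y y0.
have [Ky|/KP] := pselect (K y); first by apply: cmax; rewrite inE.
by move=> /(_ (ltW y0)); lra.
Qed.

(** Uniform continuity with tolerance 1 bounds by 1 the change of [v] over a time step [del / 2] at
    fixed [x]; the number of steps from time 0 is linear in the time. *)
Lemma UC_growth v (th : R) : UC_half_plane v -> (forall x, v (0, x) = th * x) ->
  exists2 C : R, 0 <= C & forall z, closed_half_plane z ->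
    `|v z - th * z.2| <= C * (1 + z.1).
Proof.
move=> ucv v0; have [del del0 H] := ucv 1 ltr01.
pose h := del / 2.
have h0 : 0 < h by rewrite divr_gt0.
have step (n : nat) (t x : R) : 0 <= t <= n%:R * h -> `|v (t, x) - th * x| <= n%:R.
  elim: n t => [|n IHn] t.
    rewrite mul0r => /andP[t0 t0']; have -> : t = 0 by lra.
    by rewrite v0 subrr normr0.
  rewrite -natr1 mulrDl mul1r => /andP[t0 tn].
  have [th'|th'] := leP t (n%:R * h).
    have := IHn t; rewrite t0 th' => /(_ isT); lra.
  have n0 : 0 <= n%:R * h by rewrite mulr_ge0// ltW.
  have := IHn (n%:R * h); rewrite n0 lexx => /(_ isT).
  have : `|v (t, x) - v (n%:R * h, x)| < 1.
    apply: H => //; rewrite prod_normE/= subrr normr0.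
    by rewrite gt_max del0 andbT gtr0_norm; rewrite /h in tn th' *; lra.
  have := ler_distD (v (n%:R * h, x)) (v (t, x)) (th * x); lra.
exists (h^-1 + 1); first by rewrite addr_ge0// invr_ge0 ltW.
move=> [t x] /= t0; rewrite /closed_half_plane/= in t0.
pose n := (Num.truncn (t / h)).+1.
have /andP[n1 n2] := truncn_itv (divr_ge0 t0 (ltW h0)).
apply: (le_trans (step n t x _)).
  by rewrite t0/= -ler_pdivrMr// ltW.
rewrite /n -natr1.
have : (t / h) <= h^-1 * (1 + t).
  by rewrite mulrC ler_pM2l ?invr_gt0//; lra.
lra.
Qed.

(* Since [v] is uniformly continuous it grows at most linearly, and [eta] makes
   the difference with the barrier attain its maximum. *)
Lemma barrier_above (A H W : R -> R) v S (th kap eta C : R) :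
  UC_half_plane v -> viscosity_subsolution A H W v ->
  (forall x, v (0, x) = th * x) -> C2_line S ->
  (forall x, A x * derive1 (derive1 S) x + H (derive1 S x) + W x <= kap) ->
  0 < eta -> (forall x, th * x + eta * `|x| - C <= S x) ->
  forall z, closed_half_plane z -> v z <= S z.2 + C + kap * z.1.
Proof.
move=> ucv sub v0 C2S SH eta0 Sth.
have [C0 C00 vC] := UC_growth ucv v0.
(* The linear term in [e] makes the barrier strict and the quadratic one dominates the growth of [v]
   in time; both vanish with [e]. *)
suff He (e : R) : 0 < e -> forall z, closed_half_plane z ->
    v z <= (kap + e) * z.1 + e * z.1 ^+ 2 + (S z.2 + C).
  move=> [t x]; rewrite /closed_half_plane/= => t0.
  apply/ler_addgt0Pr => e e0.
  have q0 : 0 < t + t ^+ 2 + 1 by rewrite ltr_wpDl// addr_ge0// sqr_ge0.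
  have := He (e / (t + t ^+ 2 + 1)) (divr_gt0 e0 q0) (t, x) t0.
  have : e / (t + t ^+ 2 + 1) * (t + t ^+ 2) <= e.
    by rewrite mulrAC ler_pdivrMr// ler_pM2l//; lra.
  by move: (e / _) => u /=; lra.
move=> e0.
pose T (t : R) := (kap + e) * t + e * t ^+ 2.
pose S1 (x : R) := S x + C.
have [C2T T1 T2] : [/\ C2_line T, derive1 T = (fun t => kap + e + 2 * e * t) &
    derive1 (derive1 T) = cst (2 * e)].
  apply: C2_line_of.
  - move=> t; apply: is_derive_eq; rewrite /GRing.scale/=; ring.
  - move=> t; apply: is_derive_eq; rewrite /GRing.scale/=; ring.
  - by move=> t; exact: cvg_cst.
have [C2S1 S11 S12] : [/\ C2_line S1, derive1 S1 = derive1 S &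
    derive1 (derive1 S1) = derive1 (derive1 S)].
  have [dS ddS cS] := C2S.
  apply: C2_line_of.
  - move=> x; rewrite -[derive1 S x]addr0; apply: is_deriveD.
    exact: derivable_is_derive.
  - by move=> x; exact: derivable_is_derive.
  - exact: cS.
have [C2phi phit phix phixx] := C2_half_plane_sep C2T C2S1.
pose phi (z : R * R) := T z.1 + S1 z.2.
(* [D] bounds [C0 * (1 + t) - T t] over all times, by completing the square, so the barrier wins
   beyond [D / eta] in space. The other two summands of [B] make it win at large times. *)
pose D := C0 + (`|kap| + C0) ^+ 2 / e.
pose B := D / eta + 1 + (`|kap| + 2 * C0) / e.
apply: (@viscosity_subsolution_le A H W v phi B sub ucv C2phi).
- apply: continuous_sep.
    by apply: derivable_continuous => x; have [] := C2S1.
  by apply: derivable_continuous => x; have [] := C2T.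
- move=> [t x]; rewrite /open_half_plane/= => t0.
  rewrite /rhs phixx phit phix T1 S11/=.
  apply: (le_lt_trans (SH x)); rewrite -addrA ltrDl.
  by move: (mulr_gt0 e0 t0); clear -e0; lra.
- move=> x; clear phit phix phixx C2phi C2S1 C2T S11 S12 T1 T2.
  rewrite v0 /phi /T /S1/= mulr0 expr0n/= mulr0 !add0r.
  have := Sth x; have : 0 <= eta * `|x| by rewrite mulr_ge0// ltW.
  lra.
- move=> [t x]; rewrite /closed_half_plane/= => t0 out.
  clear phit phix phixx C2phi C2S1 C2T S11 S12 T1 T2.
  have := vC (t, x) t0; rewrite ler_norml/= => /andP[_ h1].
  have h2 := Sth x.
  suff : C0 * (1 + t) <= eta * `|x| + T t by rewrite /phi/= /S1; lra.
  have k1 := ler_norm (- kap); rewrite normrN in k1.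
  have k2 : - `|kap| * t <= kap * t by rewrite ler_wpM2r//; lra.
  have ek : 0 <= (`|kap| + C0) ^+ 2 / e by rewrite divr_ge0 ?sqr_ge0// ltW.
  have D0 : 0 <= D by rewrite /D; lra.
  have x0 : 0 <= eta * `|x| by rewrite mulr_ge0// ltW.
  have kc : 0 <= (`|kap| + 2 * C0) / e.
    by apply: divr_ge0; [rewrite addr_ge0// mulr_ge0|exact: ltW].
  have et0 : 0 <= e * t by rewrite mulr_ge0// ltW.
  case: out => [tB|xB].
    have t1 : 1 <= t.
      have : 0 <= D / eta by rewrite divr_ge0// ltW.
      by rewrite /B in tB; lra.
    have : (`|kap| + 2 * C0) <= e * t.
      rewrite -ler_pdivrMl// mulrC; have : 0 <= D / eta by rewrite divr_ge0// ltW.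
      by rewrite /B in tB; lra.
    move=> /(ler_wpM2r t0).
    have : C0 <= C0 * t by rewrite ler_peMr.
    by rewrite /T expr2; lra.
  have : D <= eta * `|x|.
    rewrite -ler_pdivrMl// mulrC; rewrite /B in xB; lra.
  have : (`|kap| + C0) * t <= e * t ^+ 2 + (`|kap| + C0) ^+ 2 / e.
    move: (`|kap| + C0) (addr_ge0 (normr_ge0 kap) C00) => u u0.
    have -> : u ^+ 2 / e = e * (u / e) ^+ 2 by field; rewrite gt_eqF.
    have -> : u * t = e * ((u / e) * t) by field; rewrite gt_eqF.
    rewrite -mulrDr ler_pM2l//; nra.
  by rewrite /T /D; lra.
Qed.

(** A smooth stand-in for [|x|], with first and second derivatives bounded by 1. *)
Definition sqrt1 (x : R) : R := Num.sqrt (1 + x ^+ 2).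

Lemma sqrt1_gt0 x : 0 < sqrt1 x.
Proof. by rewrite sqrtr_gt0 ltr_wpDr// sqr_ge0. Qed.

Lemma sqrt1_sqr x : sqrt1 x ^+ 2 = 1 + x ^+ 2.
Proof. by rewrite sqr_sqrtr// addr_ge0// sqr_ge0. Qed.

Lemma le_norm_sqrt1 x : `|x| <= sqrt1 x.
Proof.
by rewrite -sqrtr_sqr ler_sqrt ?addr_ge0 ?sqr_ge0// lerDr.
Qed.

Lemma sqrt1_le x : sqrt1 x <= 1 + `|x|.
Proof.
rewrite -(@ler_pXn2r _ 2)// ?nnegrE ?addr_ge0// ?(ltW (sqrt1_gt0 x))//.
by rewrite sqrt1_sqr -(real_normK (num_real x)); have := normr_ge0 x; nra.
Qed.

Lemma sqrt1_ge1 x : 1 <= sqrt1 x.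
Proof.
rewrite -(@ler_pXn2r _ 2)// ?nnegrE ?(ltW (sqrt1_gt0 x))//.
by rewrite sqrt1_sqr expr1n lerDl sqr_ge0.
Qed.

Lemma sqrt1_C2 : [/\ C2_line sqrt1, forall x, `|derive1 sqrt1 x| <= 1 &
  forall x, 0 <= derive1 (derive1 sqrt1) x <= 1].
Proof.
have d1 (x : R) : is_derive x (1 : R) sqrt1 (x / sqrt1 x).
  have d0 : is_derive x (1 : R) (fun x : R => 1 + x ^+ 2) (2 * x).
    by apply: is_derive_eq; rewrite /GRing.scale/=; ring.
  have h : 0 < 1 + x ^+ 2 by rewrite ltr_wpDr// sqr_ge0.
  have := @is_derive1_comp R Num.sqrt (fun x : R => 1 + x ^+ 2) x _ _ (is_derive1_sqrt h) d0.
  rewrite -/(sqrt1 x) => hd; apply: is_derive_eq.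
  by field; rewrite gt_eqF// sqrt1_gt0.
have d2 (x : R) : is_derive x (1 : R) (fun x => x / sqrt1 x) ((sqrt1 x)^-1 ^+ 3).
  have n0 : sqrt1 x != 0 by rewrite gt_eqF// sqrt1_gt0.
  have dV := is_deriveV n0 (d1 x).
  apply: is_derive_eq; rewrite /GRing.scale/=.
  apply: (@mulIf _ (sqrt1 x ^+ 3)); first by rewrite expf_neq0.
  rewrite -exprMn mulVf// expr1n.
  transitivity (sqrt1 x ^+ 2 - x ^+ 2); first by field.
  by rewrite sqrt1_sqr addrK.
have cs : continuous sqrt1 by apply: derivable_continuous => x.
have [C2 E1 E2] : [/\ C2_line sqrt1, derive1 sqrt1 = (fun x => x / sqrt1 x) &
    derive1 (derive1 sqrt1) = (fun x => (sqrt1 x)^-1 ^+ 3)].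
  apply: C2_line_of => // x; apply: (@continuous_comp _ _ _ (fun x => (sqrt1 x)^-1) (fun y => y ^+ 3)).
    by apply: cvgV; [rewrite gt_eqF// sqrt1_gt0|exact: cs].
  exact: exprn_continuous.
split=> // x; rewrite ?E2 ?E1.
  by rewrite normrM normfV (gtr0_norm (sqrt1_gt0 x)) ler_pdivrMr ?sqrt1_gt0// mul1r le_norm_sqrt1.
rewrite exprn_ge0 ?invr_ge0 ?(ltW (sqrt1_gt0 x))//=.
by rewrite exprn_ile1// ?invr_ge0 ?(ltW (sqrt1_gt0 x))// invf_le1 ?sqrt1_gt0// sqrt1_ge1.
Qed.

Definition lipschitz_ball (H : R -> R) (M L : R) := 0 < L /\ 
  forall p q : R, `|p| <= M -> `|q| <= M -> `|H p - H q| <= L * `|p - q|.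

(** Of the added [2 * del * sqrt1], one half compensates the deficit [del * |x|] of [S] and the
    other half is the coercivity that [barrier_above] asks for. This costs at most [2 * del] in the
    diffusion term and [2 * del * L] in [H]; the bound on [del] keeps the perturbed slope within
    [M + 1]. *)
Lemma viscosity_le_barrier (A H W : R -> R) v S (th kap del C M L : R) :
  UC_half_plane v -> viscosity_subsolution A H W v ->
  (forall x, v (0, x) = th * x) -> (forall x, 0 <= A x <= 1) ->
  lipschitz_ball H (M + 1) L -> C2_line S ->
  (forall x, `|derive1 S x| <= M) ->
  (forall x, A x * derive1 (derive1 S) x + H (derive1 S x) + W x <= kap) ->
  0 < del <= 2^-1 -> (forall x, th * x - del * `|x| - C <= S x) ->
  forall z, closed_half_plane z ->
    v z <= S z.2 + 2 * del * sqrt1 z.2 + C + (kap + 2 * del * (1 + L)) * z.1.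
Proof.
move=> ucv sub v0 A01 [L0 HL] C2S SM SH /andP[del0 del1] Sth.
have [C2q q1 q2] := sqrt1_C2.
pose S1 (x : R) := S x + 2 * del * sqrt1 x.
have [C2S1 S11 S12] : [/\ C2_line S1,
    derive1 S1 = (fun x => derive1 S x + 2 * del * derive1 sqrt1 x) &
    derive1 (derive1 S1) =
      (fun x => derive1 (derive1 S) x + 2 * del * derive1 (derive1 sqrt1) x)].
  have [dS ddS cS] := C2S; have [dq ddq cq] := C2q.
  apply: C2_line_of.
  - move=> x; have := derivable_is_derive (dS x); have := derivable_is_derive (dq x).
    by move=> ? ?; apply: is_deriveD; exact: is_deriveZ.
  - move=> x; have := derivable_is_derive (ddS x); have := derivable_is_derive (ddq x).
    by move=> ? ?; apply: is_deriveD; exact: is_deriveZ.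
  - by move=> x; apply: cvgD; [exact: cS|apply: cvgMr; exact: cq].
move=> z z0.
have := @barrier_above A H W v S1 th (kap + 2 * del * (1 + L)) del C ucv sub v0 C2S1 _ del0 _ z z0.
rewrite /S1/= => h.
apply: h => x.
  rewrite -/S1 S12 S11.
  move: (SH x) (A01 x) (q1 x) (q2 x) (SM x).
  move: (A x) (W x) (derive1 S x) (derive1 (derive1 S) x) (derive1 sqrt1 x)
    (derive1 (derive1 sqrt1) x) => A' W' s1 s2 r1 r2.
  clear -HL del0 del1 L0 => Hk /andP[A0 A1] r11 /andP[p0 p1] s1M.
  have n1 : `|2 * del * r1| <= 2 * del.
    by rewrite normrM gtr0_norm ?mulr_gt0// ler_piMr ?mulr_ge0// ltW.
  have : `|H (s1 + 2 * del * r1) - H s1| <= L * (2 * del).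
    apply: (le_trans (HL _ _ _ _)).
    - by rewrite (le_trans (ler_normD _ _))//; apply: lerD => //; lra.
    - by apply: (le_trans s1M); lra.
    - by rewrite addrC addKr ler_pM2l.
  rewrite ler_norml => /andP[_].
  have : A' * (2 * del * r2) <= 2 * del.
    have d20 : 0 <= 2 * del by lra.
    by rewrite mulrCA -[leRHS]mulr1 ler_wpM2l// mulr_ile1.
  lra.
have := Sth x; have : del * `|x| <= del * sqrt1 x by rewrite ler_pM2l// le_norm_sqrt1.
lra.
Qed.

Lemma C1_half_planeN phi : C1_half_plane phi ->
  [/\ C1_half_plane (fun z => - phi z),
  {in @open_half_plane R, d_t (fun z => - phi z) =1 (fun z => - d_t phi z)} &
  {in @open_half_plane R, d_x (fun z => - phi z) =1 (fun z => - d_x phi z)}].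
Proof.
move=> C1.
have Et z : open_half_plane z -> d_t (fun z => - phi z) z = - d_t phi z.
  by move=> /C1[dt _ _ _]; rewrite /d_t deriveN.
have Ex z : open_half_plane z -> d_x (fun z => - phi z) z = - d_x phi z.
  by move=> /C1[_ dx _ _]; rewrite /d_x deriveN.
split=> [z z0|z|z]; last 2 first.
  by rewrite inE => /Et.
  by rewrite inE => /Ex.
have [dt dx ct cx] := C1 z z0.
have zo : nbhs z (@open_half_plane R).
  by have := open_half_plane_open; rewrite openE; exact.
split; [exact: derivableN|exact: derivableN| |].
  rewrite /prop_for /continuous_at Et//; apply: cvg_trans (cvgN ct).
  by apply: near_eq_cvg; apply: filterS zo => y /Et.
rewrite /prop_for /continuous_at Ex//; apply: cvg_trans (cvgN cx).
by apply: near_eq_cvg; apply: filterS zo => y /Ex.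
Qed.

Lemma near_continuous_ext phi psi z : (\forall y \near z, phi y = psi y) ->
  {for z, continuous phi} -> {for z, continuous psi}.
Proof.
move=> E; rewrite /prop_for /continuous_at -(nbhs_singleton E).
by apply: cvg_trans; apply: near_eq_cvg; apply: filterS E => y ->.
Qed.

(** Test functions are differentiable at positive times only, so identities between first
    derivatives hold on the open half-plane; its openness allows differentiating them once more. *)
Lemma C1_half_plane_ext phi psi : {in @open_half_plane R, phi =1 psi} ->
  C1_half_plane phi -> C1_half_plane psi /\
  {in @open_half_plane R, d_t phi =1 d_t psi} /\
  {in @open_half_plane R, d_x phi =1 d_x psi}.
Proof.
move=> E C1.
have near0 z : open_half_plane z -> \forall y \near z, phi y = psi y.
  move=> z0; have := open_half_plane_open; rewrite openE => /(_ _ z0).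
  by apply: filterS => y y0; apply: E; rewrite inE.
have Et z : open_half_plane z -> d_t phi z = d_t psi z.
  by move=> z0; rewrite /d_t; apply: near_eq_derive => //; exact: near0.
have Ex z : open_half_plane z -> d_x phi z = d_x psi z.
  by move=> z0; rewrite /d_x; apply: near_eq_derive => //; exact: near0.
split; last by split=> z; rewrite inE => z0; [exact: Et|exact: Ex].
move=> z z0; have [dt dx ct cx] := C1 z z0.
have zo : nbhs z (@open_half_plane R).
  by have := open_half_plane_open; rewrite openE; exact.
split.
- by apply: near_eq_derivable dt => //; exact: near0.
- by apply: near_eq_derivable dx => //; exact: near0.
- apply: near_continuous_ext ct; apply: filterS zo => y; exact: Et.
- apply: near_continuous_ext cx; apply: filterS zo => y; exact: Ex.
Qed.

Lemma C2_half_planeN phi : C2_half_plane phi ->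
  C2_half_plane (fun z => - phi z) /\
  {in @open_half_plane R, d_x (d_x (fun z => - phi z)) =1
    (fun z => - d_x (d_x phi) z)}.
Proof.
move=> [P1 P2 P3].
have [Q1 Q2 Q3] := C1_half_planeN P1.
have [T1 T2 T3] := C1_half_planeN P2.
have [X1 X2 X3] := C1_half_planeN P3.
have T4 : {in @open_half_plane R, (fun z => - d_t phi z) =1 d_t (fun z => - phi z)}.
  by move=> z z0; rewrite Q2.
have X4 : {in @open_half_plane R, (fun z => - d_x phi z) =1 d_x (fun z => - phi z)}.
  by move=> z z0; rewrite Q3.
have [T5 _] := C1_half_plane_ext T4 T1.
have [X5 [_ X6]] := C1_half_plane_ext X4 X1.
split; first by split; [exact: Q1|exact: T5|exact: X5].
move=> z z0; rewrite -(X6 z z0); exact: X3.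
Qed.

(** Negating the unknown exchanges the two one-sided notions, so that lower barriers become upper
    barriers of a problem of the same kind. *)
Lemma viscosity_supersolutionN (A H W : R -> R) v :
  viscosity_supersolution A H W v ->
  viscosity_subsolution A (fun p => - H (- p)) (fun x => - W x) (fun z => - v z).
Proof.
move=> [cv sup]; split; first by move=> z z0; apply: cvgN; exact: cv.
move=> z phi z0 C2phi vmax.
have [C2N xx] := C2_half_planeN C2phi.
have [_ tt x1] : [/\ True, d_t (fun z => - phi z) z = - d_t phi z &
    d_x (fun z => - phi z) z = - d_x phi z].
  by have [P1 _ _] := C2phi; have [_ Et Ex] := C1_half_planeN P1; rewrite Et ?Ex ?inE.
have := sup z _ z0 C2N; rewrite /rhs tt x1 xx ?inE//.
move=> H'; rewrite -lerN2; apply: le_trans (H' _); first lra.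
by apply: filterS vmax => y; lra.
Qed.

Lemma UC_half_planeN v : UC_half_plane v -> UC_half_plane (fun z => - v z).
Proof.
move=> ucv e e0; have [del del0 H] := ucv e e0; exists del => // z z' z0 z'0 zz.
by rewrite -opprD normrN; exact: H.
Qed.

Lemma barrier_le_viscosity (A H W : R -> R) v S (th kap del C M L : R) :
  UC_half_plane v -> viscosity_supersolution A H W v ->
  (forall x, v (0, x) = th * x) -> (forall x, 0 <= A x <= 1) ->
  lipschitz_ball H (M + 1) L -> C2_line S ->
  (forall x, `|derive1 S x| <= M) ->
  (forall x, kap <= A x * derive1 (derive1 S) x + H (derive1 S x) + W x) ->
  0 < del <= 2^-1 -> (forall x, S x <= th * x + del * `|x| + C) ->
  forall z, closed_half_plane z ->
    S z.2 - 2 * del * sqrt1 z.2 - C + (kap - 2 * del * (1 + L)) * z.1 <= v z.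
Proof.
move=> ucv sup v0 A01 [L0 HL] C2S SM SH del01 Sth z z0.
have [C2S1 S11 S12] : [/\ C2_line (fun x => - S x),
    derive1 (fun x => - S x) = (fun x => - derive1 S x) &
    derive1 (derive1 (fun x => - S x)) = (fun x => - derive1 (derive1 S) x)].
  have [dS ddS cS] := C2S.
  apply: C2_line_of.
  - by move=> x; apply: is_deriveN; exact: derivable_is_derive.
  - by move=> x; apply: is_deriveN; exact: derivable_is_derive.
  - by move=> x; apply: cvgN; exact: cS.
have := @viscosity_le_barrier A (fun p => - H (- p)) (fun x => - W x)
  (fun z => - v z) (fun x => - S x) (- th) (- kap) del C M L
  (UC_half_planeN ucv) (viscosity_supersolutionN sup) _ A01 _ C2S1 _ _ del01 _ z z0.
rewrite /= => h.
suff : - v z <= - S z.2 + 2 * del * sqrt1 z.2 + C + (- kap + 2 * del * (1 + L)) * z.1.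
  by lra.
apply: h => [x|||x|x].
- by rewrite v0 mulNr.
- split=> // p q pM qM; rewrite -opprD normrN.
  apply: (le_trans (HL _ _ _ _)); rewrite ?normrN//.
  by rewrite -opprD normrN.
- by move=> x; rewrite S11 normrN.
- by rewrite S12 S11 opprK; have := SH x; lra.
- by have := Sth x; lra.
Qed.

End HalfPlane.

(** * Scaling and sublinear errors *)

Section Scaling.
Variable R : realType.
Implicit Types (phi v : R * R -> R) (S T : R -> R).

Lemma supersolution_oppr (A H W : R -> R) v :
  viscosity_subsolution A (fun p => - H (- p)) (fun x => - W x) (fun z => - v z) ->
  viscosity_supersolution A H W v.
Proof.
move=> [cv sub]; split.
  move=> z /cv cz; rewrite (_ : v = (fun z => - (fun z => - v z) z)).
    exact: cvgN.
  by apply/funext => y /=; rewrite opprK.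
move=> z phi z0 C2phi vmin.
have [C2N xx] := C2_half_planeN C2phi.
have [_ tt x1] : [/\ True, d_t (fun z => - phi z) z = - d_t phi z &
    d_x (fun z => - phi z) z = - d_x phi z].
  by have [P1 _ _] := C2phi; have [_ Et Ex] := C1_half_planeN P1; rewrite Et ?Ex ?inE.
have := sub z _ z0 C2N; rewrite /rhs tt x1 xx ?inE// !opprK.
move=> H'; rewrite -lerN2; apply: (le_trans (H' _)); last lra.
by apply: filterS vmin => y; lra.
Qed.

Lemma derive1_scale (f : R -> R) (k c t : R) : derivable f (c * t) 1 ->
  is_derive t (1 : R) (fun t => k * f (c * t)) (k * c * derive1 f (c * t)).
Proof.
move=> df.
have d1 : is_derive t (1 : R) (fun t : R => c * t) c.
  by apply: is_derive_eq; rewrite /GRing.scale/=; ring.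
have d2 := derivable_is_derive df.
have d3 := @is_derive1_comp R f (fun t : R => c * t) t _ _ d2 d1.
by apply: is_derive_eq; rewrite /GRing.scale/=; ring.
Qed.

Definition scale (k c : R) phi : R * R -> R := fun z => k * phi (c * z.1, c * z.2).

Lemma continuous_dilation (c : R) :
  continuous (fun z : R * R => (c * z.1, c * z.2)).
Proof.
have cm : continuous (fun t : R => c * t).
  by move=> t; apply: cvgMr; exact: cvg_id.
move=> z U [[P Q] /= [HP HQ] sub].
exists ((fun t => c * t) @^-1` P, (fun t => c * t) @^-1` Q) => /=.
  by split; [exact: (cm z.1)|exact: (cm z.2)].
by move=> y [/= y1 y2]; exact: sub.
Qed.

Lemma scale_cvg phi (k c : R) z : {for (c * z.1, c * z.2), continuous phi} ->
  {for z, continuous (scale k c phi)}.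
Proof.
move=> cphi; apply: cvgMr.
by apply: (continuous_comp (@continuous_dilation c z)).
Qed.

Lemma scaleVE f (e : R) z : e != 0 ->
  scale (e^-1 * e) e f (e^-1 * z.1, e^-1 * z.2) = f z.
Proof.
by move=> e0; rewrite /scale/= mulVf// mul1r !mulrA divff// !mul1r -surjective_pairing.
Qed.

Lemma C1_scale phi (k c : R) : 0 < c -> C1_half_plane phi ->
  [/\ C1_half_plane (scale k c phi),
   {in @open_half_plane R, d_t (scale k c phi) =1 scale (k * c) c (d_t phi)} &
   {in @open_half_plane R, d_x (scale k c phi) =1 scale (k * c) c (d_x phi)}].
Proof.
move=> c0 C1.
have mem z : open_half_plane z -> open_half_plane (c * z.1, c * z.2).
  by move=> z0; rewrite /open_half_plane/= mulr_gt0.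
have Dt z : open_half_plane z -> is_derive z.1 (1 : R)
    (fun t => scale k c phi (t, z.2)) (scale (k * c) c (d_t phi) z).
  move=> /mem/C1[dt _ _ _]; rewrite derivable_tE/= in dt.
  by rewrite /scale d_tE/=; exact: derive1_scale.
have Dx z : open_half_plane z -> is_derive z.2 (1 : R)
    (fun t => scale k c phi (z.1, t)) (scale (k * c) c (d_x phi) z).
  move=> /mem/C1[_ dx _ _]; rewrite derivable_xE/= in dx.
  by rewrite /scale d_xE/=; exact: derive1_scale.
have Et z : open_half_plane z -> d_t (scale k c phi) z = scale (k * c) c (d_t phi) z.
  by move=> /Dt h; rewrite d_tE; apply: is_derive1.
have Ex z : open_half_plane z -> d_x (scale k c phi) z = scale (k * c) c (d_x phi) z.
  by move=> /Dx h; rewrite d_xE; apply: is_derive1.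
split; last 2 first.
- by move=> z; rewrite inE; exact: Et.
- by move=> z; rewrite inE; exact: Ex.
move=> z z0; have [_ _ ct cx] := C1 _ (mem z z0).
have zo : nbhs z (@open_half_plane R).
  by have := @open_half_plane_open R; rewrite openE; exact.
split.
- by rewrite derivable_tE; apply: ex_derive; exact: Dt.
- by rewrite derivable_xE; apply: ex_derive; exact: Dx.
- apply: (near_continuous_ext _ (scale_cvg (k := k * c) ct)).
  by apply: filterS zo => y y0; rewrite Et.
- apply: (near_continuous_ext _ (scale_cvg (k := k * c) cx)).
  by apply: filterS zo => y y0; rewrite Ex.
Qed.

Lemma C2_scale phi (k c : R) : 0 < c -> C2_half_plane phi ->
  C2_half_plane (scale k c phi) /\
  {in @open_half_plane R,
     d_x (d_x (scale k c phi)) =1 scale (k * c * c) c (d_x (d_x phi))}.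
Proof.
move=> c0 [P1 P2 P3].
have [Q1 Q2 Q3] := C1_scale k c0 P1.
have [T1 T2 T3] := C1_scale (k * c) c0 P2.
have [X1 X2 X3] := C1_scale (k * c) c0 P3.
have T4 : {in @open_half_plane R, scale (k * c) c (d_t phi) =1 d_t (scale k c phi)}.
  by move=> z z0; rewrite Q2.
have X4 : {in @open_half_plane R, scale (k * c) c (d_x phi) =1 d_x (scale k c phi)}.
  by move=> z z0; rewrite Q3.
have [T5 _] := C1_half_plane_ext T4 T1.
have [X5 [_ X6]] := C1_half_plane_ext X4 X1.
split; first by split; [exact: Q1|exact: T5|exact: X5].
move=> z z0; rewrite -(X6 z z0); exact: X3.
Qed.

(** A test function is pulled back by the inverse scaling, which keeps first derivatives and
    multiplies the second space derivative by [e]; hence the factor in front of [A]. *)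
Lemma viscosity_subsolution_scale (A H W : R -> R) v (e : R) : 0 < e ->
  viscosity_subsolution A H W v ->
  viscosity_subsolution (fun x => e * A (x / e)) H (fun x => W (x / e))
    (scale e e^-1 v).
Proof.
move=> e0 [cv sub]; have ei0 : 0 < e^-1 by rewrite invr_gt0.
have en0 : e != 0 by rewrite gt_eqF.
split.
  move=> z z0; apply: scale_cvg; apply: cv.
  by rewrite /open_half_plane/= mulr_gt0.
move=> z phi z0 C2phi vmax.
have [C2s xx] := C2_scale e^-1 e0 C2phi.
pose y := (e^-1 * z.1, e^-1 * z.2).
have y0 : open_half_plane y by rewrite /open_half_plane/= mulr_gt0.
have tt : d_t (scale e^-1 e phi) y = d_t phi z.
  have [P1 _ _] := C2phi; have [_ Et _] := C1_scale e^-1 e0 P1.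
  by rewrite Et ?inE//; exact: scaleVE.
have x1 : d_x (scale e^-1 e phi) y = d_x phi z.
  have [P1 _ _] := C2phi; have [_ _ Ex] := C1_scale e^-1 e0 P1.
  by rewrite Ex ?inE//; exact: scaleVE.
have x2 : d_x (d_x (scale e^-1 e phi)) y = e * d_x (d_x phi) z.
  have := xx y; rewrite inE => /(_ y0) ->; move: (d_x (d_x phi)) => f.
  rewrite -(@scaleVE f e z)// /scale/=; move: (f _) => r.
  by rewrite mulVf// !mul1r.
have := sub y _ y0 C2s; rewrite /rhs tt x1 x2.
move: (d_t phi z) (d_x phi z) (d_x (d_x phi) z) => p1 p2 p3 h.
have Ey : y.2 = z.2 / e by rewrite mulrC.
rewrite -Ey -mulrA mulrCA; apply: h.
have cm := @continuous_dilation e y.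
have := cm _ (_ : nbhs _ [set p | scale e e^-1 v p - phi p <= scale e e^-1 v z - phi z]).
rewrite /= !mulrA divff// !mul1r -surjective_pairing => /(_ vmax).
move=> vm; apply: (@filterS _ (nbhs y) _ _ _ _ vm) => -[q1 q2] /=; rewrite /scale/= !mulrA divff// mulVf// !mul1r.
rewrite -surjective_pairing => h1.
rewrite -(ler_pM2l e0) !mulrBr !mulrA divff// !mul1r.
exact: h1.
Qed.

Lemma viscosity_supersolution_scale (A H W : R -> R) v (e : R) : 0 < e ->
  viscosity_supersolution A H W v ->
  viscosity_supersolution (fun x => e * A (x / e)) H (fun x => W (x / e))
    (scale e e^-1 v).
Proof.
move=> e0 /viscosity_supersolutionN/(viscosity_subsolution_scale e0) h.
apply: supersolution_oppr.
rewrite (_ : (fun z => - scale e e^-1 v z) = scale e e^-1 (fun z => - v z))//.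
by apply/funext => z; rewrite /scale mulrN.
Qed.

Lemma UC_scale v (k c : R) : 0 < k -> 0 < c -> UC_half_plane v ->
  UC_half_plane (scale k c v).
Proof.
move=> k0 c0 ucv e e0; have [del del0 H] := ucv (e / k) (divr_gt0 e0 k0).
exists (del / c); first exact: divr_gt0.
move=> z z' z0 z'0 zz; rewrite /scale -mulrBr normrM gtr0_norm//.
rewrite mulrC -ltr_pdivlMr//; apply: H.
- by rewrite /closed_half_plane/= mulr_ge0// ltW.
- by rewrite /closed_half_plane/= mulr_ge0// ltW.
move: zz; rewrite !prod_normE/= -!mulrBr !normrM (gtr0_norm c0) -maxr_pMr ?ltW//.
by rewrite ltr_pdivlMr// mulrC.
Qed.

Lemma UC_viscosity_solution_scale (A H W : R -> R) v (th e : R) : 0 < e ->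
  UC_viscosity_solution A H W (fun x => th * x) v ->
  UC_viscosity_solution (fun x => e * A (x / e)) H (fun x => W (x / e))
    (fun x => th * x) (scale e e^-1 v).
Proof.
move=> e0 [ucv [sub sup] v0]; split.
- by apply: UC_scale => //; rewrite invr_gt0.
- by split; [exact: viscosity_subsolution_scale|exact: viscosity_supersolution_scale].
- by move=> x; rewrite /scale/= mulr0 v0; field; rewrite gt_eqF.
Qed.

(** A competitor is scaled back with [e^-1] into a solution of the original problem, where
    uniqueness is assumed. *)
Lemma unique_UC_viscosity_solution_scale (A H W : R -> R) v (th e : R) : 0 < e ->
  unique_UC_viscosity_solution A H W (fun x => th * x) v ->
  unique_UC_viscosity_solution (fun x => e * A (x / e)) H (fun x => W (x / e))
    (fun x => th * x) (fun z => e * v (z.1 / e, z.2 / e)).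
Proof.
move=> e0 [sol uniq].
have E : (fun z => e * v (z.1 / e, z.2 / e)) = scale e e^-1 v.
  by apply/funext => z; rewrite /scale !(mulrC e^-1).
have en0 : e != 0 by rewrite gt_eqF.
rewrite E; split; first exact: UC_viscosity_solution_scale.
have ei0 : 0 < e^-1 by rewrite invr_gt0.
move=> v' /(UC_viscosity_solution_scale ei0); rewrite invrK.
have -> : (fun x => e^-1 * (e * A (x * e / e))) = A.
  by apply/funext => x; rewrite mulrA mulVf// mul1r mulfK.
have -> : (fun x => W (x * e / e)) = W by apply/funext => x; rewrite mulfK.
move=> /uniq h z; rewrite inE => z0.
have := h (e^-1 * z.1, e^-1 * z.2).
rewrite inE /closed_half_plane/= => /(_ (mulr_ge0 (ltW ei0) z0)).
rewrite /scale/= => <-; rewrite !mulrA divff// !mul1r.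
by rewrite -surjective_pairing.
Qed.

Lemma local_extremum_derive (w : R -> R) (a b t : R) : a < t < b ->
  (forall s, a < s < b -> derivable w s 1) ->
  (\forall s \near t, w s <= w t) -> derive1 w t = 0.
Proof.
move=> /andP[at' tb] dw wmax; apply: is_derive1.
have [r /= r0 rw] := (nbhs_ballP _ _).1 wmax.
pose a' := Num.max a (t - r); pose b' := Num.min b (t + r).
have ha : a' < t by rewrite gt_max at'/= ltrBlDr ltrDl.
have hb : t < b' by rewrite lt_min tb/= ltrDl.
apply: (@derive1_at_max _ w a' b').
- exact: ltW (lt_trans ha hb).
- move=> s; rewrite in_itv/= gt_max lt_min => /andP[/andP[h1 _] /andP[h2 _]].
  by apply: dw; rewrite h1 h2.
- by rewrite in_itv/= ha hb.
- move=> s; rewrite in_itv/= gt_max lt_min => /andP[/andP[_ h1] /andP[_ h2]].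
  by apply: rw; rewrite /ball/= ltr_distlC; apply/andP; split; lra.
Qed.

Lemma near_slice_t phi (z : R * R) (Q : R * R -> Prop) : (\forall y \near z, Q y) ->
  \forall t \near z.1, Q (t, z.2).
Proof.
by move=> [[U1 U2] /= [h1 h2] sub]; apply: filterS h1 => t Ut; apply: sub; split=> //; exact: nbhs_singleton.
Qed.

Lemma near_slice_x phi (z : R * R) (Q : R * R -> Prop) : (\forall y \near z, Q y) ->
  \forall x \near z.2, Q (z.1, x).
Proof.
by move=> [[U1 U2] /= [h1 h2] sub]; apply: filterS h2 => t Ut; apply: sub; split=> //; exact: nbhs_singleton.
Qed.

Definition affine (h th : R) : R * R -> R := fun z => z.1 * h + th * z.2.

Lemma affine_C1 (h th : R) : [/\ C1_half_plane (affine h th),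
  d_t (affine h th) = cst h & d_x (affine h th) = cst th].
Proof.
have [C1T T1] : C1_line (fun t : R => t * h) /\ derive1 (fun t : R => t * h) = cst h.
  apply: C1_line_of; last by move=> x; exact: cvg_cst.
  by move=> x; apply: is_derive_eq; rewrite /GRing.scale/=; ring.
have [C1S S1] : C1_line (fun t : R => th * t) /\ derive1 (fun t : R => th * t) = cst th.
  apply: C1_line_of; last by move=> x; exact: cvg_cst.
  by move=> x; apply: is_derive_eq; rewrite /GRing.scale/=; ring.
have [P1 P2 P3] := C1_half_plane_sep C1T C1S.
by rewrite T1 in P2; rewrite S1 in P3.
Qed.

Lemma affine_continuous (h th : R) : continuous (affine h th).
Proof.
apply: (@continuous_sep _ (fun x => th * x) (fun t => t * h)).
  by move=> t; apply: cvgMr; exact: cvg_id.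
by move=> t; apply: cvgMl; exact: cvg_id.
Qed.

Lemma affine_subsolution (H : R -> R) (th : R) :
  viscosity_subsolution (cst 0) H (cst 0) (affine (H th) th).
Proof.
split; first by move=> z _; exact: affine_continuous.
move=> [t x] phi t0 [C1 _ _] vmax; rewrite /open_half_plane/= in t0.
have [A1 At Ax] := affine_C1 (H th) th.
have der (z : R * R) : open_half_plane z ->
    is_derive z.1 (1 : R) (fun t => affine (H th) th (t, z.2) - phi (t, z.2))
      (H th - d_t phi z) /\
    is_derive z.2 (1 : R) (fun x => affine (H th) th (z.1, x) - phi (z.1, x))
      (th - d_x phi z).
  move=> z0; have [at_ ax _ _] := A1 z z0; have [pt px _ _] := C1 z z0.
  rewrite derivable_tE in at_; rewrite derivable_tE in pt.
  rewrite derivable_xE in ax; rewrite derivable_xE in px.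
  split.
    have -> : H th - d_t phi z = d_t (affine (H th) th) z - d_t phi z by rewrite At.
    rewrite !d_tE; apply: is_deriveB; exact: derivable_is_derive.
  have -> : th - d_x phi z = d_x (affine (H th) th) z - d_x phi z by rewrite Ax.
  rewrite !d_xE; apply: is_deriveB; exact: derivable_is_derive.
have e1 : H th - d_t phi (t, x) = 0.
  rewrite -(is_derive1 (der (t, x) t0).1)/=.
  apply: (@local_extremum_derive _ 0 (t + 1)).
  - by rewrite t0 ltrDl ltr01.
  - move=> s /andP[s0 _]; have [h _] := der (s, x) s0.
    by apply: ex_derive; exact: h.
  - exact: (near_slice_t phi vmax).
have e2 : th - d_x phi (t, x) = 0.
  rewrite -(is_derive1 (der (t, x) t0).2)/=.
  apply: (@local_extremum_derive _ (x - 1) (x + 1)).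
  - by apply/andP; split; lra.
  - move=> s _; have [_ h] := der (t, s) t0.
    by apply: ex_derive; exact: h.
  - exact: (near_slice_x phi vmax).
rewrite /rhs/= mul0r add0r addr0.
by move/eqP: e1; rewrite subr_eq0 => /eqP <-; move/eqP: e2; rewrite subr_eq0 => /eqP <-.
Qed.

Lemma affine_supersolution (H : R -> R) (th : R) :
  viscosity_supersolution (cst 0) H (cst 0) (affine (H th) th).
Proof.
apply: supersolution_oppr.
have := affine_subsolution (fun p => - H (- p)) (- th).
rewrite opprK (_ : affine _ _ = (fun z => - affine (H th) th z)); last first.
  by apply/funext => z; rewrite /affine; ring.
by rewrite (_ : (fun x => - cst 0 x) = cst 0 :> (R -> R))//; apply/funext => y; rewrite /= oppr0.
Qed.

Lemma affine_UC (h th : R) : UC_half_plane (affine h th).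
Proof.
move=> e e0; exists (e / (`|h| + `|th| + 1)).
  by rewrite divr_gt0// ltr_wpDl// addr_ge0.
move=> z z' _ _; rewrite prod_normE/= ltr_pdivlMr ?ltr_wpDl ?addr_ge0// => zz.
have -> : affine h th z - affine h th z' = (z.1 - z'.1) * h + th * (z.2 - z'.2).
  by rewrite /affine; ring.
apply: le_lt_trans zz; apply: (le_trans (ler_normD _ _)); rewrite !normrM.
set m := Num.max _ _.
have m1 : `|z.1 - z'.1| <= m by rewrite le_max lexx.
have m2 : `|z.2 - z'.2| <= m by rewrite le_max lexx orbT.
have := ler_wpM2r (normr_ge0 h) m1; have := ler_wpM2l (normr_ge0 th) m2.
have := le_trans (normr_ge0 _) m1.
lra.
Qed.

(** The line [th * x] is its own barrier: the comparison holds for every small [d], with an error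
    that is [d] times a quantity fixed by the point, and [d] tends to 0. *)
Lemma affine_unique (H : R -> R) (th : R) : locally_lipschitz H ->
  classical_solution H (affine (H th) th) /\
  unique_UC_viscosity_solution (cst 0) H (cst 0) (fun x => th * x)
    (affine (H th) th).
Proof.
move=> Hlip; have [A1 At Ax] := affine_C1 (H th) th.
split; first by split=> // z _; rewrite At Ax.
split.
  split; first exact: affine_UC.
  - by split; [exact: affine_subsolution|exact: affine_supersolution].
  - by move=> x; rewrite /affine/= mul0r add0r.
move=> v [ucv [sub sup] v0] z; rewrite inE => z0.
have [L L0 HL] := locally_lipschitz_segment Hlip (`|th| + 1).
pose S (x : R) := th * x.
have [C2S S1 S2] : [/\ C2_line S, derive1 S = cst th & derive1 (derive1 S) = cst 0].
  apply: C2_line_of => x.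
  - by apply: is_derive_eq; rewrite /GRing.scale/=; ring.
  - exact: cvg_cst.
have z10 : 0 <= z.1 by [].
have lim (A B c : R) : (forall d, 0 < d <= 2^-1 -> A <= B + d * c) -> A <= B.
  move=> h; apply/ler_addgt0Pr => e e0.
  pose d := Num.min 2^-1 (e / (`|c| + 1)).
  have c1 : 0 < `|c| + 1 by rewrite ltr_wpDl.
  have d0 : 0 < d by rewrite lt_min invr_gt0 ltr0n/= divr_gt0.
  apply: (le_trans (h d _)); first by rewrite d0 ge_min lexx.
  rewrite lerD2l; apply: (@le_trans _ _ (d * (`|c| + 1))).
    by rewrite ler_pM2l//; have := ler_norm c; lra.
  by rewrite -ler_pdivlMr// ge_min lexx orbT.
have A01 (x : R) : 0 <= (cst 0 : R -> R) x <= 1 by rewrite /= lexx ler01.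
have SM x : `|derive1 S x| <= `|th| by rewrite S1.
apply/eqP; rewrite eq_le; apply/andP; split.
  apply: (lim _ _ (2 * sqrt1 z.2 + 2 * (1 + L) * z.1)) => d d01.
  have := @viscosity_le_barrier R (cst 0) H (cst 0) v S th (H th) d 0 `|th| L
    ucv sub v0 A01 (conj L0 HL) C2S SM _ d01 _ z z0.
  rewrite /S /affine => h; apply: (le_trans (h _ _)) => [x|x|].
  - by rewrite -/S S1/= mul0r add0r addr0.
  - rewrite subr0 gerBl mulr_ge0//; by have /andP[/ltW] := d01.
  - by rewrite le_eqVlt; apply/orP; left; apply/eqP; ring.
apply: (lim _ _ (2 * sqrt1 z.2 + 2 * (1 + L) * z.1)) => d d01.
have := @barrier_le_viscosity R (cst 0) H (cst 0) v S th (H th) d 0 `|th| L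
  ucv sup v0 A01 (conj L0 HL) C2S SM _ d01 _ z z0.
rewrite /S /affine -lerBlDr => h; apply: (le_trans _ (h _ _)) => [|x|x].
- by rewrite le_eqVlt; apply/orP; left; apply/eqP; ring.
- by rewrite -/S S1/= mul0r add0r addr0.
- rewrite addr0 lerDl mulr_ge0//; by have /andP[/ltW] := d01.
Qed.

(** The limit is homogeneous of degree one, so scaling turns the error into
    [eta * (t + |x|) + eps * C]. First [eta] is chosen from the size of the compact set, then [eps]
    small against [C]. *)
Lemma cvg_locally_uniformly_sublinear (u : R * R -> R) (h th : R) :
  (forall eta, 0 < eta -> exists C, forall z, closed_half_plane z ->
    `|u z - affine h th z| <= eta * (z.1 + `|z.2|) + C) ->
  cvg_locally_uniformly (fun eps z => eps * u (z.1 / eps, z.2 / eps)) 0^'+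
    (affine h th).
Proof.
move=> uaff K cK Kpos.
have [B BK] : exists B : R, forall z, K z -> z.1 + `|z.2| <= B.
  have [M [_ MK]] := compact_bounded cK.
  exists ((M + 1) + (M + 1)) => z Kz.
  have M1 : M < M + 1 by rewrite ltrDl.
  have /= := MK _ M1 z Kz; rewrite prod_normE.
  by rewrite ge_max => /andP[h1 h2]; apply: lerD => //; exact: le_trans (ler_norm _) h1.
have B1 : 0 < `|B| + 1 by rewrite ltr_wpDl.
move=> P /uniform_nbhs[E [entE sub]].
move: (entE); rewrite -entourage_ballE => -[e /= e0 eE].
have [C HC] := uaff (e / 2 / (`|B| + 1)) (divr_gt0 (divr_gt0 e0 (ltr0n _ 2)) B1).
have C1 : 0 < `|C| + 1 by rewrite ltr_wpDl.
near=> eps; apply: sub => z Kz; apply: eE.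
have eps0 : 0 < eps by near: eps; exact: nbhs_right_gt.
have eps1 : eps < e / 2 / (`|C| + 1).
  by near: eps; apply: nbhs_right_lt; rewrite divr_gt0// divr_gt0.
have z0 := Kpos _ Kz; rewrite /closed_half_plane/= in z0.
rewrite /ball/= distrC.
have -> : eps * u (z.1 / eps, z.2 / eps) - affine h th z =
    eps * (u (z.1 / eps, z.2 / eps) - affine h th (z.1 / eps, z.2 / eps)).
  by rewrite /affine/=; field; rewrite gt_eqF.
rewrite normrM gtr0_norm//.
have ez0 : closed_half_plane (z.1 / eps, z.2 / eps).
  by rewrite /closed_half_plane/= divr_ge0// ltW.
have h1 := ler_wpM2l (ltW eps0) (HC _ ez0); apply: (le_lt_trans h1).
rewrite normrM (gtr0_norm (_ : 0 < eps^-1)) ?invr_gt0// -mulrDl mulrDr.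
rewrite mulrCA (mulrCA eps) divff ?gt_eqF// mulr1.
have h2 : e / 2 / (`|B| + 1) * (z.1 + `|z.2|) <= e / 2.
  rewrite mulrAC ler_pdivrMr// ler_pM2l ?divr_gt0//.
  by have := BK _ Kz; have := ler_norm B; lra.
have h3 : eps * C < e / 2.
  apply: (@le_lt_trans _ _ (eps * (`|C| + 1))).
    by rewrite ler_pM2l//; have := ler_norm C; lra.
  by rewrite -ltr_pdivlMr.
lra.
Unshelve. all: by end_near. Qed.

End Scaling.

(** * Primitives *)

Section Primitive.
Variable R : realType.
Notation mu := (@lebesgue_measure R).
Implicit Types f g h b : R -> R.

(** The signed integral from 0 to [x]: the domain on the wrong side of 0 is empty, or reduced to the
    point 0. *)
Definition prim g (x : R) : R :=
  \int[mu]_(t in `[0, x]) g t - \int[mu]_(t in `[x, 0]) g t.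

Lemma continuous_integrable_segment g (a b : R) : continuous g ->
  mu.-integrable `[a, b] (EFin \o g).
Proof.
move=> cg; apply: continuous_compact_integrable; first exact: segment_compact.
exact: continuous_subspaceT.
Qed.

Lemma continuous_measurable g (D : set R) : measurable D -> continuous g ->
  measurable_fun D g.
Proof.
by move=> mD cg; apply: measurable_funS (continuous_measurable_fun cg).
Qed.

Lemma prim0 g : prim g 0 = 0.
Proof. by rewrite /prim subrr. Qed.

Lemma primE g (u x : R) : (forall b c : R, mu.-integrable `[b, c] (EFin \o g)) ->
  u <= 0 -> u <= x ->
  prim g x = \int[mu]_(t in `[u, x]) g t - \int[mu]_(t in `[u, 0]) g t.
Proof.
move=> ig u0 ux; rewrite /prim; have [x0|x0] := leP 0 x.
  have -> : \int[mu]_(t in `[x, 0]) g t = 0.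
    have [->|xn0] := eqVneq x 0.
      by rewrite set_itv1 Rintegral_set1.
    by rewrite set_itv_ge ?Rintegral_set0// bnd_simp -ltNge lt_neqAle eq_sym xn0.
  rewrite subr0 Rintegral_itvB//.
  rewrite Rintegral_itv_obnd_cbnd//.
  apply: integrableS (ig 0 x) => //.
  by apply: subset_itvr; rewrite bnd_simp.
rewrite (_ : `[0, x]%classic = set0); last by rewrite set_itv_ge// bnd_simp -ltNge.
rewrite Rintegral_set0 sub0r; apply/eqP; rewrite eqr_oppLR opprB; apply/eqP.
rewrite Rintegral_itvB//; last exact: ltW.
rewrite Rintegral_itv_obnd_cbnd//.
apply: integrableS (ig x 0) => //.
by apply: subset_itvr; rewrite bnd_simp.
Qed.

Lemma primB g (x y : R) : (forall b c : R, mu.-integrable `[b, c] (EFin \o g)) ->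
  x <= y -> prim g y - prim g x = \int[mu]_(t in `[x, y]) g t.
Proof.
move=> ig xy; pose u := Num.min x 0.
have ux : u <= x by rewrite ge_min lexx.
have u0 : u <= 0 by rewrite ge_min lexx orbT.
rewrite (primE ig u0 (le_trans ux xy)) (primE ig u0 ux) opprB addrA subrK.
rewrite Rintegral_itvB//.
rewrite Rintegral_itv_obnd_cbnd//.
apply: integrableS (ig x y) => //.
by apply: subset_itvr; rewrite bnd_simp.
Qed.

(** Follows from the uniqueness of Lebesgue measure: its image under a translation gives half-open
    intervals the same length. *)
Lemma integral_shift g (c x y : R) : measurable_fun setT g -> (forall z, 0 <= g z) ->
  \int[mu]_(t in `[x, y]) g (t + c) = \int[mu]_(t in `[x + c, y + c]) g t.
Proof.
move=> mg g0; rewrite /Rintegral; congr fine.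
pose T (t : R) : measurableTypeR R := t + c.
have mT : measurable_fun [set: measurableTypeR R] T by exact: measurable_funD.
have TE (b1 b2 : bool) (p q : R) :
    T @^-1` [set` Interval (BSide b1 (p + c)) (BSide b2 (q + c))] =
    [set` Interval (BSide b1 p) (BSide b2 q)].
  apply/funext => z; apply/propext; rewrite /preimage/= /T.
  by case: b1; case: b2; rewrite !in_itv/= ?lerD2r ?ltrD2r.
rewrite -TE.
transitivity (\int[pushforward mu T]_(t in `[(x + c)%R, (y + c)%R]%classic) (g t)%:E)%E.
  rewrite (ge0_integral_pushforward mT)//.
    by apply/measurable_EFinP; exact: measurable_funTS.
  by move=> t _; rewrite lee_fin.
apply: eq_measure_integral => A mA _.
apply/esym; apply: (lebesgue_measure_unique (mu := pushforward mu T)) => // _ [[b1 b2] _ <-].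
have E := TE false false (b1 - c) (b2 - c); rewrite !subrK in E.
transitivity (mu `]b1 - c, b2 - c]%classic); last exact: (congr1 mu (esym E)).
rewrite !lebesgue_measure_itv/=.
by rewrite !lte_fin ltrD2r -!EFinB opprD addrACA subrr addr0.
Qed.

Lemma bounded_integrable_segment g (M b c : R) : measurable_fun setT g ->
  (forall z, 0 <= g z <= M) -> mu.-integrable `[b, c] (EFin \o g).
Proof.
move=> mg gM; have cM := @continuous_integrable_segment (cst M) b c (fun=> @cst_continuous _ _ _ _).
apply: (le_integrable _ _ _ cM) => //.
  by apply/measurable_EFinP; exact: measurable_funTS.
move=> z _ /=; rewrite lee_fin; have /andP[h1 h2] := gM z.
by rewrite (ger0_norm h1) ger0_norm// (le_trans h1).
Qed.

Lemma prim_shift g (c x : R) : measurable_fun setT g -> (forall z, 0 <= g z) ->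
  (forall b e : R, mu.-integrable `[b, e] (EFin \o g)) ->
  (forall b e : R, mu.-integrable `[b, e] (EFin \o (fun z => g (z + c)))) ->
  prim g (x + c) - prim g c = prim (fun z => g (z + c)) x.
Proof.
move=> mg g0 ig igc; have [x0|x0] := leP 0 x.
  rewrite primB ?lerDr// -[RHS]subr0 -(prim0 (fun z => g (z + c))) primB//.
  by rewrite integral_shift// add0r.
have := @primB g (x + c) c ig; rewrite gerDr (ltW x0) => /(_ isT) h.
have := @primB (fun z => g (z + c)) x 0 igc (ltW x0).
rewrite prim0 sub0r integral_shift// add0r -h => /eqP.
by rewrite eqr_oppLR opprB => /eqP.
Qed.

Lemma is_derive_prim g : continuous g ->
  forall x : R, is_derive x (1 : R) (prim g) (g x).
Proof.
(* The base point lies to the left of both 0 and [x], so that near [x] the signed integral is an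
   ordinary one from [u], up to a constant. *)
move=> cg x; pose u : R := - `|x| - 1.
have u0 : u < 0 by rewrite /u; have := normr_ge0 x; lra.
have ux : u < x.
  by have := ler_norm (- x); rewrite normrN /u; lra.
pose F (y : R) := \int[mu]_(t in `[u, y]) g t.
have [dF F'] : derivable F x 1 /\ derive1 F x = g x.
  apply: (@continuous_FTC1 _ _ _ _ (x + 1)); [|exact: continuous_integrable_segment| |exact: cg].
    by rewrite ltrDl.
  exact: ux.
have E : \forall y \near x, F y - F 0 = prim g y.
  near=> y; rewrite (@primE g u)//; [|exact: ltW|].
    by move=> b c; exact: continuous_integrable_segment.
  by apply: ltW; near: y; exact: lt_nbhsr.
have dFc : is_derive x (1 : R) (fun y => F y - F 0) (g x).
  rewrite -F' -[derive1 F x]subr0; apply: is_deriveB.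
  exact: derivable_is_derive.
split; first by apply: near_eq_derivable E _; apply: ex_derive.
by rewrite -(near_eq_derive _ E) derive_val.
Unshelve. all: by end_near. Qed.

Lemma prim_continuous g : continuous g -> continuous (prim g).
Proof.
by move=> cg; apply: derivable_continuous => x; have := is_derive_prim cg x.
Qed.

Lemma mvt_ge (F f : R -> R) (c x y : R) : (forall z : R, is_derive z (1 : R) F (f z)) ->
  x <= y -> (forall z, x <= z <= y -> c <= f z) -> c * (y - x) <= F y - F x.
Proof.
move=> dF xy fc.
have cF : {within `[x, y], continuous F}.
  by apply: continuous_subspaceT; apply: derivable_continuous => z.
have [z] := MVT_segment xy (fun z _ => dF z) cF.
rewrite in_itv/= => zi ->; rewrite ler_wpM2r ?subr_ge0//; exact: fc.
Qed.

Lemma mvt_le (F f : R -> R) (c x y : R) : (forall z : R, is_derive z (1 : R) F (f z)) ->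
  x <= y -> (forall z, x <= z <= y -> f z <= c) -> F y - F x <= c * (y - x).
Proof.
move=> dF xy fc.
have cF : {within `[x, y], continuous F}.
  by apply: continuous_subspaceT; apply: derivable_continuous => z.
have [z] := MVT_segment xy (fun z _ => dF z) cF.
rewrite in_itv/= => zi ->; rewrite ler_wpM2r ?subr_ge0//; exact: fc.
Qed.

Lemma mvt_dist (F f : R -> R) (c : R) : (forall z : R, is_derive z (1 : R) F (f z)) ->
  (forall z, `|f z| <= c) -> forall x y, `|F y - F x| <= c * `|y - x|.
Proof.
move=> dF fc x y; wlog xy : x y / x <= y.
  move=> H; have [xy|/ltW yx] := leP x y; first exact: H.
  by rewrite distrC [`|y - x|]distrC; exact: H.
have h1 := @mvt_ge F f (- c) x y dF xy; have h2 := @mvt_le F f c x y dF xy.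
rewrite [`|y - x|]ger0_norm ?subr_ge0// ler_norml -mulNr; apply/andP; split.
  by apply: h1 => z _; have := fc z; rewrite ler_norml => /andP[].
by apply: h2 => z _; have := fc z; rewrite ler_norml => /andP[].
Qed.

Lemma prim_unique g F : continuous g -> F 0 = 0 ->
  (forall x : R, is_derive x (1 : R) F (g x)) -> F = prim g.
Proof.
move=> cg F0 dF; apply/funext => x.
have dG (z : R) : is_derive z (1 : R) (fun z => F z - prim g z) 0.
  rewrite -(subrr (g z)); apply: is_deriveB; exact: is_derive_prim.
have n0 (z : R) : `|0 : R| <= (0 : R) by rewrite normr0.
have := mvt_dist dG n0 0 x.
by rewrite F0 prim0 subrr subr0 mul0r normr_le0 subr_eq0 => /eqP.
Qed.

End Primitive.

(** * Integrating factor for the linear equation [g' + K * b * g = b * h] *)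

Section ExponentialKernel.
Variables (R : realType) (b : R -> R) (K : R).
Hypotheses (cb : continuous b) (b1 : forall x, 1 <= b x) (K0 : 0 < K).
Notation mu := (@lebesgue_measure R).
Implicit Types h : R -> R.

Definition kexp (x : R) : R := expR (K * prim b x).
Definition kint h (x : R) : R := \int[mu]_(y in `]-oo, x]) (kexp y * b y * h y).

Lemma kexp_gt0 x : 0 < kexp x. Proof. exact: expR_gt0. Qed.

Lemma is_derive_kexp (x : R) : is_derive x (1 : R) kexp (K * (kexp x * b x)).
Proof.
have d1 : is_derive x (1 : R) (fun x => K * prim b x) (K * b x).
  by have := is_derive_prim cb x => ?; apply: is_deriveZ.
have := @is_derive1_comp R expR (fun x => K * prim b x) x _ _ (is_derive_expR _) d1.
by rewrite /kexp => h; apply: is_derive_eq; ring.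
Qed.

Lemma kexp_continuous : continuous kexp.
Proof. by apply: derivable_continuous => x; have := is_derive_kexp x. Qed.

Lemma kexpb_continuous : continuous (fun y => kexp y * b y).
Proof. by move=> x; apply: cvgM; [exact: kexp_continuous|exact: cb]. Qed.

(** Since [b >= 1], the primitive of [b] at [- x] is at most [- x], and [expR (K * x)] is at least
    [1 + K * x]. *)
Lemma kexp_cvg0 : kexp (- x) @[x --> +oo] --> 0.
Proof.
apply/cvgrPdist_le => e e0; near=> x.
have x0 : 0 <= x by near: x; apply: nbhs_pinfty_ge; exact: num_real.
have xe : (K * e)^-1 <= x by near: x; apply: nbhs_pinfty_ge; exact: num_real.
rewrite sub0r normrN gtr0_norm ?kexp_gt0//.
have nx0 : - x <= 0 by rewrite oppr_le0.
have := mvt_ge (is_derive_prim cb) nx0 (fun z _ => b1 z).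
rewrite prim0 opprK add0r mul1r => h.
apply: (@le_trans _ _ (expR (- (K * x)))).
  by rewrite ler_expR -mulrN ler_pM2l//; lra.
rewrite expRN -[e]invrK lef_pV2 ?posrE ?expR_gt0 ?invr_gt0//.
apply: le_trans (expR_ge1Dx (K * x)).
have : e^-1 <= K * x.
  by rewrite -ler_pdivrMl// -invfM.
by lra.
Unshelve. all: by end_near. Qed.

Lemma kexpb_ge0 y : 0 <= kexp y * b y.
Proof. by rewrite mulr_ge0 ?(ltW (kexp_gt0 _))// (le_trans ler01). Qed.

(** [kexp / K] is an antiderivative vanishing at minus infinity; the substitution [y -> - y] moves
    the integral to a half-line ending at plus infinity. Divided by [kexp], the kernel has mass
    [1 / K], so a constant source [K * q] produces the constant [q]. *)
Lemma integral_kexp x :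
  (\int[mu]_(y in `]-oo, x]) (kexp y * b y)%:E = (kexp x / K)%:E)%E.
Proof.
have dF (y : R) : is_derive y (1 : R) (fun y => - (kexp (- y) / K)) (kexp (- y) * b (- y)).
  have dk := is_derive_kexp (- y).
  have d1 := @is_derive1_comp R kexp -%R y _ _ dk (is_deriveNid y 1).
  have -> : kexp (- y) * b (- y) = - (K * (kexp (- y) * b (- y)) * (- 1) * K^-1).
    by move: (kexp _) (b _) => p q; field; rewrite gt_eqF.
  apply: is_deriveN; rewrite (_ : (fun _ => _) = (K^-1 \*: (kexp \o -%R))); last first.
    by apply/funext => z /=; rewrite mulrC.
  by rewrite [_ * K^-1]mulrC; apply: is_deriveZ.
rewrite -[x in LHS]opprK ge0_integration_by_substitutionNy; last 2 first.
- by apply: continuous_subspaceT; exact: kexpb_continuous.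
- by move=> y _; exact: kexpb_ge0.
rewrite (@ge0_continuous_FTC2y _ _ (fun y => - (kexp (- y) / K)) _ 0).
- by rewrite sub0e opprK -EFinN !opprK.
- by move=> y _; exact: kexpb_ge0.
- apply: continuous_subspaceT => y.
  apply: (@continuous_comp _ _ _ -%R (fun y => kexp y * b y)); first exact: oppr_continuous.
  exact: kexpb_continuous.
- by rewrite -oppr0 -(mul0r K^-1); apply: cvgN; apply: cvgMl; exact: kexp_cvg0.
- by move=> y _; apply: ex_derive; exact: dF.
- apply: cvg_at_right_filter; apply: (@derivable_continuous _ (fun y => - (kexp (- y) / K))).
  by move=> y; apply: ex_derive; exact: dF.
- by move=> y _; apply: is_derive1.
Qed.

Lemma kint_integrable h (M : R) x : measurable_fun setT h ->
  (forall y, 0 <= h y <= M) ->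
  mu.-integrable `]-oo, x] (EFin \o (fun y => kexp y * b y * h y)).
Proof.
move=> mh h0M.
have mkb : measurable_fun setT (fun y => kexp y * b y).
  exact: continuous_measurable_fun kexpb_continuous.
have M0 : 0 <= M by have /andP[h1 h2] := h0M 0; exact: le_trans h1 h2.
have iE : mu.-integrable `]-oo, x] (EFin \o (fun y => kexp y * b y)).
  apply/integrableP; split.
    by apply/measurable_EFinP; exact: measurable_funS mkb.
  under eq_integral do rewrite gee0_abs ?lee_fin ?kexpb_ge0//.
  by rewrite integral_kexp ltry.
have iM : mu.-integrable `]-oo, x] (fun y => M%:E * (kexp y * b y)%:E)%E.
  exact: integrableZl.
apply: (le_integrable _ _ _ iM) => //.
- apply/measurable_EFinP; apply: measurable_funS (measurable_funM mkb mh) => //.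
- move=> y _ /=; have /andP[hy0 hyM] := h0M y.
  have p1 : 0 <= kexp y * b y * h y := mulr_ge0 (kexpb_ge0 y) hy0.
  have p2 : 0 <= M * (kexp y * b y) := mulr_ge0 M0 (kexpb_ge0 y).
  rewrite lee_fin (ger0_norm p1) (ger0_norm p2) [leRHS]mulrC.
  exact: (ler_wpM2l (kexpb_ge0 y) hyM).
Qed.

Lemma kint_cst (c : R) x : 0 <= c -> kint (cst c) x = c * (kexp x / K).
Proof.
move=> c0; rewrite /kint /Rintegral.
under eq_integral do rewrite EFinM muleC /=.
rewrite ge0_integralZl//; last 2 first.
- by apply/measurable_EFinP; exact: (measurable_funS _ _ (continuous_measurable_fun kexpb_continuous)).
- by move=> y _; rewrite lee_fin kexpb_ge0.
by rewrite integral_kexp.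
Qed.

Lemma le_kint h1 h2 (M : R) x : measurable_fun setT h1 -> measurable_fun setT h2 ->
  (forall y, 0 <= h1 y <= M) -> (forall y, 0 <= h2 y <= M) ->
  (forall y, h1 y <= h2 y) -> kint h1 x <= kint h2 x.
Proof.
move=> m1 m2 b1' b2' h12; apply: le_Rintegral => //.
- exact: (kint_integrable x m1 b1').
- exact: (kint_integrable x m2 b2').
- by move=> y _; rewrite ler_wpM2l ?kexpb_ge0.
Qed.

Lemma kint_cvg (hn : (R -> R)^nat) h (M : R) x :
  (forall n, measurable_fun setT (hn n)) -> measurable_fun setT h ->
  (forall n y, 0 <= hn n y <= M) -> (forall y, hn n y @[n --> \oo] --> h y) ->
  kint (hn n) x @[n --> \oo] --> kint h x.
Proof.
move=> mn mh h0M hc.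
have M0 : 0 <= M by have /andP[h1 h2] := h0M 0%N 0; exact: le_trans h1 h2.
have hM y : 0 <= h y <= M.
  have cv := hc y; apply/andP; split.
    by rewrite -(cvg_lim _ cv)//; apply: limr_ge; [apply/cvg_ex; eexists; exact: cv|
      apply: nearW => n; have /andP[] := h0M n y].
  by rewrite -(cvg_lim _ cv)//; apply: limr_le; [apply/cvg_ex; eexists; exact: cv|
      apply: nearW => n; have /andP[] := h0M n y].
have mkb : measurable_fun setT (fun y => kexp y * b y).
  exact: continuous_measurable_fun kexpb_continuous.
have ic : mu.-integrable `]-oo, x] (EFin \o (fun y => kexp y * b y * M)).
  by apply: (@kint_integrable (cst M) M) => // y; rewrite M0 lexx.
have [] := @dominated_convergence _ _ R mu `]-oo, x]%classic _
  (fun n y => (kexp y * b y * hn n y)%:E) (fun y => (kexp y * b y * h y)%:E) _ _ _ _ ic.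
- exact: measurable_itv.
- by move=> n; apply/measurable_EFinP; apply: measurable_funS (measurable_funM mkb (mn n)).
- by apply/measurable_EFinP; apply: measurable_funS (measurable_funM mkb mh).
- apply: aeW => y _; apply: cvg_EFin; first exact: nearW.
  exact: cvgMr (hc y).
- apply: aeW => y n _ /=; have /andP[p1 p2] := h0M n y.
  have q1 : 0 <= kexp y * b y * hn n y := mulr_ge0 (kexpb_ge0 y) p1.
  by rewrite lee_fin (ger0_norm q1); exact: (ler_wpM2l (kexpb_ge0 y) p2).
move=> _ _ cv; apply: fine_cvg; rewrite fineK; first exact: cv.
by apply: integrable_fin_num => //; exact: (kint_integrable x mh hM).
Qed.

Lemma kintB h (M : R) x y : measurable_fun setT h -> (forall z, 0 <= h z <= M) ->
  x <= y -> 0 <= kint h y - kint h x <= M * ((kexp y - kexp x) / K).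
Proof.
move=> mh h0M xy.
have M0 : 0 <= M by have /andP[h1 h2] := h0M 0; exact: le_trans h1 h2.
have E h' : measurable_fun setT h' -> (forall z, 0 <= h' z <= M) ->
    kint h' y - kint h' x = \int[mu]_(z in `]x, y]) (kexp z * b z * h' z).
  move=> mh' h0M'; rewrite /kint Rintegral_itvB//.
  exact: (kint_integrable y mh' h0M').
have mcM : measurable_fun setT (cst M : R -> R) by [].
have cM z : 0 <= (cst M : R -> R) z <= M by rewrite /= M0 lexx.
have sub : `]x, y] `<=` `]-oo, y] by apply: subset_itvr; rewrite bnd_simp.
rewrite E//; apply/andP; split.
  apply: Rintegral_ge0 => z _; rewrite mulr_ge0 ?kexpb_ge0//.
  by have /andP[] := h0M z.
have -> : M * ((kexp y - kexp x) / K) = kint (cst M) y - kint (cst M) x.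
  by rewrite !kint_cst//; move: (kexp x) (kexp y) => p q; ring.
rewrite E//; apply: le_Rintegral => //.
- by apply: integrableS (kint_integrable y mh h0M).
- by apply: integrableS (kint_integrable y mcM cM).
- by move=> z _; rewrite ler_wpM2l ?kexpb_ge0//; have /andP[] := h0M z.
Qed.

Lemma kint_continuous h (M : R) : measurable_fun setT h ->
  (forall z, 0 <= h z <= M) -> continuous (kint h).
Proof.
move=> mh h0M x.
have M0 : 0 <= M by have /andP[h1 h2] := h0M 0; exact: le_trans h1 h2.
have bd y : `|kint h x - kint h y| <= M / K * `|kexp x - kexp y|.
  wlog xy : x y / x <= y.
    move=> hw; have [|/ltW yx] := leP x y; first exact: hw.
    by rewrite distrC (distrC (kexp x)); exact: hw.
  have /andP[h1 h2] := kintB mh h0M xy.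
  have h3 : 0 <= M * ((kexp y - kexp x) / K) by exact: le_trans h1 h2.
  rewrite distrC ger0_norm//; apply: (le_trans h2); rewrite mulrA mulrAC.
  by rewrite ler_wpM2l ?divr_ge0// ?(ltW K0)// distrC ler_norm.
have q0 : 0 < M / K + 1 by rewrite ltr_wpDl// divr_ge0// ltW.
apply/cvgrPdist_le => e e0.
have r0 : 0 < (M / K + 1)^-1 * e by rewrite mulr_gt0// invr_gt0.
near=> y; apply: (le_trans (bd y)).
apply: (@le_trans _ _ ((M / K + 1) * `|kexp x - kexp y|)).
  by rewrite ler_wpM2r// lerDl.
rewrite -ler_pdivlMl//; apply: ltW; near: y.
by apply: near_continuous; first exact: kexp_continuous.
Unshelve. all: by end_near. Qed.

Lemma is_derive_kint h (M : R) : continuous h -> (forall z, 0 <= h z <= M) ->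
  forall x : R, is_derive x (1 : R) (kint h) (kexp x * b x * h x).
Proof.
move=> ch h0M x; have mh := continuous_measurable_fun ch.
have [dF F'] : derivable (kint h) x 1 /\ derive1 (kint h) x = kexp x * b x * h x.
  apply: (@continuous_FTC1 _ _ _ _ (x + 1)).
  - by rewrite ltrDl.
  - exact: (kint_integrable _ mh h0M).
  - exact: ltNyr.
  - by apply: cvgM; [exact: kexpb_continuous|exact: ch].
by rewrite -F'; exact: derivable_is_derive.
Qed.

End ExponentialKernel.

(** * Slopes of the correctors *)

Section Hamiltonian.
Variables (R : realType) (G : R -> R).
Hypothesis G_lip : locally_lipschitz G.
Hypothesis G_pinfty : G p @[p --> +oo] --> +oo.
Hypothesis G0 : G 0 = 0.
Hypothesis G_incr : {in `[0, +oo[ &, {homo G : p q / p < q}}.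

Lemma G_lt (p q : R) : 0 <= p -> p < q -> G p < G q.
Proof.
by move=> p0 pq; apply: G_incr => //; rewrite ?inE/= in_itv/= andbT ?(le_trans p0)// ltW.
Qed.

Lemma G_le (p q : R) : 0 <= p -> p <= q -> G p <= G q.
Proof. by move=> p0; rewrite le_eqVlt => /orP[/eqP->//|/(G_lt p0)/ltW]. Qed.

Lemma G2_invP (l : R) : 0 <= l -> 0 <= G2_inv G l /\ G (G2_inv G l) = l.
Proof.
move=> l0; have cG := locally_lipschitz_continuous G_lip.
have Gl : (G @` `[0, +oo[) l.
  have [M [M0 GM]] : exists M, 0 <= M /\ l <= G M.
    near +oo_R => M; exists M; split.
      by near: M; apply: nbhs_pinfty_ge; exact: num_real.
    near: M; move/cvgryPge : G_pinfty => /(_ l); exact.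
  have [|c] := @IVT _ G 0 M l M0 (continuous_subspaceT cG).
    have GM0 := G_le (lexx 0) M0; rewrite G0 in GM0 *.
    by rewrite min_l// max_r// l0 GM.
  by rewrite in_itv/= => /andP[c0 cM] <-; exists c => //=; rewrite in_itv/= c0.
split; last by apply: pinvK; rewrite inE.
have := @surjpinv_image_sub _ _ (fun=> 0) `[0, +oo[%classic (G @` `[0, +oo[) G.
move=> /(_ (fun _ => id)) /(_ (G2_inv G l)) /=; rewrite in_itv/= andbT; apply.
by exists l.
Unshelve. all: by end_near. Qed.

Lemma G2_invK (p : R) : 0 <= p -> G2_inv G (G p) = p.
Proof.
move=> p0; have Gp := G_le (lexx 0) p0; rewrite G0 in Gp.
have [q0 Gq] := G2_invP Gp.
have [lt|lt|//] := ltgtP (G2_inv G (G p)) p.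
- by have := G_lt q0 lt; rewrite Gq ltxx.
- by have := G_lt p0 lt; rewrite Gq ltxx.
Qed.

Lemma G2_inv_le (l m : R) : 0 <= l -> l <= m -> G2_inv G l <= G2_inv G m.
Proof.
move=> l0 lm; have [q0 Gq] := G2_invP l0; have [r0 Gr] := G2_invP (le_trans l0 lm).
by rewrite leNgt; apply/negP => /(G_lt r0); rewrite Gq Gr ltNge lm.
Qed.

(** Strict monotonicity made quantitative by compactness: the minimum of [G (q + e) - G q] over a
    segment is positive, and a larger distance only increases the gap. *)
Lemma G_modulus (Q e : R) : 0 < e -> exists2 m : R, 0 < m &
  forall p q : R, 0 <= q -> q + e <= p -> p <= Q -> m <= G p - G q.
Proof.
move=> e0; have cG := locally_lipschitz_continuous G_lip.
have Q0 : 0 <= `|Q| by [].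
have cg : {within `[0, `|Q|], continuous (fun q => G (q + e) - G q)}.
  apply: continuous_subspaceT => q; apply: cvgB; last exact: cG.
  apply: (@continuous_comp _ _ _ (fun q => q + e) G); last exact: cG.
  by apply: cvgD; [exact: cvg_id|exact: cvg_cst].
have [c] := EVT_min Q0 cg; rewrite in_itv/= => /andP[c0 cQ] cmin.
exists (G (c + e) - G c); first by rewrite subr_gt0 G_lt// ltrDl.
move=> p q q0 qp pQ; apply: (@le_trans _ _ (G (q + e) - G q)).
  apply: cmin; rewrite in_itv/= q0/=.
  by rewrite (le_trans _ (ler_norm Q))// (le_trans _ pQ)// (le_trans _ qp)// lerDl ltW.
by rewrite lerD2r G_le// addr_ge0// ltW.
Qed.

(** * Comparison of bounded slopes in a fixed environment *)

Section Slope.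
Variables (a V : R -> R) (beta : R).
Hypothesis beta_gt0 : 0 < beta.
Hypothesis a01 : forall x, 0 < a x <= 1.
Hypothesis V01 : forall x, 0 <= V x <= 1.
Hypothesis ca : continuous a.
Hypothesis cV : continuous V.

Let b (x : R) : R := (a x)^-1.

Let a_gt0 x : 0 < a x. Proof. by have /andP[] := a01 x. Qed.

Let cb : continuous b.
Proof. by move=> x; apply: cvgV; [rewrite gt_eqF|exact: ca]. Qed.

Let b1 x : 1 <= b x.
Proof. by rewrite -[1]invr1 lef_pV2 ?posrE ?ltr01//; have /andP[] := a01 x. Qed.

(** With [f = F'], the corrector equation [a * F'' + G F' + beta * V = lambda] solved for [F'']. *)
Definition slope_sol (lambda : R) (f : R -> R) :=
  forall x : R, is_derive x (1 : R) f ((lambda - beta * V x - G (f x)) / a x).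

Lemma slope_sol_continuous lambda f : slope_sol lambda f -> continuous f.
Proof. by move=> fs; apply: derivable_continuous => x; have := fs x. Qed.

(** Dividing by [a <= 1] can only strengthen a nonpositive bound, which makes the comparisons
    uniform although [a] may approach 0. *)
Lemma ler_ndiv (r m x : R) : 0 <= m -> r <= - m -> r / a x <= - m.
Proof.
move=> m0 rm; rewrite ler_pdivrMr//; apply: (le_trans rm).
by rewrite mulNr lerN2 ler_piMr//; have /andP[] := a01 x.
Qed.

(** Where [f] exceeds [g] by more than [e], the gap [m] of [G] outweighs [lambda - mu] and [f - g]
    decreases at a definite rate, which [entire_comparison] excludes for a bounded difference. *)
Lemma slope_close (Q e m : R) lambda mu f g : 0 < e -> 0 < m ->
  (forall p q : R, 0 <= q -> q + e <= p -> p <= Q -> m <= G p - G q) ->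
  slope_sol lambda f -> slope_sol mu g ->
  (forall x, 0 <= f x <= Q) -> (forall x, 0 <= g x <= Q) ->
  lambda - mu <= m / 2 -> forall x, f x <= g x + e.
Proof.
move=> e0 m0 Gm fs gs f0Q g0Q lm x.
have dw (z : R) : is_derive z (1 : R) (fun z => f z - g z)
    ((lambda - mu - (G (f z) - G (g z))) / a z).
  have -> : (lambda - mu - (G (f z) - G (g z))) / a z =
    (lambda - beta * V z - G (f z)) / a z - (mu - beta * V z - G (g z)) / a z.
    by rewrite -mulrBl; congr (_ / _); ring.
  exact: is_deriveB.
have Q0 : 0 <= Q by have /andP[h1 h2] := f0Q x; exact: le_trans h1 h2.
suff : f x - g x <= e by lra.
apply: (@entire_comparison _ (fun z => f z - g z) e (m / 2) Q) => [|z|z|z].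
- exact: divr_gt0.
- by apply: ex_derive; exact: dw.
- by have := f0Q z; have := g0Q z; rewrite ler_norml; lra.
- move=> ez; rewrite (is_derive1 (dw z)); apply: ler_ndiv; first by rewrite divr_ge0// ltW.
  have /andP[g0 gQ] := g0Q z; have /andP[h0 hQ] := f0Q z.
  have := Gm (f z) (g z) g0 _ hQ; lra.
Qed.

Lemma slope_le (Q lambda mu : R) f g : slope_sol lambda f -> slope_sol mu g ->
  (forall x, 0 <= f x <= Q) -> (forall x, 0 <= g x <= Q) ->
  lambda <= mu -> forall x, f x <= g x.
Proof.
move=> fs gs f0Q g0Q lm x; apply/ler_addgt0Pr => e e0.
have [m m0 Gm] := G_modulus Q e0.
by apply: (slope_close e0 m0 Gm fs gs) => //; lra.
Qed.

(** Were [g - f] smaller than [(mu - lambda) / L], the values of [G] could not balance [mu - lambda]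
    and [f - g] would again decrease at a definite rate. Averaged, this bound makes the inverses of
    [theta1] and [theta2] locally Lipschitz. *)
Lemma slope_gap (Q L lambda mu : R) f g : slope_sol lambda f -> slope_sol mu g ->
  (forall x, 0 <= f x <= Q) -> (forall x, 0 <= g x <= Q) ->
  lipschitz_ball G Q L -> lambda <= mu -> forall x, (mu - lambda) / L <= g x - f x.
Proof.
move=> fs gs f0Q g0Q [L0 GL] lm x.
have fg := slope_le fs gs f0Q g0Q lm.
have dw (z : R) : is_derive z (1 : R) (fun z => f z - g z)
    ((lambda - mu - (G (f z) - G (g z))) / a z).
  have -> : (lambda - mu - (G (f z) - G (g z))) / a z =
    (lambda - beta * V z - G (f z)) / a z - (mu - beta * V z - G (g z)) / a z.
    by rewrite -mulrBl; congr (_ / _); ring.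
  exact: is_deriveB.
apply/ler_addgt0Pr => e e0.
suff : f x - g x <= - ((mu - lambda) / L) + e by lra.
apply: (@entire_comparison _ (fun z => f z - g z) _ (L * e) Q) => [|z|z|z].
- exact: mulr_gt0.
- by apply: ex_derive; exact: dw.
- by have := f0Q z; have := g0Q z; rewrite ler_norml; lra.
- move=> ez; rewrite (is_derive1 (dw z)); apply: ler_ndiv; first by rewrite mulr_ge0// ltW.
  have /andP[g0 gQ] := g0Q z; have /andP[h0 hQ] := f0Q z.
  have := GL (g z) (f z); rewrite (ger0_norm g0) (ger0_norm h0) => /(_ gQ hQ).
  rewrite (ger0_norm (_ : 0 <= g z - f z)) ?subr_ge0//.
  rewrite ler_norml => /andP[_].
  have : L * (g z - f z) <= (mu - lambda) - L * e.
    have -> : mu - lambda - L * e = L * ((mu - lambda) / L - e).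
      by field; rewrite gt_eqF.
    by rewrite ler_pM2l//; lra.
  lra.
Qed.

(** If [G (f x) > 2 * s], the slope grows to the left of [x]: there [beta * (1 - V)] is at most [s],
    so [f'] is below [- s / a] as long as [f] is above [f x]. Up to [L1] it would gain [s] times the
    integral of [1 / a], more than [M]. *)
Lemma slope_hill (M s h L1 x : R) f : slope_sol beta f ->
  (forall z, 0 <= f z <= M) -> 0 < s -> L1 <= x ->
  (forall z, L1 <= z <= x -> h <= V z) -> beta * (1 - h) <= s ->
  M < s * (prim b x - prim b L1) -> G (f x) <= 2 * s.
Proof.
move=> fs f0M s0 L1x Vh bh sA; rewrite leNgt; apply/negP => Gx.
pose g z := f z + s * prim b z.
have dg (z : R) : is_derive z (1 : R) g ((beta - beta * V z - G (f z)) / a z + s * b z).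
  have := is_derive_prim cb z => ?; have := fs z => ?.
  by apply: is_deriveD; exact: is_deriveZ.
have := @argmax_left_growth R g L1 x L1x; have : f L1 <= M by have /andP[] := f0M L1.
have : 0 <= f x by have /andP[] := f0M x.
move=> fx0 fL1 /(_ _ _); have : g L1 < g x by rewrite /g; lra.
rewrite ltNge => /negP gL; move=> H; apply: gL; apply: H => z /andP[zL zx].
  by apply: ex_derive; exact: dg.
move=> gz; rewrite (is_derive1 (dg z)) -mulrDl.
have Az := mvt_ge (is_derive_prim cb) zx (fun y _ => le_trans ler01 (b1 y)).
have fxz : f x <= f z.
  have : s * prim b z <= s * prim b x by rewrite ler_pM2l//; lra.
  by move: gz; rewrite /g; lra.
have := G_le fx0 fxz; have := Vh z; rewrite zL zx => /(_ isT).
move=> hV GG; rewrite pmulr_llt0 ?invr_gt0//.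
have : beta * (1 - V z) <= beta * (1 - h) by rewrite ler_pM2l//; lra.
lra.
Qed.

(** * Existence of slopes by monotone iteration *)

Section Existence.
Variables lambda K : R.
Hypothesis lambda_ge : beta <= lambda.
Let qlo := G2_inv G (lambda - beta).
Let qhi := G2_inv G lambda.
Hypothesis GK : lipschitz_ball G qhi K.

Definition slope_source (f : R -> R) (y : R) : R :=
  K * f y - G (f y) + (lambda - beta * V y).

(* [kint b K h / kexp b K] is the bounded solution [g] of [g' + K * b * g = b * h],
   here with [b = 1 / a]. A fixed point therefore solves
   [a * f' + G f + beta * V = lambda], and since [K] is a Lipschitz constant of
   [G] the iteration is decreasing. *)
Fixpoint slope_iter (n : nat) (x : R) : R :=
  if n is n.+1 then kint b K (slope_source (slope_iter n)) x / kexp b K x else qhi.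

Definition slope (x : R) : R := limn (slope_iter ^~ x).

Let K0 : 0 < K. Proof. by have [] := GK. Qed.

Let lb0 : 0 <= lambda - beta. Proof. by rewrite subr_ge0. Qed.
Let l0 : 0 <= lambda. Proof. exact: le_trans (ltW beta_gt0) lambda_ge. Qed.
Let q0 : 0 <= qlo. Proof. by have [] := G2_invP lb0. Qed.
Let Gqlo : G qlo = lambda - beta. Proof. by have [] := G2_invP lb0. Qed.
Let qhi0 : 0 <= qhi. Proof. by have [] := G2_invP l0. Qed.
Let Gqhi : G qhi = lambda. Proof. by have [] := G2_invP l0. Qed.

Let KG_le (p q : R) : 0 <= p -> p <= q -> q <= qhi -> K * p - G p <= K * q - G q.
Proof.
move=> p0 pq qq; have [_ GL] := GK.
have := GL q p; rewrite (ger0_norm p0) (ger0_norm (le_trans p0 pq)).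
move=> /(_ qq (le_trans pq qq)); rewrite (ger0_norm (_ : 0 <= q - p)) ?subr_ge0//.
by rewrite ler_norml => /andP[_]; lra.
Qed.

(** The constants [qlo] and [qhi] are a sub- and a supersolution: [G qlo = lambda - beta] and
    [G qhi = lambda] enclose [lambda - beta * V], and [K * p - G p] is nondecreasing on the range of
    slopes. *)
Lemma slope_source_bounds (f : R -> R) : (forall x, qlo <= f x <= qhi) ->
  forall y, K * qlo <= slope_source f y <= K * qhi.
Proof.
move=> fq y; have /andP[f1 f2] := fq y; have /andP[V0 V1] := V01 y.
have h1 := KG_le q0 f1 f2; have h2 := KG_le (le_trans q0 f1) f2 (lexx qhi).
have : beta * V y <= beta by rewrite ler_piMr// ltW.
have : 0 <= beta * V y by rewrite mulr_ge0// ltW.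
by rewrite /slope_source; rewrite Gqlo in h1; rewrite Gqhi in h2; lra.
Qed.

Lemma slope_source_measurable (f : R -> R) : measurable_fun setT f ->
  measurable_fun setT (slope_source f).
Proof.
move=> mf; have cG := locally_lipschitz_continuous G_lip.
apply: measurable_funD.
  apply: measurable_funB; first exact: measurable_funM.
  by apply: measurableT_comp => //; exact: continuous_measurable_fun.
apply: measurable_funB => //; apply: measurable_funM => //.
exact: continuous_measurable_fun.
Qed.

Let step_bounds (f : R -> R) : measurable_fun setT f -> (forall x, qlo <= f x <= qhi) ->
  forall x, qlo <= kint b K (slope_source f) x / kexp b K x <= qhi.
Proof.
move=> mf fq x; have sb := slope_source_bounds fq.
have ms := slope_source_measurable mf.
have Kq0 : 0 <= K * qlo by rewrite mulr_ge0// ltW.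
have Kq1 : 0 <= K * qhi by rewrite mulr_ge0// ltW.
have e0 := kexp_gt0 b K x.
have qq : qlo <= qhi by have /andP[h1 h2] := fq 0; exact: le_trans h1 h2.
have B0 y : 0 <= slope_source f y <= K * qhi.
  by have /andP[h1 h2] := sb y; rewrite (le_trans Kq0 h1).
rewrite ler_pdivlMr// ler_pdivrMr//; apply/andP; split.
  have -> : qlo * kexp b K x = kint b K (cst (K * qlo)) x.
    by rewrite kint_cst//; field; rewrite gt_eqF.
  apply: (@le_kint _ b K cb b1 K0 _ _ (K * qhi)) => //.
    by move=> y; rewrite /= Kq0 ler_pM2l.
  by move=> y; have /andP[] := sb y.
have -> : qhi * kexp b K x = kint b K (cst (K * qhi)) x.
  by rewrite kint_cst//; field; rewrite gt_eqF.
apply: (@le_kint _ b K cb b1 K0 _ _ (K * qhi)) => //.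
  by move=> y; rewrite /= Kq1 lexx.
by move=> y; have /andP[] := sb y.
Qed.

Let step_continuous (f : R -> R) : measurable_fun setT f -> (forall x, qlo <= f x <= qhi) ->
  continuous (fun x => kint b K (slope_source f) x / kexp b K x).
Proof.
move=> mf fq x; have Kq0 : 0 <= K * qlo by rewrite mulr_ge0// ltW.
apply: cvgM.
  apply: (@kint_continuous _ b K cb b1 K0 _ (K * qhi)).
    exact: slope_source_measurable.
  by move=> y; have /andP[h1 h2] := slope_source_bounds fq y; rewrite (le_trans Kq0 h1).
by apply: cvgV; [rewrite gt_eqF// kexp_gt0|exact: kexp_continuous].
Qed.

Lemma slope_iterP n : measurable_fun setT (slope_iter n) /\
  forall x, qlo <= slope_iter n x <= qhi.
Proof.
elim: n => [|n [mn bn]].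
  by split=> [|x]/=; [exact: measurable_cst|rewrite lexx andbT G2_inv_le// gerBl ltW].
split; last exact: step_bounds.
exact: continuous_measurable_fun (step_continuous mn bn).
Qed.

Lemma slope_iter_le n x : slope_iter n.+1 x <= slope_iter n x.
Proof.
elim: n x => [|n IHn] x.
  by have [_ /(_ x)/andP[]] := slope_iterP 1.
have [m1 b1'] := slope_iterP n; have [m2 b2'] := slope_iterP n.+1.
rewrite [leRHS]/= [leLHS]/= ler_pM2r ?invr_gt0 ?kexp_gt0//.
have Kq0 : 0 <= K * qlo by rewrite mulr_ge0// ltW.
apply: (@le_kint _ b K cb b1 K0 _ _ (K * qhi)).
- exact: slope_source_measurable.
- exact: slope_source_measurable.
- by move=> y; have /andP[h1 h2] := slope_source_bounds b2' y; rewrite (le_trans Kq0 h1).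
- by move=> y; have /andP[h1 h2] := slope_source_bounds b1' y; rewrite (le_trans Kq0 h1).
move=> y; rewrite lerD2r; apply: KG_le; last by have /andP[] := b1' y.
  by have /andP[h1 h2] := b2' y; exact: le_trans q0 h1.
exact: IHn.
Qed.

Lemma slope_iter_cvg x : slope_iter n x @[n --> \oo] --> slope x.
Proof.
apply: nonincreasing_is_cvgn.
  by apply/nonincreasing_seqP => n; exact: slope_iter_le.
by exists qlo => _ [n _ <-]; have [_ /(_ x)/andP[]] := slope_iterP n.
Qed.

Lemma slope_bounds x : qlo <= slope x <= qhi.
Proof.
have ic : cvgn (slope_iter ^~ x) by apply/cvg_ex; exists (slope x); exact: slope_iter_cvg.
apply/andP; split; rewrite /slope.
  apply: limr_ge => //; apply: nearW => n; by have [_ /(_ x)/andP[]] := slope_iterP n.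
apply: limr_le => //; apply: nearW => n; by have [_ /(_ x)/andP[]] := slope_iterP n.
Qed.

(** The iterates converge pointwise only, and the limit is taken under the integral by dominated
    convergence; this is why measurability is carried along the iteration. *)
Lemma slope_fixpoint x : slope x = kint b K (slope_source slope) x / kexp b K x.
Proof.
have cG := locally_lipschitz_continuous G_lip.
have ms : measurable_fun setT slope.
  apply: (measurable_fun_cvg (h := slope_iter)) => [n|y _].
    by have [] := slope_iterP n.
  exact: slope_iter_cvg.
have Kq0 : 0 <= K * qlo by rewrite mulr_ge0// ltW.
have cv1 : slope_iter n.+1 x @[n --> \oo] --> slope x.
  by rewrite (cvg_shiftS (slope_iter ^~ x)); exact: slope_iter_cvg.
have cv2 : slope_iter n.+1 x @[n --> \oo] --> kint b K (slope_source slope) x / kexp b K x.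
  rewrite /=; apply: cvgMl.
  apply: (@kint_cvg _ b K cb b1 K0 (fun n => slope_source (slope_iter n)) _ (K * qhi)).
  - by move=> n; apply: slope_source_measurable; have [] := slope_iterP n.
  - exact: slope_source_measurable.
  - move=> n y; have [_ bn] := slope_iterP n.
    by have /andP[h1 h2] := slope_source_bounds bn y; rewrite (le_trans Kq0 h1).
  - move=> y; apply: cvgD; last exact: cvg_cst.
    apply: cvgB; first by apply: cvgMr; exact: slope_iter_cvg.
    by apply: continuous_cvg; [exact: cG|exact: slope_iter_cvg].
by rewrite -(cvg_lim _ cv1)// (cvg_lim _ cv2).
Qed.

(** Regularity is gained through the fixed point: a bounded measurable source gives a continuous
    slope, hence a continuous source, hence a differentiable slope. *)
Lemma slope_is_sol : slope_sol lambda slope.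
Proof.
have cG := locally_lipschitz_continuous G_lip.
have Kq0 : 0 <= K * qlo by rewrite mulr_ge0// ltW.
have E : slope = (fun x => kint b K (slope_source slope) x / kexp b K x).
  by apply/funext => x; exact: slope_fixpoint.
have ms : measurable_fun setT slope.
  apply: (measurable_fun_cvg (h := slope_iter)) => [n|y _].
    by have [] := slope_iterP n.
  exact: slope_iter_cvg.
have cs : continuous slope.
  by rewrite E; apply: step_continuous => //; exact: slope_bounds.
have csrc : continuous (slope_source slope).
  move=> y; apply: cvgD.
    apply: cvgB; first by apply: cvgMr; exact: cs.
    by apply: (@continuous_comp _ _ _ slope G); [exact: cs|exact: cG].
  by apply: cvgB; [exact: cvg_cst|apply: cvgMr; exact: cV].
have srcB y : 0 <= slope_source slope y <= K * qhi.
  by have /andP[h1 h2] := slope_source_bounds slope_bounds y; rewrite (le_trans Kq0 h1).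
move=> x; rewrite {1}E.
have d1 := is_derive_kint cb b1 K0 csrc srcB x.
have k0 : kexp b K x != 0 by rewrite gt_eqF// kexp_gt0.
have d2 := is_deriveV k0 (is_derive_kexp K cb x).
have := is_deriveM d1 d2; set D := (X in is_derive _ _ _ X) => hd.
suff <- : D = (lambda - beta * V x - G (slope x)) / a x by exact: hd.
rewrite /D /GRing.scale/=.
have -> : kint b K (slope_source slope) x = slope x * kexp b K x.
  by rewrite [in RHS]slope_fixpoint mulfVK.
rewrite /slope_source /b; move: (kexp _ _ _) k0 (slope x) => k k0 s.
by field; rewrite k0 gt_eqF.
Qed.

End Existence.

End Slope.
End Hamiltonian.

(** * Ergodic theorem *)

Section BoundedExpectation.
Context (R : realType) (d : measure_display) (Omega : measurableType d).
Variable (P : probability Omega R).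
Implicit Types f g : Omega -> R.

Lemma bounded_integrable f (M : R) : measurable_fun setT f ->
  (forall w, `|f w| <= M) -> P.-integrable setT (EFin \o f).
Proof.
move=> mf fM; have iM := @finite_measure_integrable_cst _ _ _ P setT M measurableT.
apply: (le_integrable _ _ _ iM) => //; first exact/measurable_EFinP.
by move=> w _ /=; rewrite lee_fin (le_trans (fM w))// ler_norm.
Qed.

Lemma expectation_cst' (c : R) : \int[P]_w c = c.
Proof.
rewrite Rintegral_cst//; transitivity (c * fine (1%E : \bar R)).
  by congr (_ * fine _); exact: probability_setT.
by rewrite /= mulr1.
Qed.

Lemma le_expectation f g (M N : R) : measurable_fun setT f -> measurable_fun setT g ->
  (forall w, `|f w| <= M) -> (forall w, `|g w| <= N) ->
  (forall w, f w <= g w) -> \int[P]_w f w <= \int[P]_w g w.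
Proof.
move=> mf mg fM gN fg; apply: le_Rintegral => //.
- exact: bounded_integrable fM.
- exact: bounded_integrable gN.
Qed.

Lemma expectationN f : P.-integrable setT (EFin \o f) ->
  \int[P]_w (- f w) = - \int[P]_w f w.
Proof.
move=> fi; rewrite -mulN1r -(RintegralZl (-1) measurableT fi).
by apply: eq_Rintegral => w _; rewrite mulN1r.
Qed.

End BoundedExpectation.

Section Flow.
Context (R : realType) (d : measure_display) (Omega : measurableType d).
Variables (P : probability Omega R).
Implicit Types (tau : R -> Omega -> Omega).

Lemma tau_measurable tau : measure_preserving_group P tau ->
  forall x, measurable_fun setT (tau x).
Proof.
by move=> [_ _ mtau _] x; exact: (measurable_fun_pair2 x mtau).
Qed.

Lemma Rintegral_tau tau (f : Omega -> R) (x : R) : measure_preserving_group P tau ->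
  measurable_fun setT f -> (forall w, 0 <= f w) ->
  \int[P]_w f (tau x w) = \int[P]_w f w.
Proof.
move=> mpt mf f0; have mtx := tau_measurable mpt x.
have [_ _ _ pres] := mpt.
rewrite /Rintegral; congr fine.
transitivity (\int[pushforward P (tau x)]_w (f w)%:E)%E.
  rewrite (ge0_integral_pushforward mtx)//; last 2 first.
  - exact/measurable_EFinP.
  - by move=> w _; rewrite lee_fin.
apply: (@eq_measure_integral _ _ _ _ P) => A mA _.
exact: pres.
Qed.

Lemma reverse_group tau : measure_preserving_group P tau ->
  measure_preserving_group P (fun x => tau (- x)).
Proof.
move=> [t0 tD mt pres]; split.
- by rewrite oppr0.
- by move=> x y; rewrite opprD tD.
- have mN : measurable_fun [set: measurableTypeR R * Omega] (fun p => (- p.1, p.2)).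
    apply: measurable_fun_pair; last exact: measurable_snd.
    by apply: measurableT_comp; [exact: oppr_measurable|exact: measurable_fst].
  exact: (measurableT_comp mt mN).
- by move=> x; exact: pres.
Qed.

Lemma reverse_ergodic tau : ergodic P tau -> ergodic P (fun x => tau (- x)).
Proof.
move=> erg A mA h; apply: erg => // x; rewrite -[x]opprK; exact: h.
Qed.

Section Maximal.
Variables (tau : R -> Omega -> Omega) (h : Omega -> R) (M : R).
Hypothesis tau_group : measure_preserving_group P tau.
Hypothesis mh : measurable_fun setT h.
Hypothesis hM : forall w, `|h w| <= M.

(* Maximum of 0 and of the first n ergodic sums of h. *)
Fixpoint max_sum (n : nat) (w : Omega) : R :=
  if n is n.+1 then Num.max 0 (h w + max_sum n (tau 1 w)) else 0.

Lemma max_sum_ge0 n w : 0 <= max_sum n w.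
Proof. by case: n => [|n] /=; rewrite ?le_max lexx. Qed.

Lemma max_sum_le n w : max_sum n w <= n%:R * M.
Proof.
have M0 : 0 <= M by exact: le_trans (normr_ge0 _) (hM w).
elim: n w => [|n IHn] w /=; first by rewrite mul0r.
rewrite ge_max mulr_ge0//= -natr1 mulrDl mul1r addrC lerD//.
exact: le_trans (ler_norm _) (hM w).
Qed.

Lemma max_sum_measurable n : measurable_fun setT (max_sum n).
Proof.
elim: n => [|n IHn] /=; first exact: measurable_cst.
apply: measurable_maxr; first exact: measurable_cst.
apply: measurable_funD => //; apply: (measurableT_comp IHn).
exact: tau_measurable.
Qed.

Lemma max_sumS n w : max_sum n w <= max_sum n.+1 w.
Proof.
elim: n w => [|n IHn] w; first by rewrite /= le_max lexx.
rewrite [leLHS]/= [leRHS]/= ge_max !le_max lexx/= lerD2l.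
by rewrite (IHn (tau 1 w)) orbT.
Qed.

Lemma max_sum_homo w : nondecreasing_seq (max_sum ^~ w).
Proof. by apply/nondecreasing_seqP => n; exact: max_sumS. Qed.

Let trunc_h n w := if 0 < max_sum n w then h w else 0.

Let trunc_measurable n : measurable_fun setT (trunc_h n).
Proof.
apply: measurable_fun_ifT => //.
by apply: measurable_fun_ltr => //; exact: max_sum_measurable.
Qed.

Let trunc_le n w : `|trunc_h n w| <= M.
Proof.
by rewrite /trunc_h; case: ifP => // _; rewrite normr0 (le_trans _ (hM w)).
Qed.

(** Garsia's argument: where [m > 0], the recursion gives [m <= h + m \o tau 1]; elsewhere [m = 0].
    So [m - m \o tau 1] is at most the truncated [h], and its mean is 0 by invariance. *)
Lemma maximal_inequality n : 0 <= \int[P]_w trunc_h n.+1 w.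
Proof.
pose m := max_sum n.+1.
have mm : measurable_fun setT m by exact: max_sum_measurable.
have m0 w : 0 <= m w by exact: max_sum_ge0.
have mM w : `|m w| <= n.+1%:R * M by rewrite ger0_norm//; exact: max_sum_le.
have mt := tau_measurable tau_group 1.
have mmt : measurable_fun setT (m \o tau 1) by exact: measurableT_comp.
have i1 := bounded_integrable P mm mM.
have i2 : P.-integrable setT (EFin \o (m \o tau 1)).
  by apply: (bounded_integrable P mmt) => w; exact: mM.
have <- : \int[P]_w (m w - m (tau 1 w)) = 0.
  by rewrite (RintegralB _ i1 i2)//= Rintegral_tau// subrr.
apply: (@le_expectation _ _ _ P _ _ (n.+1%:R * M + n.+1%:R * M) M) => //.
- exact: measurable_funB.
- by move=> w; rewrite (le_trans (ler_normB _ _))// lerD.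
move=> w; rewrite /trunc_h -/(m w); case: ifPn => [mw|].
  have : m w <= h w + max_sum n (tau 1 w).
    by move: mw; rewrite /m/= lt_max ltxx/= => mw; rewrite ge_max lexx andbT ltW.
  have := max_sumS n (tau 1 w); rewrite -/(m _); lra.
by rewrite -leNgt => mw; have := m0 (tau 1 w); lra.
Qed.

(** When almost every orbit has a positive partial sum, the truncation disappears in the limit of
    the maximal inequality. *)
Lemma recurrent_expectation_ge0 : {ae P, forall w, exists n, 0 < max_sum n w} ->
  0 <= \int[P]_w h w.
Proof.
move=> pos.
have iM := @finite_measure_integrable_cst _ _ _ P setT M measurableT.
have [] := @dominated_convergence _ _ R P setT measurableT
  (fun n w => (trunc_h n.+1 w)%:E) (EFin \o h) _ _ _ _ iM.
- by move=> n; apply/measurable_EFinP.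
- exact/measurable_EFinP.
- apply: filterS pos => w [n hn] _; apply: cvg_EFin; first exact: nearW.
  apply: cvg_near_cst; exists n => // k /= nk; rewrite /trunc_h.
  by rewrite (lt_le_trans hn)// max_sum_homo// leqW.
- by apply: aeW => w n _ /=; rewrite lee_fin; exact: trunc_le.
move=> ih _ cv; rewrite /Rintegral; apply: fine_ge0.
rewrite -(cvg_lim _ cv)//; apply: lime_ge; first by apply/cvg_ex; eexists; exact: cv.
apply: nearW => n; have := maximal_inequality n; rewrite /Rintegral => h0.
have fn : (\int[P]_w (trunc_h n.+1 w)%:E)%E \is a fin_num.
  apply: integrable_fin_num => //.
  exact: (bounded_integrable P (trunc_measurable n.+1) (trunc_le n.+1)).
have : (0 <= \int[P]_w (trunc_h n.+1 w)%:E)%E by rewrite -(fineK fn) lee_fin.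
exact.
Qed.

End Maximal.

Definition cocycle tau (F : R -> Omega -> R) (M : R) : Prop :=
  [/\ forall x y w, F (x + y) w = F x w + F y (tau x w),
      forall x w, `|F x w| <= M * `|x| &
      forall x, measurable_fun setT (F x)].

(* The set where [F n - al * n] is unbounded is invariant; if it had measure 1,
   the maximal inequality would give [al <= \int F 1]. *)
Lemma cocycle_le tau F (M al : R) : measure_preserving_group P tau ->
  ergodic P tau -> cocycle tau F M -> \int[P]_w F 1 w < al ->
  {ae P, forall w, exists C : R, forall x : R, 0 <= x -> F x w <= al * x + C}.
Proof.
move=> mpt erg [FD FM mF] Fal.
have [t0 tD _ _] := mpt.
pose B := [set w | forall N : nat, exists n : nat, N%:R < F n%:R w - al * n%:R].
have mB : measurable B.
  have -> : B = \bigcap_N \bigcup_n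
      ((fun w => F n%:R w - al * n%:R) @^-1` `]N%:R, +oo[).
    apply/seteqP; split => w /=.
      by move=> h N _; have [n hn] := h N; exists n => //=; rewrite in_itv/= hn.
    by move=> h N; have [n _ /=] := h N I; rewrite in_itv/= andbT => hn; exists n.
  apply: bigcapT_measurable => N; apply: bigcupT_measurable => n.
  rewrite -[X in measurable X]setTI.
  have mf : measurable_fun setT (fun w => F n%:R w - al * n%:R).
    by apply: measurable_funB => //; exact: mF.
  exact: mf.
have M0 (w : Omega) : 0 <= M by have := FM 1 w; rewrite normr1 mulr1; apply: le_trans.
have sub x w : B w -> B (tau x w).
  (* Moving the environment by [x] changes [F n] by at most [2 * M * |x|], by the cocycle identity
     read in both orders; [N'] exceeds [N] by more than that. *)
  move=> Bw N; pose N' := (N + Num.truncn (2 * M * `|x|)).+1.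
  have [n hn] := Bw N'; exists n.
  have e1 := FD x n%:R w; have e2 := FD n%:R x w.
  rewrite addrC e2 in e1.
  have h1 := FM x (tau n%:R w); have h2 := FM x w.
  rewrite ler_norml in h1; rewrite ler_norml in h2.
  have tr : 2 * M * `|x| < (Num.truncn (2 * M * `|x|)).+1%:R.
    have p0 : 0 <= 2 * M * `|x| by rewrite mulr_ge0// mulr_ge0// (M0 w).
    by have /andP[] := truncn_itv p0.
  have : N%:R + (Num.truncn (2 * M * `|x|)).+1%:R = N'%:R :> R.
    by rewrite -natrD addnS.
  move: e1 h1 h2 hn tr => + /andP[+ _] /andP[_ +]; clear; lra.
have inv x : tau x @` B = B.
  apply/seteqP; split => [_ [w Bw <-]|w Bw]; first exact: sub.
  exists (tau (- x) w); first exact: sub.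
  have := congr1 (fun f => f w) (tD x (- x)); rewrite subrr t0/=; exact: esym.
have B0 : P B = 0%E.
  have [//|B1] := erg B mB inv; exfalso.
  have mh : measurable_fun setT (fun w => F 1 w - al).
    by apply: measurable_funB => //; exact: mF.
  have hM w : `|F 1 w - al| <= M + `|al|.
    rewrite (le_trans (ler_normB _ _))// lerD//.
    by have := FM 1 w; rewrite normr1 mulr1.
  have pos : {ae P, forall w, exists n, 0 < max_sum tau (fun w => F 1 w - al) n w}.
    exists (~` B); split; first exact: measurableC.
      by rewrite probability_setC// B1 subee.
    move=> w /= nw Bw; apply: nw; have [n hn] := Bw 0%N; exists n.
    clear Bw.
    (* By the cocycle identity the left side is the [n]-th ergodic sum of [F 1 - al], one of those
       under the maximum. *)
    have key : F n%:R w - al * n%:R <= max_sum tau (fun w => F 1 w - al) n w.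
      clear hn M0; elim: n w => [|n IHn] w.
        have := FM 0 w; rewrite normr0 mulr0 normr_le0 => /eqP ->.
        by rewrite mulr0 subr0.
      rewrite /= le_max -natr1 [n%:R + 1]addrC FD mulrDr mulr1.
      by have := IHn (tau 1 w) => h; apply/orP; right; lra.
    exact: lt_le_trans hn key.
  have := recurrent_expectation_ge0 mpt mh hM pos.
  rewrite (RintegralB _ _ _)//; last 2 first.
    by apply: (@bounded_integrable _ _ _ P _ M) => // w; have := FM 1 w; rewrite normr1 mulr1.
    exact: finite_measure_integrable_cst.
  by rewrite expectation_cst' subr_ge0 leNgt Fal.
exists B; split => // w /= nw; apply: contrapT => /existsNP[N hN]; apply: nw.
have {}hN n : F n%:R w - al * n%:R <= N%:R.
  by rewrite leNgt; apply/negP => hn; apply: hN; exists n.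
(* Real times are compared with their integer part, at the cost of [M] for [F] and of [|al|] for the
   line. *)
exists (N%:R + M + `|al|) => x x0.
have /andP[n1 n2] := truncn_itv x0; pose n := Num.truncn x.
have := hN n; have -> : F x w = F n%:R w + F (x - n%:R) (tau n%:R w).
  by rewrite -FD addrC subrK.
have := FM (x - n%:R) (tau n%:R w); rewrite -/n in n1 n2.
rewrite (ger0_norm (_ : 0 <= x - n%:R)) ?subr_ge0// ler_norml => /andP[_ h1] h2.
rewrite -natr1 in n2.
have h3 : M * (x - n%:R) <= M.
  by have M00 := M0 w; clear M0; rewrite ler_piMr//; lra.
clear M0.
have h4 : al * (n%:R - x) <= `|al|.
  rewrite (le_trans (ler_norm _))// normrM ler_piMr// distrC ger0_norm ?subr_ge0//; lra.
lra.
Qed.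

Lemma cocycleN tau F M : cocycle tau F M -> cocycle tau (fun x w => - F x w) M.
Proof.
move=> [FD FM mF]; split=> [x y w|x w|x].
- by rewrite FD opprD.
- by rewrite normrN.
- by apply: measurableT_comp => //; exact: oppr_measurable.
Qed.

(** The upper bound is applied to [F] and to [- F], with slopes exceeding the mean by [1 / (k + 1)],
    so that the exceptional sets stay countable in number. *)
Lemma cocycle_cvg tau F (M : R) : measure_preserving_group P tau ->
  ergodic P tau -> cocycle tau F M ->
  {ae P, forall w, forall del, 0 < del -> exists C : R, forall x : R, 0 <= x ->
    `|F x w - x * \int[P]_w F 1 w| <= del * x + C}.
Proof.
move=> mpt erg cF; set m := \int[P]_w F 1 w.
have [FD FM mF] := cF.
have h1 (k : nat) : {ae P, forall w, exists C : R, forall x : R, 0 <= x ->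
    F x w <= (m + k.+1%:R^-1) * x + C}.
  by apply: (cocycle_le mpt erg cF); rewrite ltrDl invr_gt0.
have h2 (k : nat) : {ae P, forall w, exists C : R, forall x : R, 0 <= x ->
    - F x w <= (- m + k.+1%:R^-1) * x + C}.
  apply: (cocycle_le mpt erg (cocycleN cF)).
  have -> : \int[P]_w (- F 1 w) = - m.
    apply: expectationN.
    by apply: (@bounded_integrable _ _ _ P _ M) => // w; have := FM 1 w; rewrite normr1 mulr1.
  by rewrite ltrDl invr_gt0.
apply: filterS2 (ae_foralln h1) (ae_foralln h2) => w u1 u2 del del0.
pose k := Num.truncn del^-1.
have kd : k.+1%:R^-1 <= del.
  rewrite -[leRHS]invrK lef_pV2 ?posrE ?invr_gt0//.
  have di : 0 <= del^-1 by rewrite invr_ge0 ltW.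
  by have /andP[_ /ltW] := truncn_itv di.
have [C1 H1] := u1 k; have [C2 H2] := u2 k.
exists (`|C1| + `|C2|) => x x0.
have kx : k.+1%:R^-1 * x <= del * x by rewrite ler_wpM2r.
have := H1 x x0; have := H2 x x0; have := ler_norm C1; have := ler_norm C2.
have := normr_ge0 C1; have := normr_ge0 C2.
by move: (k.+1%:R^-1) kx => r kx *; rewrite ler_norml; apply/andP; split; lra.
Qed.

(** Negative positions are positive ones for the reversed flow and the cocycle [F (- x)], whose mean
    at 1 is minus that of [F 1] by invariance. *)
Theorem ergodic_cocycle tau F (M : R) : measure_preserving_group P tau ->
  ergodic P tau -> cocycle tau F M ->
  {ae P, forall w, forall del : R, 0 < del -> exists C : R, forall x : R,
    `|F x w - x * \int[P]_w F 1 w| <= del * `|x| + C}.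
Proof.
move=> mpt erg cF; have [FD FM mF] := cF; have [t0 tD _ _] := mpt.
have F00 w : F 0 w = 0.
  by have := FM 0 w; rewrite normr0 mulr0 normr_le0 => /eqP.
have cF' : cocycle (fun x => tau (- x)) (fun x w => F (- x) w) M.
  split=> [x y w|x w|x]; last exact: mF.
    by rewrite opprD FD.
  by have := FM (- x) w; rewrite normrN.
have h1 := cocycle_cvg mpt erg cF.
have h2 := cocycle_cvg (reverse_group mpt) (reverse_ergodic erg) cF'.
have E : \int[P]_w F (- 1) w = - \int[P]_w F 1 w.
  have nt := reverse_group mpt.
  have FE w : F (- 1) w = - F 1 (tau (- 1) w).
    have := FD (- 1) 1 w; rewrite addNr F00 => h; lra.
  have FM1 w : `|F 1 w| <= M by have := FM 1 w; rewrite normr1 mulr1.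
  have mF1 := mF 1.
  (* Adding [M] makes the integrand nonnegative, as [Rintegral_tau] requires. *)
  have pos w : 0 <= F 1 w + M.
    by have := FM1 w; rewrite ler_norml => /andP[h _]; lra.
  have mpos : measurable_fun setT (fun w => F 1 w + M) by exact: measurable_funD.
  have := Rintegral_tau (- 1) mpt mpos pos.
  have iF := bounded_integrable P mF1 FM1.
  have iM := @finite_measure_integrable_cst _ _ _ P setT M measurableT.
  have mFt : measurable_fun setT (fun w => F 1 (tau (- 1) w)).
    by apply: measurableT_comp => //; exact: tau_measurable.
  have iFt : P.-integrable setT (EFin \o (fun w => F 1 (tau (- 1) w))).
    by apply: (bounded_integrable P mFt) => w; exact: FM1.
  rewrite (RintegralD measurableT iF iM) (RintegralD measurableT iFt iM) => /addIr h.
  under eq_Rintegral do rewrite FE.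
  by rewrite (expectationN iFt) h.
rewrite E in h2; apply: filterS2 h1 h2 => w u1 u2 del del0.
have [C1 H1] := u1 del del0; have [C2 H2] := u2 del del0.
exists (`|C1| + `|C2|) => x; have := ler_norm C1; have := ler_norm C2.
have := normr_ge0 C1; have := normr_ge0 C2.
have [x0|x0] := leP 0 x.
  by rewrite (ger0_norm x0); have := H1 x x0; lra.
have nx : 0 <= - x by rewrite oppr_ge0 ltW.
have := H2 (- x) nx; rewrite opprK mulrNN (ltr0_norm x0); lra.
Qed.

End Flow.

(** * Dependence on the environment *)

Section JointMeasurability.
Context (R : realType) (d : measure_display) (Omega : measurableType d).
Notation mu := (@lebesgue_measure R).
Notation RO := (measurableTypeR R * Omega)%type.

Definition jointly_measurable (f : R -> Omega -> R) : Prop :=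
  measurable_fun [set: RO] (fun p : RO => f p.1 p.2).

Lemma jointly_measurable_section f x : jointly_measurable f ->
  measurable_fun setT (f x).
Proof. by move=> mf; exact: (measurable_fun_pair2 x mf). Qed.

(** The varying domain is absorbed into an indicator on the product; the measurability part of
    Tonelli's theorem then applies. *)
Lemma measurable_Rintegral_param (g : R -> Omega -> R) (D : R -> set R) :
  jointly_measurable g -> (forall y w, 0 <= g y w) ->
  measurable [set z : measurableTypeR R * measurableTypeR R | D z.1 z.2] ->
  jointly_measurable (fun x w => \int[mu]_(y in D x) g y w).
Proof.
move=> mg g0 mD.
pose D' := [set q : RO * measurableTypeR R | D q.1.1 q.2].
have mD' : measurable D'.
  have mq : measurable_fun [set: RO * measurableTypeR R]
      (fun q => (q.1.1, q.2) : measurableTypeR R * measurableTypeR R).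
    apply: measurable_fun_pair; last exact: measurable_snd.
    by apply: measurableT_comp; exact: measurable_fst.
  by have := mq measurableT _ mD; rewrite setTI.
pose f (q : RO * measurableTypeR R) : \bar R := (g q.2 q.1.2 * \1_D' q)%:E.
have mf : measurable_fun setT f.
  apply/measurable_EFinP; apply: measurable_funM; last exact: measurable_indic.
  have mq : measurable_fun [set: RO * measurableTypeR R] (fun q => (q.2, q.1.2) : RO).
    apply: measurable_fun_pair; first exact: measurable_snd.
    by apply: measurableT_comp; [exact: measurable_snd|exact: measurable_fst].
  exact: (measurableT_comp mg mq).
have f0 q : (0 <= f q)%E by rewrite lee_fin mulr_ge0.
have := @measurable_fun_fubini_tonelli_F _ _ _ _ _ mu f mf f0.
move=> mF.
rewrite /jointly_measurable.
have -> : (fun p : RO => \int[mu]_(y in D p.1) g y p.2) =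
    (fun p : RO => fine (fubini_F mu f p)).
  apply/funext => p; rewrite /Rintegral integral_mkcond; congr fine.
  apply: eq_integral => y _; rewrite /f patchE indicE.
  have -> : ((p, y) \in D') = (y \in D p.1) by apply/idP/idP; rewrite !inE.
  by case: (y \in D p.1); rewrite ?mulr1 ?mulr0.
exact: (measurableT_comp (fine_measurable measurableT) mF).
Qed.

Lemma jointly_measurable_prim (g : R -> Omega -> R) : jointly_measurable g ->
  (forall y w, 0 <= g y w) -> jointly_measurable (fun x w => prim (g ^~ w) x).
Proof.
move=> mg g0; apply: measurable_funB.
  apply: (@measurable_Rintegral_param g (fun x => `[0, x]%classic)) => //.
  rewrite (_ : [set _ | _] = (snd @^-1` `[0, +oo[) `&`
     (fun z : measurableTypeR R * measurableTypeR R => z.1 - z.2) @^-1` `[0, +oo[).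
    apply: measurableI.
      by rewrite -[X in measurable X]setTI; exact: measurable_snd.
    rewrite -[X in measurable X]setTI.
    have mB : measurable_fun [set: measurableTypeR R * measurableTypeR R] (fun z => z.1 - z.2).
      by apply: measurable_funB; [exact: measurable_fst|exact: measurable_snd].
    exact: mB.
  apply/seteqP; split => z /=; rewrite !in_itv/= !andbT subr_ge0.
    by move=> /andP[].
  by move=> [-> ->].
apply: (@measurable_Rintegral_param g (fun x => `[x, 0]%classic)) => //.
rewrite (_ : [set _ | _] = (snd @^-1` `]-oo, 0]) `&`
   (fun z : measurableTypeR R * measurableTypeR R => z.1 - z.2) @^-1` `]-oo, 0]).
  apply: measurableI.
    by rewrite -[X in measurable X]setTI; exact: measurable_snd.
  rewrite -[X in measurable X]setTI.
  have mB : measurable_fun [set: measurableTypeR R * measurableTypeR R] (fun z => z.1 - z.2).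
    by apply: measurable_funB; [exact: measurable_fst|exact: measurable_snd].
  exact: mB.
apply/seteqP; split => z /=; rewrite !in_itv/= subr_le0.
  by move=> /andP[].
by move=> [-> ->].
Qed.

Lemma jointly_measurable_kint (b : R -> Omega -> R) (K : R) (h : R -> Omega -> R) :
  jointly_measurable b -> (forall y w, 0 <= b y w) ->
  jointly_measurable h -> (forall y w, 0 <= h y w) ->
  jointly_measurable (fun x w => kint (b ^~ w) K (h ^~ w) x / kexp (b ^~ w) K x).
Proof.
move=> mb b0 mh h0.
have mk : jointly_measurable (fun x w => kexp (b ^~ w) K x).
  have mKp : measurable_fun [set: RO] (fun p => K * prim (b ^~ p.2) p.1).
    by apply: measurable_funM => //; exact: jointly_measurable_prim.
  exact: (measurableT_comp (@measurable_expR R) mKp).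
apply: measurable_funM.
  apply: (@measurable_Rintegral_param (fun y w => kexp (b ^~ w) K y * b y w * h y w)
      (fun x => `]-oo, x]%classic)).
  - by apply: measurable_funM => //; exact: measurable_funM.
  - by move=> y w; rewrite mulr_ge0// mulr_ge0// ltW// kexp_gt0.
  rewrite (_ : [set _ | _] =
     (fun z : measurableTypeR R * measurableTypeR R => z.1 - z.2) @^-1` `[0, +oo[).
    rewrite -[X in measurable X]setTI.
    have mB : measurable_fun [set: measurableTypeR R * measurableTypeR R] (fun z => z.1 - z.2).
      by apply: measurable_funB; [exact: measurable_fst|exact: measurable_snd].
    exact: mB.
  by apply/seteqP; split => z /=; rewrite !in_itv/= andbT subr_ge0.
rewrite (_ : (fun x : RO => _) = (fun p : RO => expR (- (K * prim (b ^~ p.2) p.1)))).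
  have mKp : measurable_fun [set: RO] (fun p => K * prim (b ^~ p.2) p.1).
    by apply: measurable_funM => //; exact: jointly_measurable_prim.
  exact: (measurableT_comp (@measurable_expR R) (measurableT_comp (@oppr_measurable R setT) mKp)).
by apply/funext => p; rewrite expRN.
Qed.

Variables (G : R -> R) (a V : R -> Omega -> R) (beta lambda K : R).
Hypothesis G_lip : locally_lipschitz G.
Hypothesis G_pinfty : G p @[p --> +oo] --> +oo.
Hypothesis G0 : G 0 = 0.
Hypothesis G_incr : {in `[0, +oo[ &, {homo G : p q / p < q}}.
Hypothesis beta_gt0 : 0 < beta.
Hypothesis a01 : forall x w, 0 < a x w <= 1.
Hypothesis V01 : forall x w, 0 <= V x w <= 1.
Hypothesis ca : forall w, continuous (a ^~ w).
Hypothesis cV : forall w, continuous (V ^~ w).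
Hypothesis ma : jointly_measurable a.
Hypothesis mV : jointly_measurable V.
Hypothesis lambda_ge : beta <= lambda.
Hypothesis GK : lipschitz_ball G (G2_inv G lambda) K.

(** For positive [a] the inverse is [expR (- ln a)], a composition of measurable functions. *)
Lemma jointly_measurable_inv : jointly_measurable (fun x w => (a x w)^-1).
Proof.
rewrite /jointly_measurable.
have -> : (fun p : RO => (a p.1 p.2)^-1) = (fun p : RO => expR (- ln (a p.1 p.2))).
  by apply/funext => p; rewrite expRN lnK// posrE; have /andP[] := a01 p.1 p.2.
have ml := measurableT_comp (@measurable_ln R) ma.
exact: (measurableT_comp (@measurable_expR R) (measurableT_comp (@oppr_measurable R setT) ml)).
Qed.

Lemma slope_iter_jointly_measurable n :
  jointly_measurable (fun x w => slope_iter G (a ^~ w) (V ^~ w) beta lambda K n x).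
Proof.
have K0 : 0 < K by case: GK.
have lb0 : 0 <= lambda - beta by rewrite subr_ge0.
have [q0 _] := G2_invP G_lip G_pinfty G0 G_incr lb0.
elim: n => [|n IHn]; first exact: measurable_cst.
have cG := locally_lipschitz_continuous G_lip.
apply: (@jointly_measurable_kint (fun x w => (a x w)^-1) K
  (fun y w => slope_source G (V ^~ w) beta lambda K
     (slope_iter G (a ^~ w) (V ^~ w) beta lambda K n) y)).
- exact: jointly_measurable_inv.
- by move=> y w; rewrite invr_ge0 ltW//; have /andP[] := a01 y w.
- apply: measurable_funD.
    apply: measurable_funB; first exact: measurable_funM.
    exact: (measurableT_comp (continuous_measurable_fun cG) IHn).
  by apply: measurable_funB => //; exact: measurable_funM.
- move=> y w.
  have [_ bn] := @slope_iterP R G G_lip G_pinfty G0 G_incr (a ^~ w) (V ^~ w) beta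
    beta_gt0 (a01 ^~ w) (V01 ^~ w) (@ca w) (@cV w) lambda K lambda_ge GK n.
  have := @slope_source_bounds R G G_lip G_pinfty G0 G_incr (V ^~ w) beta
    beta_gt0 (V01 ^~ w) lambda K lambda_ge GK _ bn y.
  by move=> /andP[h _]; apply: le_trans h; rewrite mulr_ge0// ?(ltW K0).
Qed.

(** The reason for an explicit iteration: each step is an integral with a parameter, hence jointly
    measurable in position and environment, and pointwise limits keep this. *)
Lemma slope_jointly_measurable :
  jointly_measurable (fun x w => slope G (a ^~ w) (V ^~ w) beta lambda K x).
Proof.
apply: (measurable_fun_cvg (h := fun n (p : RO) =>
  slope_iter G (a ^~ p.2) (V ^~ p.2) beta lambda K n p.1)).
  by move=> n; exact: slope_iter_jointly_measurable.
move=> p _; exact: (@slope_iter_cvg R G G_lip G_pinfty G0 G_incr (a ^~ p.2) (V ^~ p.2) beta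
    beta_gt0 (a01 ^~ p.2) (V01 ^~ p.2) (@ca p.2) (@cV p.2) lambda K lambda_ge GK p.1).
Qed.

End JointMeasurability.

(** * Primitives of stationary functions as cocycles *)

Section StationaryPrimitive.
Context (R : realType) (d : measure_display) (Omega : measurableType d).
Variables (P : probability Omega R) (tau : R -> Omega -> Omega).
Variables (g : R -> Omega -> R) (M : R).
Hypothesis tau_group : measure_preserving_group P tau.
Hypothesis mg : jointly_measurable g.
Hypothesis sg : stationary tau g.
Hypothesis gM : forall x w, 0 <= g x w <= M.
Notation mu := (@lebesgue_measure R).

Let mgw w : measurable_fun setT (g ^~ w).
Proof. exact: (measurable_fun_pair1 w mg). Qed.

Let ig w (b c : R) : mu.-integrable `[b, c] (EFin \o g ^~ w).
Proof. exact: (bounded_integrable_segment b c (mgw w) (gM ^~ w)). Qed.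

Let g0 x w : 0 <= g x w.
Proof. by have /andP[] := gM x w. Qed.

Lemma stationary_translate x y w : g (x + y) w = g x (tau y w).
Proof. by have [_ tD _ _] := tau_group; rewrite sg tD [RHS]sg. Qed.

Lemma integral_segment_bounds w (x y : R) : x <= y ->
  0 <= \int[mu]_(t in `[x, y]) g t w <= M * (y - x).
Proof.
move=> xy; apply/andP; split.
  by apply: Rintegral_ge0 => t _.
have -> : M * (y - x) = \int[mu]_(t in `[x, y]) (cst M t).
  rewrite Rintegral_cst//; congr (_ * _).
  suff m : lebesgue_measure `[x, y]%classic = (y - x)%:E by exact: (esym (congr1 fine m)).
  by rewrite lebesgue_measure_itv/= lte_fin; case: ltgtP xy => // -> _; rewrite subrr.
apply: le_Rintegral => //.
  by apply: continuous_integrable_segment => z; exact: cvg_cst.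
by move=> t _; have /andP[] := gM t w.
Qed.

Lemma prim_cocycle : cocycle tau (fun x w => prim (g ^~ w) x) M.
Proof.
split.
- move=> x y w.
  have E : g ^~ (tau x w) = fun z => g (z + x) w.
    by apply/funext => z; rewrite stationary_translate.
  have sD (p q r : R) : p - q = r -> p = q + r by move=> <-; rewrite addrC subrK.
  by rewrite E [x + y]addrC; apply: sD; apply: prim_shift => //; rewrite -E.
- move=> x w; rewrite -[prim _ x]subr0 -(prim0 (g ^~ w)).
  have [x0|x0] := leP 0 x.
    rewrite (primB (ig w) x0) ger0_norm//; last first.
      by have /andP[] := integral_segment_bounds w x0.
    by have /andP[_] := integral_segment_bounds w x0; rewrite subr0 (ger0_norm x0).
  rewrite distrC (primB (ig w) (ltW x0)) ger0_norm//; last first.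
    by have /andP[] := integral_segment_bounds w (ltW x0).
  by have /andP[_] := integral_segment_bounds w (ltW x0); rewrite sub0r (ltr0_norm x0).
- move=> x; apply: (@jointly_measurable_section _ _ _ (fun x w => prim (g ^~ w) x)).
  exact: jointly_measurable_prim.
Qed.

(** Tonelli exchanges the mean with the integral over [[0, 1]], and by stationarity the inner mean
    does not depend on the position. *)
Lemma expectation_prim : \int[P]_w prim (g ^~ w) 1 = \int[P]_w g 0 w.
Proof.
pose f (q : Omega * measurableTypeR R) : \bar R :=
  (g q.2 q.1 * \1_(`[0, 1]%classic : set R) q.2)%:E.
have mf : measurable_fun setT f.
  apply/measurable_EFinP; apply: measurable_funM.
    have mq : measurable_fun [set: Omega * measurableTypeR R]
        (fun q => (q.2, q.1) : measurableTypeR R * Omega).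
      by apply: measurable_fun_pair; [exact: measurable_snd|exact: measurable_fst].
    exact: (measurableT_comp mg mq).
  have m1 : measurable_fun setT (\1_(`[0, 1]%classic : set R) : measurableTypeR R -> R).
    exact: measurable_indic.
  exact: (measurableT_comp m1 measurable_snd).
have f0 q : (0 <= f q)%E by rewrite lee_fin mulr_ge0.
have tonelli := @fubini_tonelli _ _ _ _ R P mu f mf f0.
have restr (k : R -> R) : (\int[mu]_y (k y * \1_(`[0, 1]%classic : set R) y)%:E =
    \int[mu]_(y in `[0%R, 1%R]%classic) (k y)%:E)%E.
  rewrite [RHS]integral_mkcond; apply: eq_integral => y _.
  by rewrite patchE indicE; case: (y \in _); rewrite ?mulr1 ?mulr0.
have m01 : mu `[0, 1]%classic = 1%E.
  by rewrite lebesgue_measure_itv/= lte_fin ltr01 oppr0 adde0.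
have E1 w : (\int[mu]_y f (w, y) = (prim (g ^~ w) 1)%:E)%E.
  rewrite /f/= restr; have := primB (ig w) ler01; rewrite prim0 subr0 => ->.
  by rewrite /Rintegral fineK//; exact: integrable_fin_num (ig w 0 1).
have ix x : P.-integrable setT (EFin \o g x).
  apply: (@bounded_integrable _ _ _ P _ M (jointly_measurable_section x mg)) => w.
  by rewrite ger0_norm//; have /andP[] := gM x w.
have E2 y : (\int[P]_w f (w, y) =
    (\int[P]_w g 0 w * \1_(`[0, 1]%classic : set R) y)%:E)%E.
  rewrite /f/= EFinM.
  have iy := ix y.
  under eq_integral do rewrite EFinM muleC.
  rewrite integralZl// muleC; congr (_ * _)%E.
  rewrite -[LHS]fineK; last by apply: integrable_fin_num.
  congr EFin.
  transitivity (\int[P]_w g 0 (tau y w)).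
    by apply: eq_Rintegral => w _; rewrite -stationary_translate add0r.
  by apply: (Rintegral_tau y tau_group (jointly_measurable_section 0 mg)) => w.
rewrite /Rintegral; under eq_integral do rewrite -E1.
rewrite tonelli (eq_integral _ _ (fun y _ => E2 y)).
rewrite (restr (fun=> \int[P]_w g 0 w)) integral_cst//.
by rewrite [X in (_ * X)%E]m01 mule1.
Qed.

End StationaryPrimitive.

(** * Nonnegative slopes: the branch of [theta2] *)

Section RightBranch.
Context (R : realType) (d : measure_display) (Omega : measurableType d).
Variables (P : probability Omega R) (tau : R -> Omega -> Omega).
Variables (G : R -> R) (a V : R -> Omega -> R) (beta : R).
Hypothesis tau_group : measure_preserving_group P tau.
Hypothesis P_ergodic : ergodic P tau.
Hypothesis beta_gt0 : 0 < beta.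
Hypothesis G_lip : locally_lipschitz G.
Hypothesis G_pinfty : G p @[p --> +oo] --> +oo.
Hypothesis G0 : G 0 = 0.
Hypothesis G_incr : {in `[0, +oo[ &, {homo G : p q / p < q}}.
Hypothesis a01 : forall x w, 0 < a x w <= 1.
Hypothesis V01 : forall x w, 0 <= V x w <= 1.
Hypothesis a_meas : measurable_fun setT (a 0).
Hypothesis V_meas : measurable_fun setT (V 0).
Hypothesis a_stat : stationary tau a.
Hypothesis V_stat : stationary tau V.
Hypothesis ca : forall w, continuous (a ^~ w).
Hypothesis cV : forall w, continuous (V ^~ w).
Notation mu := (@lebesgue_measure R).

Lemma stationary_jointly_measurable (g : R -> Omega -> R) :
  measurable_fun setT (g 0) -> stationary tau g -> jointly_measurable g.
Proof.
move=> mg sg; have [_ _ mt _] := tau_group.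
rewrite /jointly_measurable (_ : (fun p => g p.1 p.2) =
  (fun p : measurableTypeR R * Omega => g 0 (tau p.1 p.2))).
  exact: (measurableT_comp mg mt).
by apply/funext => p; exact: sg.
Qed.

Let ma := stationary_jointly_measurable a_meas a_stat.
Let mV := stationary_jointly_measurable V_meas V_stat.

Lemma ex_lipschitz_ball (M : R) : exists L, lipschitz_ball G M L.
Proof. by have [L L0 H] := locally_lipschitz_segment G_lip M; exists L. Qed.

(* The slope does not depend on the Lipschitz constant that [cid] selects, by
   [slope_sol_unique] below. *)
Definition slope2 (lambda : R) (x : R) (w : Omega) : R :=
  slope G (a ^~ w) (V ^~ w) beta lambda
    (projT1 (cid (ex_lipschitz_ball (G2_inv G lambda)))) x.

Let lb (lambda : R) : beta <= lambda -> 0 <= lambda - beta /\ 0 <= lambda.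
Proof. by move=> bl; split; [rewrite subr_ge0|exact: le_trans (ltW beta_gt0) bl]. Qed.

Lemma slope2_sol lambda w : beta <= lambda ->
  slope_sol G (a ^~ w) (V ^~ w) beta lambda (slope2 lambda ^~ w).
Proof.
move=> bl; rewrite /slope2; case: cid => K GK /=.
exact: (@slope_is_sol R G G_lip G_pinfty G0 G_incr (a ^~ w) (V ^~ w) beta
    beta_gt0 (a01 ^~ w) (V01 ^~ w) (@ca w) (@cV w) lambda K bl GK).
Qed.

Lemma slope2_bounds lambda x w : beta <= lambda ->
  G2_inv G (lambda - beta) <= slope2 lambda x w <= G2_inv G lambda.
Proof.
move=> bl; rewrite /slope2; case: cid => K GK /=.
exact: (@slope_bounds R G G_lip G_pinfty G0 G_incr (a ^~ w) (V ^~ w) beta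
    beta_gt0 (a01 ^~ w) (V01 ^~ w) (@ca w) (@cV w) lambda K bl GK).
Qed.

Lemma slope2_ge0 lambda x w : beta <= lambda -> 0 <= slope2 lambda x w.
Proof.
move=> bl; have [l1 l2] := lb bl.
have [q0 _] := G2_invP G_lip G_pinfty G0 G_incr l1.
by have /andP[h _] := slope2_bounds x w bl; exact: le_trans h.
Qed.

Lemma slope2_range lambda Q x w : beta <= lambda -> lambda <= Q ->
  0 <= slope2 lambda x w <= G2_inv G Q.
Proof.
move=> bl lQ; rewrite slope2_ge0//=; have [l1 l2] := lb bl.
have /andP[_ h] := slope2_bounds x w bl; apply: (le_trans h).
exact: (G2_inv_le G_lip G_pinfty G0 G_incr).
Qed.

Lemma slope2_measurable lambda : beta <= lambda -> jointly_measurable (slope2 lambda).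
Proof.
move=> bl; rewrite /slope2; case: cid => K GK /=.
exact: slope_jointly_measurable.
Qed.

Lemma slope2_continuous lambda w : beta <= lambda -> continuous (slope2 lambda ^~ w).
Proof. by move=> bl; exact: slope_sol_continuous (slope2_sol w bl). Qed.

Lemma slope_sol_unique lambda w f : beta <= lambda ->
  slope_sol G (a ^~ w) (V ^~ w) beta lambda f ->
  (forall x, 0 <= f x <= G2_inv G lambda) -> f = slope2 lambda ^~ w.
Proof.
move=> bl fs fb; apply/funext => x; have s2 := slope2_sol w bl.
have b2 y := slope2_range y w bl (lexx lambda).
apply/eqP; rewrite eq_le; apply/andP; split.
  exact: (slope_le G_lip G_incr (a01 ^~ w) fs s2 fb b2 (lexx _)).
exact: (slope_le G_lip G_incr (a01 ^~ w) s2 fs b2 fb (lexx _)).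
Qed.

(** A translated slope solves the equation of the translated environment, where slopes in the given
    range are unique. *)
Lemma slope2_stationary lambda x y w : beta <= lambda ->
  slope2 lambda (x + y) w = slope2 lambda x (tau y w).
Proof.
move=> bl; have [_ tD _ _] := tau_group.
have st (g : R -> Omega -> R) : stationary tau g ->
    forall z, g z (tau y w) = g (z + y) w.
  by move=> sg z; rewrite sg [RHS]sg tD.
suff E : (fun x => slope2 lambda (x + y) w) = slope2 lambda ^~ (tau y w).
  exact: (congr1 (fun f => f x) E).
apply: slope_sol_unique => // [z|z]; last exact: slope2_range.
rewrite !st//.
have dz : is_derive z (1 : R) (fun z : R => z + y) 1.
  by apply: is_derive_eq; rewrite addr0.
have := @is_derive1_comp R (slope2 lambda ^~ w) (fun z => z + y) z _ _
  (slope2_sol w bl (z + y)) dz.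
by rewrite mulr1.
Qed.

(** The set from which [F2] is chosen is a singleton with an explicit element, which gives access to
    the measurability and stationarity of a function defined by choice. *)
Lemma corrector2P lambda w F : beta <= lambda ->
  corrector G a V beta (slopes2 G beta) lambda w F <->
  F = prim (slope2 lambda ^~ w).
Proof.
move=> bl; have a0 x : 0 < a x w by have /andP[] := a01 x w.
split.
- move=> [[dF ddF cF] F0 eqF rF].
  have [l1 l2] := lb bl.
  have [q0 _] := G2_invP G_lip G_pinfty G0 G_incr l1.
  have <- : derive1 F = slope2 lambda ^~ w.
    apply: slope_sol_unique => // x.
      have := derivable_is_derive (ddF x); have := eqF x.
      move: (derive1 (derive1 F) x) => D /= E dD.
      suff <- : D = (lambda - beta * V x w - G (derive1 F x)) / a x w by [].
      rewrite -E; move: (G _) => g; field; exact: lt0r_neq0.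
    have := rF x; rewrite /slopes2/= in_itv/= => /andP[h1 h2].
    by rewrite h2 (le_trans q0 h1).
  apply: (prim_unique (derivable_continuous ddF) F0) => x.
  exact: (derivable_is_derive (dF x)).
- move=> ->.
  have cs := @slope2_continuous lambda w bl.
  have dF x := is_derive_prim cs x.
  have ddF := slope2_sol w bl.
  have cdd : continuous (fun x =>
      (lambda - beta * V x w - G (slope2 lambda x w)) / a x w).
    move=> x; apply: cvgM.
      apply: cvgB; first by apply: cvgB; [exact: cvg_cst|apply: cvgMr; exact: cV].
      apply: (@continuous_comp _ _ _ (slope2 lambda ^~ w) G); first exact: cs.
      exact: locally_lipschitz_continuous.
    by apply: cvgV; [exact: lt0r_neq0|exact: ca].
  have [C2 E1 E2] := C2_line_of dF ddF cdd.
  split=> //; first exact: prim0.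
    move=> x; rewrite E2 E1 mulrCA divff ?lt0r_neq0// mulr1; ring.
  by move=> x; rewrite E1 /slopes2/= in_itv/=; exact: slope2_bounds.
Qed.

Lemma F2E lambda w : beta <= lambda ->
  F2 G a V beta lambda w = prim (slope2 lambda ^~ w).
Proof.
move=> bl; apply/(corrector2P w _ bl); rewrite /F2; apply: xgetPex.
by exists (prim (slope2 lambda ^~ w)); apply/(corrector2P w _ bl).
Qed.

Lemma is_derive_F2 lambda w : beta <= lambda ->
  forall x : R, is_derive x (1 : R) (F2 G a V beta lambda w) (slope2 lambda x w).
Proof.
by move=> bl x; rewrite F2E//; apply: is_derive_prim; exact: slope2_continuous.
Qed.

Lemma theta2E lambda : beta <= lambda ->
  theta2 P G a V beta lambda = \int[P]_w slope2 lambda 0 w.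
Proof.
move=> bl; rewrite /theta2 unlock; congr fine; apply: eq_integral => w _.
by congr EFin; exact: (is_derive1 (is_derive_F2 w bl 0)).
Qed.

Let slope2_bounded lambda x w : beta <= lambda -> `|slope2 lambda x w| <= G2_inv G lambda.
Proof.
by move=> bl; have /andP[h1 h2] := slope2_range x w bl (lexx lambda); rewrite ger0_norm.
Qed.

Let mslope lambda x : beta <= lambda -> measurable_fun setT (slope2 lambda x).
Proof. by move=> bl; exact: (jointly_measurable_section x (slope2_measurable bl)). Qed.

Lemma slope2_integrable lambda x : beta <= lambda ->
  P.-integrable setT (EFin \o slope2 lambda x).
Proof.
move=> bl; apply: (bounded_integrable P (mslope x bl)) => w.
exact: slope2_bounded.
Qed.

Lemma theta2_gap (lambda nu L : R) : beta <= lambda -> lambda <= nu ->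
  lipschitz_ball G (G2_inv G nu) L ->
  (nu - lambda) / L <= theta2 P G a V beta nu - theta2 P G a V beta lambda.
Proof.
move=> bl ln GL; have bn := le_trans bl ln; rewrite !theta2E//.
rewrite -(RintegralB _ (slope2_integrable 0 bn) (slope2_integrable 0 bl))//.
rewrite -[leLHS](expectation_cst' P).
apply: (@le_expectation _ _ _ P _ _ `|(nu - lambda) / L|
  (G2_inv G nu + G2_inv G lambda)) => //.
- exact: measurable_funB (mslope 0 bn) (mslope 0 bl).
- by move=> w; rewrite (le_trans (ler_normB _ _))// lerD// slope2_bounded.
move=> w; apply: (slope_gap G_lip G_incr (a01 ^~ w) (slope2_sol w bl) (slope2_sol w bn) _ _ GL ln).
- by move=> x; exact: slope2_range.
- by move=> x; exact: slope2_range.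
Qed.

(** The constant of [G_modulus] depends only on [G], [e] and the range of slopes, so closeness is
    uniform in position and environment. It gives the continuity of [theta2] and the passage from
    rational to real [lambda]. *)
Lemma slope2_close (Q e : R) : 0 < e -> exists2 m : R, 0 < m &
  forall lambda nu, beta <= lambda <= Q -> beta <= nu <= Q -> `|lambda - nu| <= m ->
  (forall x w, `|slope2 lambda x w - slope2 nu x w| <= e) /\
  `|theta2 P G a V beta lambda - theta2 P G a V beta nu| <= e.
Proof.
move=> e0; have [m m0 Gm] := G_modulus G_lip G_incr (G2_inv G Q) e0.
exists (m / 2); first exact: divr_gt0.
move=> lambda nu /andP[bl lQ] /andP[bn nQ] lnm.
have H x w : `|slope2 lambda x w - slope2 nu x w| <= e.
  have h1 := @slope_close R G (a ^~ w) (V ^~ w) beta (a01 ^~ w) _ e m lambda nu _ _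
    e0 m0 Gm (slope2_sol w bl) (slope2_sol w bn) (fun y => slope2_range y w bl lQ)
    (fun y => slope2_range y w bn nQ).
  have h2 := @slope_close R G (a ^~ w) (V ^~ w) beta (a01 ^~ w) _ e m nu lambda _ _
    e0 m0 Gm (slope2_sol w bn) (slope2_sol w bl) (fun y => slope2_range y w bn nQ)
    (fun y => slope2_range y w bl lQ).
  move: lnm; rewrite ler_norml => /andP[n1 n2].
  have n3 : nu - lambda <= m / 2 by rewrite lerNl opprB in n1.
  have k1 := h1 n2 x; have k2 := h2 n3 x.
  by rewrite ler_norml lerBlDl k1 andbT lerNl opprB lerBlDl.
split=> //; rewrite !theta2E//.
rewrite -(RintegralB _ (slope2_integrable 0 bl) (slope2_integrable 0 bn))//.
have B w : `|slope2 lambda 0 w - slope2 nu 0 w| <= e by [].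
have mB := measurable_funB (mslope 0 bl) (mslope 0 bn).
rewrite ler_norml; apply/andP; split.
  rewrite -[leLHS](expectation_cst' P).
  apply: (@le_expectation _ _ _ P _ _ `|- e| e) => // w.
  by have := B w; rewrite ler_norml => /andP[].
rewrite -[leRHS](expectation_cst' P).
apply: (@le_expectation _ _ _ P _ _ e `|e|) => // w.
by have := B w; rewrite ler_norml => /andP[].
Qed.

Lemma theta2_ge lambda : beta <= lambda ->
  G2_inv G (lambda - beta) <= theta2 P G a V beta lambda.
Proof.
move=> bl; rewrite theta2E// -[leLHS](expectation_cst' P).
apply: (@le_expectation _ _ _ P _ _ `|G2_inv G (lambda - beta)| (G2_inv G lambda)) => //.
- exact: mslope.
- by move=> w; exact: slope2_bounded.
- by move=> w; have /andP[] := slope2_bounds 0 w bl.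
Qed.

Lemma theta2_ge0 lambda : beta <= lambda -> 0 <= theta2 P G a V beta lambda.
Proof.
move=> bl; apply: le_trans (theta2_ge bl); have [l1 _] := lb bl.
by have [] := G2_invP G_lip G_pinfty G0 G_incr l1.
Qed.

Lemma theta2_lt lambda nu : beta <= lambda -> lambda < nu ->
  theta2 P G a V beta lambda < theta2 P G a V beta nu.
Proof.
move=> bl ln; have [L GL] := ex_lipschitz_ball (G2_inv G nu).
have := theta2_gap bl (ltW ln) GL; have [L0 _] := GL.
move=> h; rewrite -subr_gt0; apply: lt_le_trans h.
by rewrite divr_gt0// subr_gt0.
Qed.

Lemma theta2_surj th : theta2 P G a V beta beta <= th ->
  exists2 lambda, beta <= lambda & theta2 P G a V beta lambda = th.
Proof.
move=> tth; have th0 : 0 <= th := le_trans (theta2_ge0 (lexx beta)) tth.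
have Gth : 0 <= G th by rewrite -G0; apply: G_le.
(* At this [lambda] the lower bound [G2_inv G (lambda - beta)] of the slopes is already [th], which
   closes the interval for the intermediate value theorem. *)
pose Q := beta + G th.
have bQ : beta <= Q by rewrite lerDl.
have thQ : th <= theta2 P G a V beta Q.
  apply: le_trans (theta2_ge bQ); rewrite /Q [beta + _]addrC addrK.
  by rewrite (G2_invK G_lip G_pinfty G0 G_incr).
have cth : {within `[beta, Q], continuous (theta2 P G a V beta)}.
  apply/subspace_continuousP => x; rewrite /= in_itv/= => xi.
  apply/cvgrPdist_le => e e0; have [m m0 H] := slope2_close Q e0.
  near=> y.
  have yi : beta <= y <= Q by near: y; apply: withinT.
  have xy : `|x - y| <= m.
    by near: y; apply: cvg_within; apply: filterS (near_ball x m0) => y /ltW.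
  by have [_] := H x y xi yi xy.
have := @IVT R _ beta Q th bQ cth; have h := le_trans tth thQ.
rewrite (min_l h) (max_r h) tth thQ => /(_ isT)[c].
by rewrite in_itv/= => /andP[bc _] <-; exists c.
Unshelve. all: by end_near. Qed.

(* The exceptional set is uniform in [lambda] because rational values suffice:
   the slopes are equicontinuous in [lambda]. *)
Lemma F2_asymptotics : {ae P, forall w, forall lambda, beta <= lambda ->
  forall del : R, 0 < del -> exists C : R, forall x : R,
    `|F2 G a V beta lambda w x - theta2 P G a V beta lambda * x| <= del * `|x| + C}.
Proof.
(* An enumeration of the values [beta + |q|] with [q] rational; an index that encodes no rational
   receives [q = 0]. *)
pose ln (n : nat) : R := beta + `|ratr (odflt 0 (unpickle n) : rat)|.
have bn n : beta <= ln n by rewrite lerDl.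
have H n : {ae P, forall w, forall del : R, 0 < del -> exists C : R, forall x : R,
    `|F2 G a V beta (ln n) w x - theta2 P G a V beta (ln n) * x| <= del * `|x| + C}.
  have ms := slope2_measurable (bn n).
  have ss : stationary tau (slope2 (ln n)).
    by move=> x w; rewrite -[in LHS](add0r x) slope2_stationary.
  have bs x w := slope2_range x w (bn n) (lexx (ln n)).
  have := ergodic_cocycle tau_group P_ergodic (prim_cocycle tau_group ms ss bs).
  apply: filterS => w h del del0; have [C HC] := h del del0; exists C => x.
  by rewrite F2E// theta2E// -(expectation_prim tau_group ms ss bs) mulrC.
apply: filterS (ae_foralln H) => w {}H lambda bl del del0.
have d40 : 0 < del / 4 by rewrite divr_gt0.
have [m m0 Hm] := slope2_close (lambda + 1) d40.
pose r := Num.min m 1.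
have r0 : 0 < r by rewrite lt_min m0 ltr01.
have : lambda - beta < lambda - beta + r by rewrite ltrDl.
move=> /rat_in_itvoo[q]; rewrite in_itv/= => /andP[q1 q2].
have lnq : ln (pickle q) = beta + ratr q.
  rewrite /ln pickleK/= ger0_norm//; apply: ltW; apply: le_lt_trans q1.
  by rewrite subr_ge0.
have [C HC] := H (pickle q) (del / 4) d40.
have rm : r <= m by rewrite ge_min lexx.
have r1 : r <= 1 by rewrite ge_min lexx orbT.
have := Hm lambda (ln (pickle q)); rewrite bl bn lnq/=.
have -> : lambda <= lambda + 1 by rewrite lerDl.
have -> : beta + ratr q <= lambda + 1 by rewrite -lerBrDl; apply: (le_trans (ltW q2)); rewrite addrAC lerD2r lerD2l.
have -> : `|lambda - (beta + ratr q)| <= m.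
  rewrite distrC ler_norml; apply/andP; split; lra.
move=> /(_ isT isT isT) [hf ht]; exists C => x.
have := HC x; rewrite lnq => hC.
have bq : beta <= beta + ratr q by rewrite -lnq.
have dF (z : R) : is_derive z (1 : R)
    (fun z => F2 G a V beta lambda w z - F2 G a V beta (beta + ratr q) w z)
    (slope2 lambda z w - slope2 (beta + ratr q) z w).
  by have := is_derive_F2 w bl z; have := is_derive_F2 w bq z => ? ?; apply: is_deriveB.
have F00 l : beta <= l -> F2 G a V beta l w 0 = 0 by move=> bl'; rewrite F2E// prim0.
have := mvt_dist dF (hf ^~ w) 0 x; rewrite !F00// !subr0 => dist.
move: hC dist; rewrite distrC in ht; move: ht.
move: (F2 _ _ _ _ lambda w x) (F2 _ _ _ _ _ w x) (theta2 _ _ _ _ _ lambda) (theta2 _ _ _ _ _ _).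
move=> f1 f2 t1 t2 ht hC dist.
have dist2 : `|(t2 - t1) * x| <= del / 4 * `|x| by rewrite normrM ler_wpM2r.
(* Each of the three terms costs [del / 4]: the distance of the two correctors, the asymptotics at
   the rational value, and the distance of the two means. *)
have -> : f1 - t1 * x = (f1 - f2) + ((f2 - t2 * x) + (t2 - t1) * x) by ring.
rewrite (le_trans (ler_normD _ _))// (le_trans (lerD dist (ler_normD _ _)))//.
apply: le_trans (lerD (lexx _) (lerD hC dist2)) _.
have -> : del / 4 * `|x| + (del / 4 * `|x| + C + del / 4 * `|x|) =
  del * `|x| * (3 / 4) + C by field.
by rewrite lerD2r ler_piMr ?mulr_ge0 ?(ltW del0)//; lra.
Qed.

End RightBranch.

(** * Reflection of the line *)

Section Reflection.
Variable R : realType.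
Implicit Types G : R -> R.

Lemma locally_lipschitz_opp G : locally_lipschitz G ->
  locally_lipschitz (fun p => G (- p)).
Proof.
move=> GL; apply: locally_lipschitz_of_segment => M.
have [L L0 H] := locally_lipschitz_segment GL M; exists L => // x y xM yM.
rewrite (le_trans (H _ _ _ _)) ?normrN//.
by rewrite -opprD normrN.
Qed.

Lemma cvg_ninfty_opp G : G p @[p --> -oo] --> +oo -> G (- p) @[p --> +oo] --> +oo.
Proof.
have e : (- x : R) @[x --> +oo] --> -oo by rewrite ninfty; exact: cvg_id.
exact: (cvg_comp _ _ e).
Qed.

Lemma decreasing_opp G : {in `]-oo, 0] &, {homo G : p q / p < q >-> q < p}} ->
  {in `[0, +oo[ &, {homo (fun p => G (- p)) : p q / p < q}}.
Proof.
move=> h p q; rewrite !inE/= !in_itv/= !andbT => p0 q0 pq; apply: h.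
- by rewrite inE/= in_itv/= oppr_le0.
- by rewrite inE/= in_itv/= oppr_le0.
- by rewrite ltrN2.
Qed.

Lemma continuous_opp (f : R -> R) : continuous f -> continuous (fun x => f (- x)).
Proof.
by move=> cf x; apply: (@continuous_comp _ _ _ -%R f); [exact: opp_continuous|exact: cf].
Qed.

Lemma is_derive_opp_arg (f : R -> R) (x l : R) : is_derive (- x) (1 : R) f l ->
  is_derive x (1 : R) (fun x => f (- x)) (- l).
Proof.
move=> df; have dN : is_derive x (1 : R) (fun x : R => - x) (- 1).
  by apply: is_deriveN.
have := @is_derive1_comp R f (fun x => - x) x _ _ df dN.
by rewrite mulrN1.
Qed.

Context (d : measure_display) (Omega : measurableType d).
Implicit Types (g a V : R -> Omega -> R).

Lemma stationary_opp (tau : R -> Omega -> Omega) g : stationary tau g ->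
  stationary (fun x => tau (- x)) (fun x => g (- x)).
Proof. by move=> sg x w; rewrite oppr0 sg. Qed.

(** The reflected function has slope [- F' (- x)] and second derivative [F'' (- x)]; only the
    first-order term sees the sign, which [G (- p)] absorbs. *)
Lemma corrector_opp G G' a a' V V' (beta lambda : R) (I I' : R -> set R) w F :
  (forall p, G' p = G (- p)) -> (forall x, a' x w = a (- x) w) ->
  (forall x, V' x w = V (- x) w) -> (forall p, I lambda p -> I' lambda (- p)) ->
  corrector G a V beta I lambda w F ->
  corrector G' a' V' beta I' lambda w (fun x => F (- x)).
Proof.
move=> GE aE VE IE [[dF ddF cF] F0 eqF rF].
have d1 (x : R) : is_derive x (1 : R) (fun x => F (- x)) (- derive1 F (- x)).
  by apply: is_derive_opp_arg; exact: derivable_is_derive.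
have d2 (x : R) : is_derive x (1 : R) (fun x => - derive1 F (- x))
    (derive1 (derive1 F) (- x)).
  rewrite -[X in is_derive _ _ _ X]opprK; apply: is_deriveN.
  by apply: is_derive_opp_arg; exact: derivable_is_derive.
have [C2 E1 E2] := C2_line_of d1 d2 (continuous_opp cF).
split; [exact: C2|by rewrite oppr0|..].
- by move=> x; rewrite E2 E1 aE GE VE opprK; exact: eqF.
- by move=> x; rewrite E1; exact: IE.
Qed.

End Reflection.

(** * Nonpositive slopes: the branch of [theta1] *)

Section LeftBranch.
Context (R : realType) (d : measure_display) (Omega : measurableType d).
Variables (P : probability Omega R) (tau : R -> Omega -> Omega).
Variables (G : R -> R) (a V : R -> Omega -> R) (beta : R).
Hypothesis tau_group : measure_preserving_group P tau.
Hypothesis P_ergodic : ergodic P tau.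
Hypothesis beta_gt0 : 0 < beta.
Hypothesis G_lip : locally_lipschitz G.
Hypothesis G_ninfty : G p @[p --> -oo] --> +oo.
Hypothesis G0 : G 0 = 0.
Hypothesis G_decr : {in `]-oo, 0] &, {homo G : p q / p < q >-> q < p}}.
Hypothesis a01 : forall x w, 0 < a x w <= 1.
Hypothesis V01 : forall x w, 0 <= V x w <= 1.
Hypothesis a_meas : measurable_fun setT (a 0).
Hypothesis V_meas : measurable_fun setT (V 0).
Hypothesis a_stat : stationary tau a.
Hypothesis V_stat : stationary tau V.
Hypothesis ca : forall w, continuous (a ^~ w).
Hypothesis cV : forall w, continuous (V ^~ w).

Let G' := fun p => G (- p).
Let a' := fun x => a (- x).
Let V' := fun x => V (- x).
Let tau_group' := reverse_group tau_group.
Let P_ergodic' := reverse_ergodic P_ergodic.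
Let G_lip' := locally_lipschitz_opp G_lip.
Let G_pinfty' := cvg_ninfty_opp G_ninfty.
Let G0' : G' 0 = 0. Proof. by rewrite /G' oppr0. Qed.
Let G_incr' := decreasing_opp G_decr.
Let a01' : forall x w, 0 < a' x w <= 1. Proof. by move=> x w; exact: a01. Qed.
Let V01' : forall x w, 0 <= V' x w <= 1. Proof. by move=> x w; exact: V01. Qed.
Let a_meas' : measurable_fun setT (a' 0). Proof. by rewrite /a' oppr0. Qed.
Let V_meas' : measurable_fun setT (V' 0). Proof. by rewrite /V' oppr0. Qed.
Let a_stat' := stationary_opp a_stat.
Let V_stat' := stationary_opp V_stat.
Let ca' : forall w, continuous (a' ^~ w).
Proof. by move=> w; exact: continuous_opp (@ca w). Qed.
Let cV' : forall w, continuous (V' ^~ w).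
Proof. by move=> w; exact: continuous_opp (@cV w). Qed.

Definition slope1 (lambda x : R) (w : Omega) : R :=
  - slope2 (fun x => a (- x)) (fun x => V (- x)) beta (locally_lipschitz_opp G_lip) lambda (- x) w.

Lemma slope1_sol lambda w : beta <= lambda ->
  slope_sol G (a ^~ w) (V ^~ w) beta lambda (slope1 lambda ^~ w).
Proof.
move=> bl x.
have s2 := slope2_sol beta_gt0 G_lip' G_pinfty' G0' G_incr' a01' V01' ca' cV' w bl (- x).
have := is_deriveN (is_derive_opp_arg s2).
by rewrite opprK /a' /V' opprK.
Qed.

Lemma slope1_range lambda x w : beta <= lambda ->
  - G2_inv G' lambda <= slope1 lambda x w <= 0.
Proof.
move=> bl.
have := slope2_range beta_gt0 G_lip' G_pinfty' G0' G_incr' a01' V01' ca' cV' (- x) w bl (lexx lambda).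
by rewrite /slope1 lerN2 oppr_le0 andbC.
Qed.

Lemma G1_invE l : 0 <= l -> G1_inv G l = - G2_inv G' l.
Proof.
move=> l0; have [q0 Gq] := G2_invP G_lip' G_pinfty' G0' G_incr' l0.
rewrite -{1}Gq /G' /G1_inv pinvKV ?inE/= ?in_itv/= ?oppr_le0//.
move=> x y; rewrite !inE/= !in_itv/= => x0 y0 xy.
have [xy'|yx|//] := ltgtP x y.
  have : G y < G x by apply: G_decr xy'; rewrite inE/= in_itv.
  by rewrite xy ltxx.
have : G x < G y by apply: G_decr yx; rewrite inE/= in_itv.
by rewrite xy ltxx.
Qed.

Let slopes12 lambda p : beta <= lambda ->
  slopes1 G beta lambda p <-> slopes2 G' beta lambda (- p).
Proof.
move=> bl; have l1 : 0 <= lambda - beta by rewrite subr_ge0.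
have l2 : 0 <= lambda by exact: le_trans (ltW beta_gt0) bl.
rewrite /slopes1 /slopes2/= !in_itv/= !G1_invE// lerNl lerNr andbC.
by split.
Qed.

(** Both sides are choices, so unfolding does not suffice. The reflected [F2] shows that left
    correctors exist, hence [F1] is one of them; reflecting [F1] back, uniqueness on the right
    applies. *)
Lemma F1E lambda w : beta <= lambda ->
  F1 G a V beta lambda w = fun x => F2 G' a' V' beta lambda w (- x).
Proof.
move=> bl.
have P2 := corrector2P beta_gt0 G_lip' G_pinfty' G0' G_incr' a01' V01' ca' cV' w.
have c2 : corrector G a V beta (slopes1 G beta) lambda w (fun x => F2 G' a' V' beta lambda w (- x)).
  apply: (@corrector_opp _ _ _ G' G a' a V' V beta lambda (slopes2 G' beta)).
  - by move=> p; rewrite /G' opprK.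
  - by move=> x; rewrite /a' opprK.
  - by move=> x; rewrite /V' opprK.
  - by move=> p h; apply/slopes12 => //; rewrite opprK.
  apply/(P2 _ _ bl); exact: (F2E beta_gt0 G_lip' G_pinfty' G0' G_incr' a01' V01' ca' cV' w bl).
have c1 : corrector G a V beta (slopes1 G beta) lambda w (F1 G a V beta lambda w).
  by rewrite /F1; apply: xgetPex; eexists; exact: c2.
have := @corrector_opp _ _ _ G G' a a' V V' beta lambda (slopes1 G beta) (slopes2 G' beta) w _
  (fun=> erefl) (fun=> erefl) (fun=> erefl) (fun p => (slopes12 p bl).1) c1.
move=> /(P2 _ _ bl) E.
apply/funext => x; rewrite (F2E beta_gt0 G_lip' G_pinfty' G0' G_incr' a01' V01' ca' cV' w bl) -E.
by rewrite opprK.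
Qed.

Lemma is_derive_F1 lambda w : beta <= lambda ->
  forall x : R, is_derive x (1 : R) (F1 G a V beta lambda w) (slope1 lambda x w).
Proof.
move=> bl x; rewrite F1E//; apply: is_derive_opp_arg.
exact: (is_derive_F2 beta_gt0 G_lip' G_pinfty' G0' G_incr' a01' V01' ca' cV' w bl).
Qed.

Lemma theta1E lambda : beta <= lambda ->
  theta1 P G a V beta lambda = - theta2 P G' a' V' beta lambda.
Proof.
move=> bl; rewrite (theta2E _ beta_gt0 G_lip' G_pinfty' G0' G_incr' a01' V01' ca' cV' bl).
rewrite -expectationN; last first.
  exact: (slope2_integrable tau_group' beta_gt0 G_lip' G_pinfty' G0' G_incr' a01' V01'
    a_meas' V_meas' a_stat' V_stat' ca' cV' 0 bl).
rewrite /theta1 unlock; congr fine; apply: eq_integral => w _.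
by congr EFin; have := is_derive1 (is_derive_F1 w bl 0); rewrite /slope1 oppr0.
Qed.

Lemma theta1_le0 lambda : beta <= lambda -> theta1 P G a V beta lambda <= 0.
Proof.
move=> bl; rewrite theta1E// oppr_le0.
exact: (theta2_ge0 tau_group' beta_gt0 G_lip' G_pinfty' G0' G_incr' a01' V01'
    a_meas' V_meas' a_stat' V_stat' ca' cV').
Qed.

Lemma theta1_lt lambda nu : beta <= lambda -> lambda < nu ->
  theta1 P G a V beta nu < theta1 P G a V beta lambda.
Proof.
move=> bl ln; rewrite !theta1E ?(le_trans bl (ltW ln))// ltrN2.
exact: (theta2_lt tau_group' beta_gt0 G_lip' G_pinfty' G0' G_incr' a01' V01'
    a_meas' V_meas' a_stat' V_stat' ca' cV').
Qed.

Lemma theta1_surj th : th <= theta1 P G a V beta beta ->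
  exists2 lambda, beta <= lambda & theta1 P G a V beta lambda = th.
Proof.
rewrite theta1E// lerNr => h.
have [l bl lE] := theta2_surj tau_group' beta_gt0 G_lip' G_pinfty' G0' G_incr' a01' V01'
    a_meas' V_meas' a_stat' V_stat' ca' cV' h.
by exists l => //; rewrite theta1E// lE opprK.
Qed.

Lemma theta1_gap (lambda nu L : R) : beta <= lambda -> lambda <= nu ->
  lipschitz_ball (fun p => G (- p)) (G2_inv (fun p => G (- p)) nu) L ->
  (nu - lambda) / L <= theta1 P G a V beta lambda - theta1 P G a V beta nu.
Proof.
move=> bl ln GL; rewrite !theta1E ?(le_trans bl ln)// opprK [leRHS]addrC.
exact: (theta2_gap tau_group' beta_gt0 G_lip' G_pinfty' G0' G_incr' a01' V01'
    a_meas' V_meas' a_stat' V_stat' ca' cV').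
Qed.

Lemma F1_asymptotics : {ae P, forall w, forall lambda, beta <= lambda ->
  forall del : R, 0 < del -> exists C : R, forall x : R,
    `|F1 G a V beta lambda w x - theta1 P G a V beta lambda * x| <= del * `|x| + C}.
Proof.
have := F2_asymptotics tau_group' P_ergodic' beta_gt0 G_lip' G_pinfty' G0' G_incr' a01' V01'
    a_meas' V_meas' a_stat' V_stat' ca' cV'.
apply: filterS => w H lambda bl del del0; have [C HC] := H lambda bl del del0.
exists C => x; rewrite F1E// theta1E// mulNr -mulrN -[`|x|]normrN; exact: HC.
Qed.

End LeftBranch.

(** * The effective Hamiltonian *)

Section InverseBranch.
Variables (R : realType) (f inv : R -> R) (beta : R).
Hypothesis f_surj : forall th, f beta <= th -> exists2 l, beta <= l & f l = th.
Hypothesis f_gap : forall Q, exists2 L : R, 0 < L &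
  forall l n, beta <= l -> l <= n -> n <= Q -> (n - l) / L <= f n - f l.
Hypothesis invK : forall l, beta <= l -> inv (f l) = l.

Lemma branch_le l n : beta <= l -> l <= n -> f l <= f n.
Proof.
move=> bl ln; have [L L0 h] := f_gap n.
rewrite -subr_ge0; apply: le_trans (h _ _ bl ln (lexx n)).
by rewrite divr_ge0 ?subr_ge0// ltW.
Qed.

Lemma inv_branch_ge th : f beta <= th -> beta <= inv th.
Proof. by move=> /f_surj[l bl <-]; rewrite invK. Qed.

Lemma inv_branchK th : f beta <= th -> f (inv th) = th.
Proof. by move=> /f_surj[l bl <-]; rewrite invK. Qed.

Lemma inv_branch_lt p q : f beta <= p -> p < q -> inv p < inv q.
Proof.
move=> bp pq; have bq := le_trans bp (ltW pq).
rewrite ltNge; apply/negP => /(branch_le (inv_branch_ge bq)).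
by rewrite !inv_branchK// leNgt pq.
Qed.

Lemma inv_branch_le p q : f beta <= p -> p <= q -> inv p <= inv q.
Proof.
by move=> bp; rewrite le_eqVlt => /predU1P[->//|pq]; apply: ltW; exact: inv_branch_lt.
Qed.

(** A lower bound on the growth of [f] is a Lipschitz bound on its inverse. The maximum with
    [f beta] freezes the inverse at [beta] off the branch, the form in which the pieces of [Hbar]
    are glued. *)
Lemma inv_branch_lipschitz (M : R) : exists2 L : R, 0 < L &
  forall x y, `|x| <= M -> `|y| <= M ->
    `|inv (Num.max x (f beta)) - inv (Num.max y (f beta))| <= L * `|x - y|.
Proof.
have [L L0 h] := f_gap (inv (Num.max M (f beta))); exists L => //.
have fm x : f beta <= Num.max x (f beta) by rewrite le_max lexx orbT.
move=> x y; wlog xy : x y / x <= y.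
  move=> H xM yM; have [xy|/ltW yx] := leP x y; first exact: H.
  by rewrite distrC [`|x - y|]distrC; exact: H.
move=> xM yM; have mxy : Num.max x (f beta) <= Num.max y (f beta).
  by rewrite ge_max !le_max xy lexx orbT.
have myM : Num.max y (f beta) <= Num.max M (f beta).
  by rewrite ge_max !le_max lexx orbT (le_trans (ler_norm y) yM).
have := h _ _ (inv_branch_ge (fm x)) (inv_branch_le (fm x) mxy) (inv_branch_le (fm y) myM).
rewrite !inv_branchK// ler_pdivrMr// => /le_trans H.
rewrite distrC ger0_norm ?subr_ge0 ?inv_branch_le//; apply: H.
rewrite mulrC ler_wpM2l ?(ltW L0)// distrC ger0_norm ?subr_ge0//.
rewrite lerBlDr ge_max; apply/andP; split.
  by rewrite -addrA lerDl addrC subr_ge0 le_max lexx.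
by apply: le_trans (fm x) _; rewrite lerDr subr_ge0.
Qed.

End InverseBranch.

Section EffectiveHamiltonianRegularity.
Context (R : realType) (d : measure_display) (Omega : measurableType d).
Variables (P : probability Omega R) (tau : R -> Omega -> Omega).
Variables (G : R -> R) (a V : R -> Omega -> R) (beta : R).
Hypothesis tau_group : measure_preserving_group P tau.
Hypothesis beta_gt0 : 0 < beta.
Hypothesis G_lip : locally_lipschitz G.
Hypothesis G_pinfty : G p @[p --> +oo] --> +oo.
Hypothesis G_ninfty : G p @[p --> -oo] --> +oo.
Hypothesis G0 : G 0 = 0.
Hypothesis G_incr : {in `[0, +oo[ &, {homo G : p q / p < q}}.
Hypothesis G_decr : {in `]-oo, 0] &, {homo G : p q / p < q >-> q < p}}.
Hypothesis a01 : forall x w, 0 < a x w <= 1.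
Hypothesis V01 : forall x w, 0 <= V x w <= 1.
Hypothesis a_meas : measurable_fun setT (a 0).
Hypothesis V_meas : measurable_fun setT (V 0).
Hypothesis a_stat : stationary tau a.
Hypothesis V_stat : stationary tau V.
Hypothesis ca : forall w, continuous (a ^~ w).
Hypothesis cV : forall w, continuous (V ^~ w).
Notation theta1 := (theta1 P G a V beta).
Notation theta2 := (theta2 P G a V beta).
Notation theta1_inv := (theta1_inv P G a V beta).
Notation theta2_inv := (theta2_inv P G a V beta).
Notation Hbar := (Hbar P G a V beta).

Lemma theta2_gap_segment Q : exists2 L : R, 0 < L &
  forall l n, beta <= l -> l <= n -> n <= Q -> (n - l) / L <= theta2 n - theta2 l.
Proof.
have [L L0 HL] := locally_lipschitz_segment G_lip (G2_inv G Q); exists L => // l n bl ln nQ.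
apply: (theta2_gap tau_group beta_gt0 G_lip G_pinfty G0 G_incr a01 V01
  a_meas V_meas a_stat V_stat ca cV bl ln); split => // p q hp hq.
have nQ' : G2_inv G n <= G2_inv G Q.
  apply: (G2_inv_le G_lip G_pinfty G0 G_incr) => //.
  by rewrite (le_trans (ltW beta_gt0))// (le_trans bl).
by apply: HL; [exact: le_trans hp nQ'|exact: le_trans hq nQ'].
Qed.

Lemma theta1_gap_segment Q : exists2 L : R, 0 < L &
  forall l n, beta <= l -> l <= n -> n <= Q -> (n - l) / L <= - theta1 n - - theta1 l.
Proof.
have G_lip' := locally_lipschitz_opp G_lip.
have [L L0 HL] := locally_lipschitz_segment G_lip' (G2_inv (fun p => G (- p)) Q).
exists L => // l n bl ln nQ; rewrite opprK [leRHS]addrC.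
apply: (theta1_gap tau_group beta_gt0 G_lip G_ninfty G0 G_decr a01 V01
  a_meas V_meas a_stat V_stat ca cV bl ln); split => // p q hp hq.
have nQ' : G2_inv (fun p => G (- p)) n <= G2_inv (fun p => G (- p)) Q.
  apply: (G2_inv_le G_lip' (cvg_ninfty_opp G_ninfty) _ (decreasing_opp G_decr)) => //.
    by rewrite oppr0.
  by rewrite (le_trans (ltW beta_gt0))// (le_trans bl).
by apply: HL; [exact: le_trans hp nQ'|exact: le_trans hq nQ'].
Qed.

Lemma theta2_invK l : beta <= l -> theta2_inv (theta2 l) = l.
Proof.
move=> bl; rewrite /theta2_inv pinvKV ?inE/= ?in_itv/= ?andbT//.
move=> x y; rewrite !inE/= !in_itv/= !andbT => bx by_ xy.
have lt := theta2_lt tau_group beta_gt0 G_lip G_pinfty G0 G_incr a01 V01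
  a_meas V_meas a_stat V_stat ca cV.
have [h|h|//] := ltgtP x y.
  by have := lt _ _ bx h; rewrite xy ltxx.
by have := lt _ _ by_ h; rewrite xy ltxx.
Qed.

(** The double negation is what [inv (f l)] becomes for [f = - theta1] and
    [inv t = theta1_inv (- t)]. *)
Lemma theta1_invK l : beta <= l -> theta1_inv (- - theta1 l) = l.
Proof.
move=> bl; rewrite opprK /theta1_inv pinvKV ?inE/= ?in_itv/= ?andbT//.
move=> x y; rewrite !inE/= !in_itv/= !andbT => bx by_ xy.
have lt := theta1_lt tau_group beta_gt0 G_lip G_ninfty G0 G_decr a01 V01
  a_meas V_meas a_stat V_stat ca cV.
have [h|h|//] := ltgtP x y.
  by have := lt _ _ bx h; rewrite xy ltxx.
by have := lt _ _ by_ h; rewrite xy ltxx.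
Qed.

Let surj2 := theta2_surj tau_group beta_gt0 G_lip G_pinfty G0 G_incr a01 V01
  a_meas V_meas a_stat V_stat ca cV.

Let surj1 th : - theta1 beta <= th -> exists2 l, beta <= l & - theta1 l = th.
Proof.
rewrite lerNl => /(theta1_surj tau_group beta_gt0 G_lip G_ninfty G0 G_decr a01 V01
  a_meas V_meas a_stat V_stat ca cV)[l bl E].
by exists l => //; rewrite E opprK.
Qed.

Let th1_le0 : theta1 beta <= 0.
Proof.
exact: (theta1_le0 tau_group beta_gt0 G_lip G_ninfty G0 G_decr a01 V01
  a_meas V_meas a_stat V_stat ca cV).
Qed.

Let th2_ge0 : 0 <= theta2 beta.
Proof.
exact: (theta2_ge0 tau_group beta_gt0 G_lip G_pinfty G0 G_incr a01 V01
  a_meas V_meas a_stat V_stat ca cV).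
Qed.

(* A single formula for the three pieces, whose summands are locally Lipschitz. *)
Lemma HbarE th : Hbar th = theta1_inv (- Num.max (- th) (- theta1 beta)) +
  theta2_inv (Num.max th (theta2 beta)) - beta.
Proof.
have b1 : theta1_inv (theta1 beta) = beta.
  by rewrite -[X in theta1_inv X]opprK theta1_invK.
have b2 : theta2_inv (theta2 beta) = beta by rewrite theta2_invK.
rewrite /Hbar; have [h1|h1] := leP th (theta1 beta).
  rewrite max_l ?lerN2// opprK max_r ?b2 ?addrK//.
  exact: le_trans h1 (le_trans th1_le0 th2_ge0).
rewrite max_r ?lerN2 ?(ltW h1)// opprK b1 addrAC subrr add0r.
by have [h2|h2] := ltP th (theta2 beta); rewrite ?b2.
Qed.

Lemma Hbar_theta1 l : beta <= l -> Hbar (theta1 l) = l.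
Proof.
move=> bl; have h : theta1 l <= theta1 beta.
  have := branch_le theta1_gap_segment (lexx beta) bl.
  by rewrite lerN2.
by rewrite /Hbar h -[X in theta1_inv X]opprK theta1_invK.
Qed.

Lemma Hbar_theta2 l : beta <= l -> Hbar (theta2 l) = l.
Proof.
move=> bl; have h := branch_le theta2_gap_segment (lexx beta) bl.
rewrite HbarE max_r; last by rewrite lerN2 (le_trans th1_le0)// (le_trans th2_ge0).
rewrite max_l// theta2_invK// theta1_invK//.
by rewrite addrAC subrr add0r.
Qed.

Lemma Hbar_cases th : [\/ exists2 l, beta <= l & theta1 l = th,
  (theta1 beta < th < theta2 beta) /\ Hbar th = beta |
  exists2 l, beta <= l & theta2 l = th].
Proof.
have [h1|h1] := leP th (theta1 beta).
  apply: Or31.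
  exact: (theta1_surj tau_group beta_gt0 G_lip G_ninfty G0 G_decr a01 V01
    a_meas V_meas a_stat V_stat ca cV h1).
have [h2|h2] := ltP th (theta2 beta).
  by apply: Or32; split=> //; rewrite /Hbar leNgt h1/= h2.
by apply: Or33; exact: surj2.
Qed.

Lemma Hbar_locally_lipschitz : locally_lipschitz Hbar.
Proof.
apply: locally_lipschitz_of_segment => M.
have [L2 L20 H2] := inv_branch_lipschitz surj2 theta2_gap_segment theta2_invK M.
have [L1 L10 H1] := @inv_branch_lipschitz R (fun l => - theta1 l) (fun t => theta1_inv (- t)) beta
  surj1 theta1_gap_segment theta1_invK M.
exists (L1 + L2); first exact: addr_gt0.
move=> x y xM yM; rewrite !HbarE.
have := H1 (- x) (- y); rewrite !normrN -opprD normrN => /(_ xM yM).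
have := H2 x y xM yM.
move: (theta1_inv _) (theta1_inv _) (theta2_inv _) (theta2_inv _) => p p' q q' h2 h1.
have -> : p' + q' - beta - (p + q - beta) = (p' - p) + (q' - q) by ring.
rewrite mulrDl.
rewrite (le_trans (ler_normD _ _))//; exact: lerD.
Qed.

Lemma Hbar_decreasing :
  {in `]-oo, theta1 beta] &, {homo Hbar : p q / p < q >-> q < p}}.
Proof.
move=> p q; rewrite !inE/= !in_itv/= => hp hq pq; rewrite /Hbar hp hq.
have := @inv_branch_lt R (fun l => - theta1 l) (fun t => theta1_inv (- t)) beta
  surj1 theta1_gap_segment theta1_invK (- q) (- p).
by rewrite !opprK lerN2 ltrN2; exact.
Qed.

Lemma Hbar_increasing :
  {in `[theta2 beta, +oo[ &, {homo Hbar : p q / p < q}}.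
Proof.
move=> p q; rewrite !inE/= !in_itv/= !andbT => hp hq pq.
rewrite !HbarE !(max_l hp, max_l hq).
have h t : theta2 beta <= t -> Num.max (- t) (- theta1 beta) = - theta1 beta.
  by move=> ht; rewrite max_r// lerN2 (le_trans th1_le0)// (le_trans th2_ge0).
rewrite !h// ltrD2r ltrD2l.
exact: (inv_branch_lt surj2 theta2_gap_segment theta2_invK).
Qed.

End EffectiveHamiltonianRegularity.

(** * Hills *)

Section Hills.
Context (R : realType) (d : measure_display) (Omega : measurableType d).
Variables (P : probability Omega R) (tau : R -> Omega -> Omega).
Variables (a V : R -> Omega -> R).
Hypothesis tau_group : measure_preserving_group P tau.
Hypothesis P_ergodic : ergodic P tau.
Hypothesis a01 : forall x w, 0 < a x w <= 1.
Hypothesis a_meas : measurable_fun setT (a 0).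
Hypothesis V_meas : measurable_fun setT (V 0).
Hypothesis a_stat : stationary tau a.
Hypothesis V_stat : stationary tau V.
Hypothesis ca : forall w, continuous (a ^~ w).
Hypothesis cV : forall w, continuous (V ^~ w).
Notation mu := (@lebesgue_measure R).

Definition hill_set (h C q1 q2 : R) : set Omega :=
  [set w | [/\ q1 <= q2,
    C <= prim (fun x => (a x w)^-1) q2 - prim (fun x => (a x w)^-1) q1 &
    forall y, q1 <= y <= q2 -> h <= V y w]].

Let ainv0 x w : 0 <= (a x w)^-1.
Proof. by rewrite invr_ge0 ltW//; have /andP[] := a01 x w. Qed.

Let cinv w : continuous (fun x => (a x w)^-1).
Proof.
move=> x; apply: cvgV; last exact: ca.
by apply: lt0r_neq0; have /andP[] := a01 x w.
Qed.

Let mainv : jointly_measurable (fun x w => (a x w)^-1).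
Proof.
apply: jointly_measurable_inv a01 _.
exact: (stationary_jointly_measurable tau_group).
Qed.

(** Continuity of [V] reduces the condition on a whole interval to its rational points, so that
    countably many events describe a hill. *)
Lemma hill_set_rational h C (q1 q2 : rat) : hill_set h C (ratr q1) (ratr q2) =
  [set w | [/\ ratr q1 <= ratr q2 :> R,
    C <= prim (fun x => (a x w)^-1) (ratr q2) - prim (fun x => (a x w)^-1) (ratr q1) &
    forall q : rat, (q1 <= q <= q2)%R -> h <= V (ratr q) w]].
Proof.
apply/seteqP; split => w [q12 Cq Vq]; split => //.
  by move=> q qi; apply: Vq; rewrite !ler_rat.
move=> y /andP[q1y yq2].
rewrite leNgt; apply/negP => Vy.
(* The endpoints are rational themselves; an interior [y] has rational points of the interval just
   to its left. *)
move: q1y; rewrite le_eqVlt => /predU1P[q1y|q1y].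
  by move: (Vq q1); rewrite lexx -(ler_rat R) q12 q1y leNgt Vy => /(_ isT).
move: yq2; rewrite le_eqVlt => /predU1P[yq2|yq2].
  by move: (Vq q2); rewrite lexx -(ler_rat R) q12 -yq2 leNgt Vy => /(_ isT).
have near_lt : \forall z \near y, V z w < h.
  have e0 : 0 < h - V y w by rewrite subr_gt0.
  have := @cV w y => /cvgrPdist_lt/(_ _ e0); apply: filterS => z.
  by rewrite distrC => /(le_lt_trans (ler_norm _)); rewrite ltrD2r.
have [e /= e0 He] := (nbhs_ballP _ _).1 near_lt.
have : Num.max (ratr q1) (y - e) < y by rewrite gt_max q1y/= gtrDl oppr_lt0.
move=> /rat_in_itvoo[q]; rewrite in_itv/= gt_max => /andP[/andP[q1q yeq] qy].
have : V (ratr q) w < h.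
  by apply: He; rewrite /ball/= gtr0_norm ?subr_gt0// ltrBlDr -ltrBlDl.
by rewrite ltNge Vq// -!(ler_rat R) (ltW q1q) (ltW (lt_trans qy yq2)).
Qed.

Lemma measurable_hill_set h C (q1 q2 : rat) : measurable (hill_set h C (ratr q1) (ratr q2)).
Proof.
rewrite hill_set_rational.
have [q12|q12] := leP (ratr q1 : R) (ratr q2); last first.
  rewrite (_ : [set _ | _] = set0)//; apply/seteqP; split=> // w [].
  by [].
pose A := [set w | C <= prim (fun x => (a x w)^-1) (ratr q2) - prim (fun x => (a x w)^-1) (ratr q1)].
pose B (q : rat) := if (q1 <= q <= q2)%R then [set w | V (ratr q) w < h] else set0.
have mprim (q : rat) : measurable_fun setT (fun w => prim (fun x => (a x w)^-1) (ratr q)).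
  apply: (@jointly_measurable_section _ _ _ (fun x w => prim (fun x => (a x w)^-1) x)).
  exact: jointly_measurable_prim.
have mA : measurable A.
  have mf := measurable_funB (mprim q2) (mprim q1).
  have := mf measurableT `[C, +oo[%classic (measurable_itv _).
  rewrite setTI; congr measurable; apply/seteqP; split => w /=;
    by rewrite in_itv/= andbT.
have mB q : measurable (B q).
  rewrite /B; case: ifP => // _.
  have mf := jointly_measurable_section (ratr q) (stationary_jointly_measurable tau_group V_meas V_stat).
  have := mf measurableT `]-oo, h[%classic (measurable_itv _).
  rewrite setTI; congr measurable; apply/seteqP; split => w /=;
    by rewrite in_itv/=.
rewrite (_ : [set _ | _] = A `&` ~` \bigcup_q B q).
  by apply: measurableI => //; apply: measurableC; exact: bigcupT_measurable_rat.
apply/seteqP; split => w.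
  move=> [_ Aw Vq]; split=> // -[q _]; rewrite /B; case: ifP => // qi /=.
  by rewrite ltNge Vq.
move=> [Aw nB]; split=> // q qi; rewrite leNgt; apply/negP => Vh; apply: nB.
by exists q => //; rewrite /B qi.
Qed.

Lemma hill_set_tau h C q1 q2 y w : hill_set h C q1 q2 (tau y w) <->
  hill_set h C (q1 + y) (q2 + y) w.
Proof.
have [_ tD _ _] := tau_group.
have st (g : R -> Omega -> R) : stationary tau g ->
    forall z, g z (tau y w) = g (z + y) w.
  by move=> sg z; rewrite sg [RHS]sg tD.
have E q : prim (fun x => (a x (tau y w))^-1) q =
    prim (fun x => (a x w)^-1) (q + y) - prim (fun x => (a x w)^-1) y.
  have e1 : (fun x => (a x (tau y w))^-1) = (fun x => (a (x + y) w)^-1).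
    by apply/funext => x; rewrite st.
  rewrite e1 prim_shift//.
  - exact: continuous_measurable.
  - by move=> b c; exact: continuous_integrable_segment.
  - by rewrite -e1 => b c; exact: continuous_integrable_segment.
have E2 : prim (fun x => (a x (tau y w))^-1) q2 - prim (fun x => (a x (tau y w))^-1) q1 =
    prim (fun x => (a x w)^-1) (q2 + y) - prim (fun x => (a x w)^-1) (q1 + y).
  by rewrite (E q1) (E q2); move: (prim _ (q2 + y)) (prim _ (q1 + y)) (prim _ y) => p2 p1 p0; ring.
rewrite /hill_set/= E2 lerD2r; split=> -[q12 Cq Vq]; split=> // z.
  move=> /andP[z1 z2]; have := Vq (z - y).
  by rewrite lerBrDr lerBlDr z1 z2 st// subrK; exact.
by move=> zi; rewrite st//; apply: Vq; rewrite !lerD2r.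
Qed.

(** Moving both ends inwards to rational points changes the primitive by less than [C / 4] at each
    end, by continuity, so half of [C] survives. *)
Lemma hill_rational h C w L1 L2 : 0 < C -> L1 <= L2 ->
  (C%:E <= \int[mu]_(y in `[L1, L2]) ((a y w)^-1)%:E)%E ->
  (forall y, y \in `[L1, L2]%R -> h <= V y w) ->
  exists q : rat * rat, hill_set h (C / 2) (ratr q.1) (ratr q.2) w.
Proof.
move=> C0 L12 CL VL; pose b x := (a x w)^-1.
have pL : C <= prim b L2 - prim b L1.
  rewrite primB//; last by move=> x y; apply: continuous_integrable_segment; exact: cinv.
  rewrite -lee_fin /Rintegral fineK//; apply: integrable_fin_num => //.
  by apply: continuous_integrable_segment; exact: cinv.
have L12' : L1 < L2.
  rewrite lt_neqAle L12 andbT; apply/eqP => L12e.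
  by move: pL; rewrite L12e subrr leNgt C0.
have cp x : {for x, continuous (prim b)} by apply: prim_continuous; exact: cinv.
have C4 : 0 < C / 4 by rewrite divr_gt0.
have [e1 /= e10 H1] := (nbhs_ballP _ _).1 (near_continuous (cp L1) C4).
have [e2 /= e20 H2] := (nbhs_ballP _ _).1 (near_continuous (cp L2) C4).
pose m := (L1 + L2) / 2.
have L1m : L1 < m by rewrite midf_lt.
have mL2 : m < L2 by rewrite midf_lt.
have : L1 < Num.min m (L1 + e1) by rewrite lt_min L1m ltrDl.
move=> /rat_in_itvoo[q1]; rewrite in_itv/= lt_min => /andP[L1q /andP[qm q1e]].
have : Num.max m (L2 - e2) < L2 by rewrite gt_max mL2/= gtrDl oppr_lt0.
move=> /rat_in_itvoo[q2]; rewrite in_itv/= gt_max => /andP[/andP[mq q2e] q2L].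
have {}H1 : `|prim b L1 - prim b (ratr q1)| < C / 4.
  by apply: H1; rewrite /ball/= distrC gtr0_norm ?subr_gt0// ltrBlDl.
have {}H2 : `|prim b L2 - prim b (ratr q2)| < C / 4.
  by apply: H2; rewrite /ball/= gtr0_norm ?subr_gt0// ltrBlDr -ltrBlDl.
exists (q1, q2); split=> /=.
- exact: ltW (lt_trans qm mq).
- move: H1 H2 pL; rewrite !ltr_norml -/b.
  move: (prim b L1) (prim b L2) (prim b _) (prim b _) => p1 p2 p3 p4; lra.
- move=> y /andP[y1 y2]; apply: VL; rewrite in_itv/=.
  by rewrite (ltW (lt_le_trans L1q y1)) (ltW (le_lt_trans y2 q2L)).
Qed.

Definition hill_near (h C del B x : R) (w : Omega) : Prop :=
  exists L1 L2, [/\ hill_set h C L1 L2 w, `|L1 - x| <= del * `|x| + B &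
    `|L2 - x| <= del * `|x| + B].

(* The indicator of the hill event has positive mean, so its primitive along the
   flow cannot stay constant on an interval longer than [o(|x|) + C]. *)
Lemma hill_set_near h C (q1 q2 : rat) :
  (0 < P (hill_set h C (ratr q1) (ratr q2)))%E ->
  {ae P, forall w, forall del : R, 0 < del -> exists B : R, forall x : R,
    hill_near h C del B x w}.
Proof.
set E := hill_set _ _ _ _ => PE0.
have mE : measurable E by exact: measurable_hill_set.
have [_ tD mt _] := tau_group; have [t0 _ _ _] := tau_group.
pose g x w : R := \1_E (tau x w).
have mg : jointly_measurable g.
  have m1 : measurable_fun setT (\1_E : Omega -> R) by exact: measurable_indic.
  exact: (measurableT_comp m1 mt).
have sg : stationary tau g by move=> x w; rewrite /g t0.
have g1 x w : 0 <= g x w <= 1 by rewrite /g indicE; case: (_ \in _); rewrite /= ?lexx ler01.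
pose p := \int[P]_w g 0 w.
have p0 : 0 < p.
  rewrite /p /g t0 /Rintegral integral_indic// setIT.
  by rewrite fine_gt0// PE0/= (le_lt_trans (probability_le1 _ mE))// ltry.
have := ergodic_cocycle tau_group P_ergodic (prim_cocycle tau_group mg sg g1).
rewrite (expectation_prim tau_group mg sg g1) -/p.
apply: filterS => w H del del0.
(* The bound [p / 2] lets the error term in [r x] be absorbed by [r x * p]; the bound [del * p / 8]
   keeps the growth of [r x] in [|x|] below [del]. *)
pose dl := Num.min (p / 2) (del * p / 8).
have dl0 : 0 < dl by rewrite lt_min !divr_gt0 ?mulr_gt0.
have dl1 : dl <= p / 2 by rewrite ge_min lexx.
have dl2 : dl <= del * p / 8 by rewrite ge_min lexx orbT.
have [B HB] := H dl dl0.
(* If no hill occurred between [x] and [x + r x], the asymptotics would give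
   [r x * p <= 4 * dl * |x| + 4 * B]; the summand 1 makes this impossible. *)
pose r (x : R) : R := (4 * dl * `|x| + (4 * B + 1)) / p.
have B0 : 0 <= B.
  have := HB 0; rewrite prim0 mul0r subrr normr0 mulr0 add0r; exact.
have r0 x : 0 < r x.
  by rewrite divr_gt0// ltr_wpDl ?mulr_ge0 ?(ltW dl0)// ltr_wpDl// mulr_ge0.
exists ((4 * B + 1) / p + `|ratr q1| + `|ratr q2|) => x.
have [y [xy yx Ey]] : exists y, [/\ x <= y, y <= x + r x & E (tau y w)].
  apply: contrapT => nE.
  have : prim (g ^~ w) (x + r x) - prim (g ^~ w) x = 0.
    rewrite (@primB _ (g ^~ w)) ?lerDl ?(ltW (r0 x))//.
      transitivity (\int[mu]_(t in `[x, x + r x]) (cst 0 t : R)); last by rewrite Rintegral_cst// mul0r.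
      apply: eq_Rintegral => y; rewrite inE/= in_itv/= => /andP[y1 y2].
      rewrite /g indicE memNset// => Ey; apply: nE; by exists y.
    move=> b c; apply: (@bounded_integrable_segment _ _ 1 b c) => //.
    exact: (measurable_fun_pair1 w mg).
  have := HB (x + r x); have := HB x; rewrite !ler_norml.
  have := ler_normD x (r x); rewrite (gtr0_norm (r0 x)).
  have rE : r x * p = 4 * dl * `|x| + (4 * B + 1) by rewrite /r divfK ?gt_eqF.
  have rdl : dl * r x <= p / 2 * r x by rewrite ler_wpM2r// ltW.
  have nd : `|x + r x| <= `|x| + r x -> dl * `|x + r x| <= dl * `|x| + dl * r x.
    by move=> h'; rewrite -mulrDr ler_wpM2l// ltW.
  have rp : p * r x = r x * p by rewrite mulrC.
  move=> /nd; rewrite mulrDl rE.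
  move: rdl; rewrite mulrAC rp rE.
  move: (prim _ _) (prim _ _) (dl * `|x + _|) (x * p) (dl * r x) => p1 p2 A1 A2 A3.
  have : 0 <= dl * `|x| by rewrite mulr_ge0// ltW.
  rewrite -mulrA; move: (dl * `|x|) => A4.
  lra.
have bound : r x <= del * `|x| + (4 * B + 1) / p.
  rewrite /r mulrDl lerD2r mulrAC ler_wpM2r// ler_pdivrMr//.
  have := ler_wpM2l (ltW dl0) (lexx 4).
  have : 0 < del * p by rewrite mulr_gt0.
  move: dl2; move: (del * p) => dp; lra.
have far (q : R) : `|q| <= `|ratr q1 : R| + `|ratr q2 : R| ->
    `|q + y - x| <= del * `|x| + ((4 * B + 1) / p + `|ratr q1| + `|ratr q2|).
  move=> hq; rewrite -addrA (le_trans (ler_normD _ _))//.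
  rewrite [`|y - x|]ger0_norm ?subr_ge0// addrC.
  have h2 : y - x <= r x by rewrite lerBlDl.
  apply: (le_trans (lerD (le_trans h2 bound) hq)).
  by rewrite -!addrA.
exists (ratr q1 + y), (ratr q2 + y); split.
- by apply: (hill_set_tau h C (ratr q1) (ratr q2) y w).1; exact: Ey.
- by apply: far; rewrite lerDl.
- by apply: far; rewrite lerDr.
Qed.

(** The null sets of the hypothesis depend on [h] and [C], so only the pairs [1 - 1 / (k + 2)],
    [k + 1] are used. For each of them some rational interval is a hill with positive probability,
    since countably many null events cannot contain almost every environment. *)
Theorem hill_density :
  (forall h C, 0 < h < 1 -> 0 < C -> {ae P, forall w, exists L1 L2, [/\ L1 <= L2,
      (C%:E <= \int[mu]_(y in `[L1, L2]) ((a y w)^-1)%:E)%E &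
      forall y, y \in `[L1, L2]%classic -> h <= V y w]}) ->
  {ae P, forall w, forall h C del : R, h < 1 -> 0 < del -> exists B : R, forall x : R,
    hill_near h C del B x w}.
Proof.
move=> hill.
have H (k : nat) : {ae P, forall w, forall del : R, 0 < del -> exists B : R, forall x : R,
    hill_near (1 - k.+2%:R^-1) k.+1%:R del B x w}.
  pose h : R := 1 - k.+2%:R^-1; pose C : R := k.+1%:R.
  have h01 : 0 < h < 1.
    by rewrite /h subr_gt0 invf_lt1// ltr1n/= gtrDl oppr_lt0 invr_gt0.
  have C0 : 0 < C by rewrite ltr0n.
  have C20 : 0 < 2 * C by rewrite mulr_gt0.
  (* Twice the wanted [C], because half is lost in passing to rational endpoints. *)
  have hw := hill h (2 * C) h01 C20.
  suff [q1 [q2]] : exists q1 q2 : rat, (0 < P (hill_set h C (ratr q1) (ratr q2)))%E.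
    exact: hill_set_near.
  apply: contrapT => nq.
  have H0 (n : nat) : {ae P, forall w,
      ~ hill_set h C (ratr (odflt (0, 0) (unpickle n : option (rat * rat))).1)
        (ratr (odflt (0, 0) (unpickle n : option (rat * rat))).2) w}.
    set q := odflt _ _.
    have mq := measurable_hill_set h C q.1 q.2.
    apply/negligibleP; first exact: measurableC (measurableC mq).
    rewrite setCK; apply/eqP; rewrite eq_le measure_ge0 andbT leNgt; apply/negP => Pq.
    by apply: nq; exists q.1, q.2.
  have : {ae P, forall w, False}.
    apply: filterS2 hw (ae_foralln H0) => w [L1 [L2 [L12 CL VL]]] Hw.
    have [q] := hill_rational C20 L12 CL (fun y yi => VL y (mem_set yi)).
    rewrite mulrC mulKf// => Hq; apply: (Hw (pickle q)); rewrite pickleK; exact: Hq.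
  move=> [A [mA A0 sA]].
  have : (P setT <= P A)%E by rewrite le_measure// ?inE// => w _; exact: sA.
  by rewrite A0 probability_setT lee_fin ler10.
apply: filterS (ae_foralln H) => w Hw h C del h1 del0.
(* Large enough for [C <= k + 1] and [1 / (k + 2) <= 1 - h]. *)
pose k := Num.bound (`|C| + (1 - h)^-1).
have h0 : 0 < 1 - h by rewrite subr_gt0.
have : `|C| + (1 - h)^-1 < k%:R.
  by apply: archi_boundP; rewrite addr_ge0// invr_ge0 ltW.
have := ler_norm C; have := normr_ge0 C.
have : 0 < (1 - h)^-1 by rewrite invr_gt0.
move: (`|C|) => nC ih0 nC0 CnC kC.
have kE : k.+1%:R = k%:R + 1 :> R by rewrite -natr1.
have kE2 : k.+2%:R = k%:R + 1 + 1 :> R by rewrite -!natr1.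
have Ck : C <= k.+1%:R by rewrite kE; lra.
have hk : h <= 1 - k.+2%:R^-1.
  rewrite lerBrDr -lerBrDl -[leRHS]invrK lef_pV2 ?posrE ?ltr0n// kE2.
  lra.
have [B HB] := Hw k del del0; exists B => x.
have [L1 [L2 [[L12 CL VL] n1 n2]]] := HB x.
exists L1, L2; split=> //; split=> //; first exact: le_trans CL.
by move=> y yi; exact: le_trans (VL y yi).
Qed.

End Hills.

(** * A cutoff with continuous derivative *)

Section Cutoff.
Variable R : realType.

Lemma derive0_eq (F f : R -> R) (x y : R) :
  (forall z : R, is_derive z (1 : R) F (f z)) -> x <= y ->
  (forall z, x <= z <= y -> f z = 0) -> F x = F y.
Proof.
move=> dF xy f0.
have h1 := @mvt_ge R F f 0 x y dF xy.
have h2 := @mvt_le R F f 0 x y dF xy.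
apply/eqP; rewrite eq_le -subr_ge0 -[F y <= F x]subr_le0; apply/andP; split.
  by rewrite -[leLHS](mul0r (y - x)); apply: h1 => z /f0 ->.
by rewrite -[leRHS](mul0r (y - x)); apply: h2 => z /f0 ->.
Qed.

(** A continuous density supported in [[0, 1]]; its normalised primitive [step] is of class C^1, so
    correctors whose slopes are interpolated with it are of class C^2. *)
Definition bump (r : R) : R := Num.max 0 (r * (1 - r)).

Lemma bump_continuous : continuous bump.
Proof.
move=> r; apply: (@continuous_max R _ (fun=> 0 : R^o) (fun r : R => r * (1 - r) : R^o) r).
  exact: cvg_cst.
by apply: cvgM; [exact: cvg_id|apply: cvgB; [exact: cvg_cst|exact: cvg_id]].
Qed.

Lemma bump_ge0 r : 0 <= bump r.
Proof. by rewrite le_max lexx. Qed.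

Lemma bump_le1 r : bump r <= 1.
Proof. by rewrite ge_max ler01/=; have := sqr_ge0 (r - 2^-1); lra. Qed.

Lemma bump_eq0 r : (r <= 0) || (1 <= r) -> bump r = 0.
Proof.
move=> h; apply: max_l; case/orP: h => h.
  by rewrite mulr_le0_ge0// subr_ge0 (le_trans h).
by rewrite mulr_ge0_le0 ?subr_le0// (le_trans ler01).
Qed.

Let dbump := is_derive_prim bump_continuous.

Lemma bump_mass_gt0 : 0 < prim bump 1.
Proof.
have h1 := mvt_ge dbump (_ : 0 <= 4^-1 :> R) (fun z _ => bump_ge0 z).
(* On [[1 / 4, 1 / 2]] the product [r * (1 - r)] is at least [3 / 16], hence [1 / 8]. *)
have h2 := mvt_ge dbump (_ : 4^-1 <= 2^-1 :> R) (c := 8^-1) _.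
have h3 := mvt_ge dbump (_ : 2^-1 <= 1 :> R) (fun z _ => bump_ge0 z).
have := h1 _; rewrite prim0 subr0 mul0r invr_ge0 => /(_ (ler0n _ _)) {}h1.
have {}h3 : 0 <= prim bump 1 - prim bump 2^-1.
  by have := h3 _; rewrite mul0r; apply; lra.
have {}h2 : 8^-1 * (2^-1 - 4^-1) <= prim bump 2^-1 - prim bump 4^-1.
  apply: h2; first lra.
  move=> z /andP[z1 z2]; rewrite le_max; apply/orP; right.
  have : 0 <= (z - 4^-1) * (2^-1 - z) by rewrite mulr_ge0// subr_ge0.
  lra.
by move: h1 h2 h3; move: (prim _ _) (prim _ _) (prim _ _) => p q r; lra.
Qed.

Definition step (r : R) : R := prim bump r / prim bump 1.
Definition dstep (r : R) : R := bump r / prim bump 1.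

Lemma is_derive_step (r : R) : is_derive r (1 : R) step (dstep r).
Proof.
rewrite /step /dstep mulrC; have := dbump r => dr.
rewrite (_ : (fun r => _) = (fun r => (prim bump 1)^-1 * prim bump r)).
  exact: is_deriveZ.
by apply/funext => x; rewrite mulrC.
Qed.

Lemma dstep_continuous : continuous dstep.
Proof. by move=> r; apply: cvgMl; exact: bump_continuous. Qed.

Lemma dstep_bounds r : 0 <= dstep r <= (prim bump 1)^-1.
Proof.
rewrite /dstep divr_ge0 ?bump_ge0 ?(ltW bump_mass_gt0)//=.
by rewrite ler_piMl ?bump_le1// invr_ge0 ltW// bump_mass_gt0.
Qed.

Lemma step_eq0 r : r <= 0 -> step r = 0.
Proof.
move=> r0; rewrite /step (derive0_eq dbump r0) ?prim0 ?mul0r//.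
by move=> z /andP[_ h]; rewrite bump_eq0// h.
Qed.

Lemma step_eq1 r : 1 <= r -> step r = 1.
Proof.
move=> r1; rewrite /step -(derive0_eq dbump r1) ?divff ?gt_eqF ?bump_mass_gt0//.
by move=> z /andP[h _]; rewrite bump_eq0// h orbT.
Qed.

Lemma step01 r : 0 <= step r <= 1.
Proof.
have mono (x y : R) : x <= y -> step x <= step y.
  move=> xy; rewrite /step ler_pM2r ?invr_gt0 ?bump_mass_gt0//.
  have := mvt_ge dbump xy (fun z _ => bump_ge0 z).
  by rewrite mul0r subr_ge0.
apply/andP; split.
  have [r0|r0] := leP r 0; first by rewrite step_eq0.
  by rewrite -(step_eq0 (lexx 0)); apply: mono; exact: ltW.
have [r1|r1] := leP 1 r; first by rewrite step_eq1.
by rewrite -(step_eq1 (lexx 1)); apply: mono; exact: ltW.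
Qed.

End Cutoff.

(** * Interpolation between two slopes on a hill *)

Section Transition.
Variables (R : realType) (G a V : R -> R) (beta : R).
Hypothesis G_lip : locally_lipschitz G.
Hypothesis G_ge0 : forall p, 0 <= G p.
Hypothesis G_quasiconvex : forall x y z, x <= y <= z -> G y <= Num.max (G x) (G z).
Hypothesis a01 : forall x, 0 < a x <= 1.
Hypothesis ca : continuous a.
Hypothesis cV : continuous V.
Notation Ainv := (prim (fun x => (a x)^-1)).
Variables (L1 L2 C : R) (p q : R -> R) (M s : R).
Hypothesis C0 : 0 < C.
Hypothesis L12 : L1 <= L2.
Hypothesis CL : C <= Ainv L2 - Ainv L1.
Hypothesis ps : slope_sol G a V beta beta p.
Hypothesis qs : slope_sol G a V beta beta q.
Hypothesis pM : forall x, `|p x| <= M.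
Hypothesis qM : forall x, `|q x| <= M.

Let a0 x : 0 < a x. Proof. by have /andP[] := a01 x. Qed.

Let cinv : continuous (fun x => (a x)^-1).
Proof. by move=> x; apply: cvgV; [exact: lt0r_neq0|exact: ca]. Qed.

Let dA := is_derive_prim cinv.

Let Ainv_le x y : x <= y -> Ainv x <= Ainv y.
Proof.
move=> xy; rewrite -subr_ge0 -[leLHS](mul0r (y - x)).
by apply: (mvt_ge dA xy) => z _; rewrite invr_ge0 ltW.
Qed.

Let rho x := (3 / C) * (Ainv x - Ainv L1) - 1.
(* [chi] increases from 0 to 1 on the middle third of the hill, as measured by
   the primitive of [1 / a], so that [a * chi'] is of order [1 / C]. *)
Definition chi x := step (rho x).
Let dchi x := dstep (rho x) * (3 / C * (a x)^-1).

Let is_derive_chi (x : R) : is_derive x (1 : R) chi (dchi x).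
Proof.
have drho : is_derive x (1 : R) rho (3 / C * (a x)^-1).
  rewrite /rho -[X in is_derive _ _ _ X]subr0; apply: is_deriveB.
  apply: is_deriveZ; rewrite -[X in is_derive _ _ _ X]subr0; apply: is_deriveB.
  exact: dA.
have := @is_derive1_comp R (@step R) rho x _ _ (is_derive_step (rho x)) drho.
exact.
Qed.

Let chi01 x : 0 <= chi x <= 1.
Proof. exact: step01. Qed.

Let chi_left x : x <= L1 -> chi x = 0.
Proof.
move=> xL; apply: step_eq0; have := Ainv_le xL; rewrite -subr_le0 => h.
have : 3 / C * (Ainv x - Ainv L1) <= 0 by rewrite mulr_ge0_le0// divr_ge0// ltW.
by rewrite /rho; move: (_ * _) => r; lra.
Qed.

Let chi_right x : L2 <= x -> chi x = 1.
Proof.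
move=> xL; apply: step_eq1; have h := Ainv_le xL.
have CLx : C <= Ainv x - Ainv L1 by rewrite (le_trans CL)// lerD2r.
have : 3 / C * C <= 3 / C * (Ainv x - Ainv L1).
  by rewrite ler_wpM2l// divr_ge0// ltW.
by rewrite divfK ?gt_eqF// /rho; move: (_ * (_ - _)) => r; lra.
Qed.

(** Equal to [p] left of the hill and to [q] right of it. Both orders of the two extremal slopes are
    used, one for each barrier. *)
Definition mixed_slope x := p x + chi x * (q x - p x).

Let dsol g x := (beta - beta * V x - G (g x)) / a x.

Let dmixed x := dsol p x + (chi x * (dsol q x - dsol p x) + (q x - p x) * dchi x).

Lemma is_derive_mixed_slope (x : R) : is_derive x (1 : R) mixed_slope (dmixed x).
Proof.
apply: is_deriveD; first exact: ps.
have dqp : is_derive x (1 : R) (fun x => q x - p x) (dsol q x - dsol p x).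
  by apply: is_deriveB; [exact: qs|exact: ps].
have := @is_deriveM R _ chi (fun x => q x - p x) x 1 _ _ (is_derive_chi x) dqp.
exact.
Qed.

Let csol g : continuous g -> continuous (dsol g).
Proof.
move=> cg x; apply: cvgM.
  apply: cvgB; first by apply: cvgB; [exact: cvg_cst|apply: cvgMr; exact: cV].
  apply: (@continuous_comp _ _ _ g G); first exact: cg.
  exact: locally_lipschitz_continuous.
exact: cinv.
Qed.

Let cp : continuous p. Proof. exact: slope_sol_continuous ps. Qed.
Let cq : continuous q. Proof. exact: slope_sol_continuous qs. Qed.

Let dmixed_continuous : continuous dmixed.
Proof.
have crho : continuous rho.
  move=> x; apply: cvgB; last exact: cvg_cst.
  apply: cvgMr; apply: cvgB; last exact: cvg_cst.
  by apply: prim_continuous; exact: cinv.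
move=> x; apply: cvgD; first by apply: csol; exact: cp.
apply: cvgD.
  apply: cvgM.
    by apply: (derivable_continuous (f := chi)) => y; have := is_derive_chi y.
  by apply: cvgB; [apply: csol; exact: cq|apply: csol; exact: cp].
apply: cvgM; first by apply: cvgB; [exact: cq|exact: cp].
apply: cvgM; last by apply: cvgMr; exact: cinv.
apply: (@continuous_comp _ _ _ rho (@dstep R)); first exact: crho.
exact: dstep_continuous.
Qed.

Let cmixed : continuous mixed_slope.
Proof. by apply: derivable_continuous => x; have := is_derive_mixed_slope x. Qed.

Lemma mixed_slope_between x :
  (p x <= mixed_slope x <= q x) || (q x <= mixed_slope x <= p x).
Proof.
rewrite /mixed_slope; have /andP[h1 h2] := chi01 x.
have [pq|qp] := leP (p x) (q x).
  have pq0 : 0 <= q x - p x by rewrite subr_ge0.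
  rewrite lerDl mulr_ge0//= -lerBrDl.
  by rewrite -[leRHS]mul1r ler_wpM2r.
have pq0 : q x - p x <= 0 by rewrite subr_le0 ltW.
have h3 := ler_wnM2r pq0 h2; have h4 := ler_wnM2r pq0 h1.
rewrite mul1r in h3; rewrite mul0r in h4.
by apply/orP; right; rewrite -lerBlDl h3 gerDl h4.
Qed.

Lemma mixed_slope_le x : `|mixed_slope x| <= M.
Proof.
have := pM x; have := qM x; rewrite !ler_norml => /andP[q1 q2] /andP[p1 p2].
case/orP: (mixed_slope_between x) => /andP[h1 h2].
  by rewrite (le_trans p1)// (le_trans h2).
by rewrite (le_trans q1)// (le_trans h2).
Qed.

Hypothesis s0 : 0 <= s.
Hypothesis hill_slopes : forall x, L1 <= x <= L2 ->
  C / 3 <= Ainv x - Ainv L1 -> C / 3 <= Ainv L2 - Ainv x ->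
  G (p x) <= 2 * s /\ G (q x) <= 2 * s.

(** As [p] and [q] solve the equation, the residual is the failure of [G] to be affine along the
    interpolation, plus the cutoff term, in which [a] cancels the factor [1 / a] of [chi']. Where
    [chi] is 0 or 1 the first part vanishes; in between, the three values of [G] lie in [[0, 2 * s]]
    by quasiconvexity. *)
Lemma mixed_slope_equation x :
  `|a x * dmixed x + G (mixed_slope x) + beta * V x - beta| <=
  2 * s + 6 * M * (prim (@bump R) 1)^-1 / C.
Proof.
have M0 : 0 <= M := le_trans (normr_ge0 _) (pM x).
set k := (prim (@bump R) 1)^-1; set c := chi x.
set P := G (p x); set Q := G (q x); set F := G (mixed_slope x).
have E : a x * dmixed x + F + beta * V x - beta =
    (F - (1 - c) * P - c * Q) + (q x - p x) * (dstep (rho x) * (3 / C)).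
  rewrite /dmixed /dsol /dchi -/c -/P -/Q.
  by move: F (dstep _) c P Q (p x) (q x) => F S c P Q pp qq; field; rewrite !gt_eqF.
have T2 : `|(q x - p x) * (dstep (rho x) * (3 / C))| <= 6 * M * k / C.
  have /andP[d0 dk] := dstep_bounds (rho x).
  have C30 : 0 <= 3 / C by rewrite divr_ge0// ltW.
  have dC0 := mulr_ge0 d0 C30.
  rewrite normrM (ger0_norm dC0).
  have -> : 6 * M * k / C = (M + M) * (k * (3 / C)) by field; rewrite gt_eqF.
  apply: ler_pM => //; last exact: ler_wpM2r.
  by rewrite (le_trans (ler_normB _ _))// lerD.
have T1 : `|F - (1 - c) * P - c * Q| <= 2 * s.
  have s20 : 0 <= 2 * s by rewrite mulr_ge0.
  have [r0|r0] := leP (rho x) 0.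
    have c0 : c = 0 by exact: step_eq0.
    have -> : F = P by rewrite /F /mixed_slope -/c c0 mul0r addr0.
    by rewrite c0 subr0 mul1r mul0r subr0 subrr normr0.
  have [r1|r1] := leP 1 (rho x).
    have c1 : c = 1 by exact: step_eq1.
    have -> : F = Q by rewrite /F /mixed_slope -/c c1 mul1r addrC subrK.
    by rewrite c1 subrr mul0r subr0 mul1r subrr normr0.
  have CA : C / 3 <= Ainv x - Ainv L1.
    rewrite ler_pdivrMr// -[leLHS]mul1r -ler_pdivlMr//.
    by move: r0; rewrite /rho subr_gt0 => /ltW; rewrite [3 / C * _]mulrC !mulrA.
  have CA2 : (Ainv x - Ainv L1) * 3 <= 2 * C.
    rewrite -ler_pdivrMr//.
    by move: r1; rewrite /rho ltrBlDr => /ltW; rewrite [3 / C * _]mulrC !mulrA.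
  have C30 : 0 < C / 3 by rewrite divr_gt0.
  have xL1 : L1 <= x.
    rewrite leNgt; apply/negP => /ltW/Ainv_le; rewrite -subr_le0 => h.
    by move: (lt_le_trans C30 (le_trans CA h)); rewrite ltxx.
  have xL2 : x <= L2.
    rewrite leNgt; apply/negP => /ltW/Ainv_le h.
    move: CL h CA2 C0; move: (Ainv x) (Ainv L1) (Ainv L2) => u v w; lra.
  have xL12 : L1 <= x <= L2 by rewrite xL1 xL2.
  have [|] := hill_slopes xL12 CA _.
    move: CL CA2; move: (Ainv x) (Ainv L1) (Ainv L2) => u v w; lra.
  rewrite -/P -/Q => Ps Qs.
  have P0 : 0 <= P by exact: G_ge0.
  have Q0 : 0 <= Q by exact: G_ge0.
  have F0 : 0 <= F by exact: G_ge0.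
  have /andP[c0 c1] : 0 <= c <= 1 by exact: chi01.
  have Fs : F <= 2 * s.
    by case/orP: (mixed_slope_between x) => /G_quasiconvex/le_trans; apply;
      rewrite ge_max Ps Qs.
  have cP : 0 <= (1 - c) * P by rewrite mulr_ge0// subr_ge0.
  have cQ : 0 <= c * Q by rewrite mulr_ge0.
  have cP' : (1 - c) * P <= (1 - c) * (2 * s) by rewrite ler_wpM2l// subr_ge0.
  have cQ' : c * Q <= c * (2 * s) by rewrite ler_wpM2l.
  by rewrite ler_norml; clear E; clearbody F; apply/andP; split; lra.
by rewrite E (le_trans (ler_normD _ _))// lerD.
Qed.

Variables (th tp tq eta K : R) (Fp Fq : R -> R).
Hypothesis dFp : forall x : R, is_derive x (1 : R) Fp (p x).
Hypothesis dFq : forall x : R, is_derive x (1 : R) Fq (q x).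
Hypothesis eta0 : 0 <= eta.
Hypothesis Fp_near : forall x, `|Fp x - tp * x| <= eta * `|x| + K.
Hypothesis Fq_near : forall x, `|Fq x - tq * x| <= eta * `|x| + K.

(** Normalised to meet the line [th * x] at the left end of the hill. *)
Definition mixed_corrector (x : R) : R := th * L1 + (prim mixed_slope x - prim mixed_slope L1).

Lemma is_derive_mixed_corrector (x : R) :
  is_derive x (1 : R) mixed_corrector (mixed_slope x).
Proof.
have d := is_derive_prim cmixed x.
rewrite -[mixed_slope x]add0r; apply: is_deriveD.
rewrite -[mixed_slope x]subr0; apply: is_deriveB.
Qed.

Lemma mixed_corrector_C2 : [/\ C2_line mixed_corrector,
  derive1 mixed_corrector = mixed_slope &
  derive1 (derive1 mixed_corrector) = dmixed].
Proof.
apply: C2_line_of dmixed_continuous.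
  exact: is_derive_mixed_corrector.
exact: is_derive_mixed_slope.
Qed.

Definition mixed_error (x : R) : R :=
  eta * (`|x| + `|L1| + `|L2|) + 2 * K + (M + `|th|) * (L2 - L1).

Lemma mixed_corrector_dist x : `|mixed_corrector x - th * x| <= (M + `|th|) * `|x - L1|.
Proof.
have SL1 : mixed_corrector L1 = th * L1 by rewrite /mixed_corrector subrr addr0.
have -> : mixed_corrector x - th * x =
  (mixed_corrector x - mixed_corrector L1) - th * (x - L1) by rewrite SL1; ring.
rewrite (le_trans (ler_normB _ _))// mulrDl lerD// ?normrM//.
exact: mvt_dist is_derive_mixed_corrector mixed_slope_le L1 x.
Qed.

(** Left of the hill the corrector differs from [Fp] by a constant, right of it from [Fq], and it
    inherits their asymptotic slopes; on the hill it stays close to the line because its slope is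
    bounded. *)
Lemma mixed_corrector_near x : [\/
  x <= L1 /\ `|mixed_corrector x - th * x - (tp - th) * (x - L1)| <= mixed_error x,
  `|mixed_corrector x - th * x| <= mixed_error x |
  L2 <= x /\ `|mixed_corrector x - th * x - (tq - th) * (x - L2)| <= mixed_error x].
Proof.
have M0 : 0 <= M := le_trans (normr_ge0 _) (pM x).
have Mt0 : 0 <= M + `|th| by rewrite addr_ge0.
have K0 : 0 <= K.
  have := Fp_near 0; rewrite normr0 !mulr0 add0r; exact: le_trans (normr_ge0 _).
have L0 : 0 <= L2 - L1 by rewrite subr_ge0.
have SL1 : mixed_corrector L1 = th * L1 by rewrite /mixed_corrector subrr addr0.
have dS := is_derive_mixed_corrector.
have mid y : L1 <= y <= L2 -> `|mixed_corrector y - th * y| <= (M + `|th|) * (L2 - L1).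
  move=> /andP[y1 y2]; apply: le_trans (mixed_corrector_dist y) _.
  by rewrite ler_wpM2l// ger0_norm ?subr_ge0// lerD2r.
have ee0 : 0 <= eta * `|x| by rewrite mulr_ge0.
have ee1 : 0 <= eta * `|L1| by rewrite mulr_ge0.
have ee2 : 0 <= eta * `|L2| by rewrite mulr_ge0.
have mm0 : 0 <= (M + `|th|) * (L2 - L1) by rewrite mulr_ge0.
have errE : mixed_error x = eta * `|x| + eta * `|L1| + eta * `|L2| + 2 * K + (M + `|th|) * (L2 - L1).
  by rewrite /mixed_error !mulrDr.
have [xL1|/ltW L1x] := leP x L1.
  apply: Or31; split=> //.
  have dd (z : R) : is_derive z (1 : R) (fun z => mixed_corrector z - Fp z) (mixed_slope z - p z).
    exact: is_deriveB.
  have := derive0_eq dd xL1; rewrite /= SL1 => e.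
  have {}e : mixed_corrector x - Fp x = th * L1 - Fp L1.
    by apply: e => z /andP[_ zL]; rewrite /mixed_slope chi_left// mul0r addr0 subrr.
  have -> : mixed_corrector x - th * x - (tp - th) * (x - L1) =
      (Fp x - tp * x) - (Fp L1 - tp * L1).
    by rewrite -[mixed_corrector x](subrK (Fp x)) e; ring.
  rewrite errE; apply: (le_trans (ler_normB _ _)); apply: (le_trans (lerD (Fp_near x) (Fp_near L1))).
  lra.
have [xL2|/ltW L2x] := leP x L2.
  apply: Or32; rewrite (le_trans (mid x _)) ?L1x// errE; lra.
apply: Or33; split=> //.
have dd (z : R) : is_derive z (1 : R) (fun z => mixed_corrector z - Fq z) (mixed_slope z - q z).
  exact: is_deriveB.
have := derive0_eq dd L2x; rewrite /= => e.
have {}e : mixed_corrector L2 - Fq L2 = mixed_corrector x - Fq x.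
  apply: e => z /andP[zL _]; rewrite /mixed_slope chi_right// mul1r.
  by ring.
have -> : mixed_corrector x - th * x - (tq - th) * (x - L2) =
    ((Fq x - tq * x) - (Fq L2 - tq * L2)) + (mixed_corrector L2 - th * L2).
  by rewrite -[mixed_corrector x](subrK (Fq x)) -e; ring.
have m2 : `|mixed_corrector L2 - th * L2| <= (M + `|th|) * (L2 - L1).
  by apply: mid; rewrite L12 lexx.
rewrite errE; apply: (le_trans (ler_normD _ _)).
apply: (le_trans (lerD (le_trans (ler_normB _ _) (lerD (Fq_near x) (Fq_near L2))) m2)).
lra.
Qed.

Definition hill_cost : R :=
  eta * (`|L1| + `|L2|) + 2 * K + (M + `|th|) * (L2 - L1).

Let mixed_errorE x : mixed_error x = eta * `|x| + hill_cost.
Proof. by rewrite /mixed_error /hill_cost; ring. Qed.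

(** With a smaller mean slope on the left and a larger one on the right, the corrector lies above
    the line on both sides of the hill, up to [mixed_error]. *)
Lemma mixed_corrector_ge x : tp <= th <= tq ->
  th * x - eta * `|x| - hill_cost <= mixed_corrector x.
Proof.
move=> /andP[pt tq']; rewrite -addrA -opprD -mixed_errorE.
case: (mixed_corrector_near x) => [[xL]|h|[Lx]].
- have : 0 <= (tp - th) * (x - L1) by rewrite mulr_le0// subr_le0.
  rewrite ler_norml; move: (mixed_corrector x) (mixed_error x) (_ * (x - _)) => S e d d0 /andP[h _].
  lra.
- by move: h; rewrite ler_norml => /andP[h _]; lra.
- have : 0 <= (tq - th) * (x - L2) by rewrite mulr_ge0// subr_ge0.
  rewrite ler_norml; move: (mixed_corrector x) (mixed_error x) (_ * (x - _)) => S e d d0 /andP[h _].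
  lra.
Qed.

Lemma mixed_corrector_le x : tq <= th <= tp ->
  mixed_corrector x <= th * x + eta * `|x| + hill_cost.
Proof.
move=> /andP[pt tq']; rewrite -addrA -mixed_errorE.
case: (mixed_corrector_near x) => [[xL]|h|[Lx]].
- have : (tp - th) * (x - L1) <= 0 by rewrite mulr_ge0_le0 ?subr_ge0// subr_le0.
  rewrite ler_norml; move: (mixed_corrector x) (mixed_error x) (_ * (x - _)) => S e d d0 /andP[_ h].
  lra.
- by move: h; rewrite ler_norml => /andP[_ h]; lra.
- have : (tq - th) * (x - L2) <= 0 by rewrite mulr_le0_ge0 ?subr_ge0// subr_le0.
  rewrite ler_norml; move: (mixed_corrector x) (mixed_error x) (_ * (x - _)) => S e d d0 /andP[_ h].
  lra.
Qed.

Variables (v : R * R -> R) (Lg : R).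
Hypothesis v_UC : UC_half_plane v.
Hypothesis v_sol : viscosity_solution a G (fun x => beta * V x) v.
Hypothesis v0 : forall x, v (0, x) = th * x.
Hypothesis GL : lipschitz_ball G (M + 1) Lg.
Hypothesis eta_le : 0 < eta <= 2^-1.

(** The first term is the price of evaluating at [z] a barrier attached to the line at [L1]; it is
    acceptable only for a hill near [z.2]. *)
Definition hill_error (z : R * R) : R :=
  (M + `|th|) * `|z.2 - L1| + 2 * eta * sqrt1 z.2 + hill_cost
  + (2 * s + 6 * M * (prim (@bump R) 1)^-1 / C + 2 * eta * (1 + Lg)) * z.1.

Let a01' x : 0 <= a x <= 1.
Proof. by have /andP[h1 h2] := a01 x; rewrite h2 ltW. Qed.

Lemma viscosity_le_hill z : tp <= th <= tq -> closed_half_plane z ->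
  v z - affine beta th z <= hill_error z.
Proof.
move=> tpq z0; have [C2 E1 E2] := mixed_corrector_C2.
have := @viscosity_le_barrier R a G (fun x => beta * V x) v mixed_corrector th
  (beta + (2 * s + 6 * M * (prim (@bump R) 1)^-1 / C)) eta hill_cost M Lg
  v_UC (proj1 v_sol) v0 a01' GL C2.
rewrite E2 E1 => /(_ mixed_slope_le) H.
have {}H := H _ eta_le (fun x => mixed_corrector_ge x tpq) z z0.
have {}H : v z <= mixed_corrector z.2 + 2 * eta * sqrt1 z.2 + hill_cost +
   (beta + (2 * s + 6 * M / prim (bump (R:=R)) 1 / C) + 2 * eta * (1 + Lg)) * z.1.
  apply: H => x; have := mixed_slope_equation x; rewrite ler_norml => /andP[_].
  by rewrite lerBlDl.
have := mixed_corrector_dist z.2; rewrite ler_norml => /andP[_].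
rewrite /affine /hill_error; move: H; move: (mixed_corrector z.2) (sqrt1 z.2) => S q1 H hS.
move: H hS; move: (_ * `|_ - L1|) (6 * M / _ / C) => d e H hS.
rewrite lerBlDr (le_trans H)//; move: hS; lra.
Qed.

Lemma hill_le_viscosity z : tq <= th <= tp -> closed_half_plane z ->
  affine beta th z - v z <= hill_error z.
Proof.
move=> tpq z0; have [C2 E1 E2] := mixed_corrector_C2.
have := @barrier_le_viscosity R a G (fun x => beta * V x) v mixed_corrector th
  (beta - (2 * s + 6 * M * (prim (@bump R) 1)^-1 / C)) eta hill_cost M Lg
  v_UC (proj2 v_sol) v0 a01' GL C2.
rewrite E2 E1 => /(_ mixed_slope_le) H.
have {}H := H _ eta_le (fun x => mixed_corrector_le x tpq) z z0.
have {}H : mixed_corrector z.2 - 2 * eta * sqrt1 z.2 - hill_cost +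
   (beta - (2 * s + 6 * M / prim (bump (R:=R)) 1 / C) - 2 * eta * (1 + Lg)) * z.1 <= v z.
  apply: H => x; have := mixed_slope_equation x; rewrite ler_norml => /andP[+ _].
  by rewrite lerBrDl addrC.
have := mixed_corrector_dist z.2; rewrite ler_norml => /andP[+ _].
rewrite /affine /hill_error; move: H; move: (mixed_corrector z.2) (sqrt1 z.2) => S q1 H hS.
move: H hS; move: (_ * `|_ - L1|) (6 * M / _ / C) => d e H hS.
rewrite lerBlDr -lerBlDl (le_trans _ H)//; move: hS; lra.
Qed.

End Transition.

(** * Homogenization *)

Section SublinearError.
Variables (R : realType) (G a V : R -> R) (beta : R).
Hypothesis beta_gt0 : 0 < beta.
Hypothesis G_lip : locally_lipschitz G.
Hypothesis G_ge0 : forall p, 0 <= G p.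
Hypothesis G_decr : {in `]-oo, 0] &, {homo G : p q / p < q >-> q < p}}.
Hypothesis G_incr : {in `[0, +oo[ &, {homo G : p q / p < q}}.
Hypothesis a01 : forall x, 0 < a x <= 1.
Hypothesis ca : continuous a.
Hypothesis cV : continuous V.
Notation Ainv := (prim (fun x => (a x)^-1)).

Lemma G_quasiconvex x y z : x <= y <= z -> G y <= Num.max (G x) (G z).
Proof.
move=> /andP[xy yz]; rewrite le_max; have [y0|y0] := leP 0 y.
  by rewrite (G_le G_incr y0 yz) orbT.
have := G_le (decreasing_opp G_decr) (_ : 0 <= - y) (_ : - y <= - x).
by rewrite !opprK lerN2 oppr_ge0 => -> //; exact: ltW.
Qed.

(** Reflection makes the slope nonnegative and turns the part of the hill to the right of [x] into a
    part to the left of [- x]. *)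
Lemma slope_hill_left (M s h L2 x : R) (f : R -> R) :
  slope_sol G a V beta beta f -> (forall z, - M <= f z <= 0) -> 0 < s ->
  x <= L2 -> (forall z, x <= z <= L2 -> h <= V z) -> beta * (1 - h) <= s ->
  M < s * (Ainv L2 - Ainv x) -> G (f x) <= 2 * s.
Proof.
move=> fs fM s0 xL Vh bh MA.
have ca' := continuous_opp ca.
have cinv : continuous (fun x => (a x)^-1).
  by move=> z; apply: cvgV; [apply: lt0r_neq0; have /andP[] := a01 z|exact: ca].
have E : (fun y => - Ainv (- y)) = prim (fun x => (a (- x))^-1).
  apply: prim_unique; first exact: (continuous_opp cinv).
    by rewrite oppr0 prim0 oppr0.
  move=> y; rewrite -[X in is_derive _ _ _ X]opprK; apply: is_deriveN.
  by apply: is_derive_opp_arg; exact: (is_derive_prim cinv).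
have Ey y : prim (fun x => (a (- x))^-1) y = - Ainv (- y).
  exact: (congr1 (fun k => k y) (esym E)).
have fs' : slope_sol (fun p => G (- p)) (fun x => a (- x)) (fun x => V (- x)) beta beta
    (fun y => - f (- y)).
  move=> y; have := is_deriveN (is_derive_opp_arg (fs (- y))).
  by rewrite !opprK.
have := @slope_hill R _ (decreasing_opp G_decr) (fun x => a (- x)) (fun x => V (- x)) beta
  beta_gt0 (fun x => a01 (- x)) ca' M s h (- L2) (- x) _ fs'.
rewrite !Ey !opprK; apply => //.
- by move=> z; have /andP[h1 h2] := fM (- z); rewrite oppr_ge0 h2 lerNl h1.
- by rewrite lerN2.
- by move=> z /andP[z1 z2]; apply: Vh; rewrite lerNr z2 lerNl.
- by rewrite addrC.
Qed.

Variables (v : R * R -> R) (th : R).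
Hypothesis v_UC : UC_half_plane v.
Hypothesis v_sol : viscosity_solution a G (fun x => beta * V x) v.
Hypothesis v0 : forall x, v (0, x) = th * x.

Let a01' x : 0 <= a x <= 1.
Proof. by have /andP[h1 h2] := a01 x; rewrite h2 ltW. Qed.

Let ball M : exists L, lipschitz_ball G M L.
Proof. by have [L L0 H] := locally_lipschitz_segment G_lip M; exists L. Qed.

(** When [th] is the mean slope of a corrector, the corrector is a barrier from both sides: it
    solves the equation exactly and its distance to the line is sublinear. *)
Lemma corrector_error (lam M : R) (F f : R -> R) :
  (forall x : R, is_derive x (1 : R) F (f x)) -> slope_sol G a V beta lam f ->
  (forall x, `|f x| <= M) ->
  (forall del : R, 0 < del -> exists C : R, forall x : R,
     `|F x - th * x| <= del * `|x| + C) ->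
  forall eta, 0 < eta -> exists C : R, forall z, closed_half_plane z ->
    `|v z - affine lam th z| <= eta * (z.1 + `|z.2|) + C.
Proof.
move=> dF fs fM Fth eta eta0; have [L GL] := ball (M + 1); have [L0 _] := GL.
(* The space error adds up to [3 * del * |x|], one [del] from the corrector and two from [sqrt1];
   the time error is [2 * del * (1 + L)] per unit of time. *)
pose del := Num.min 2^-1 (eta / (3 * (1 + L))).
have L1 : 0 < 1 + L by rewrite addr_gt0.
have d0 : 0 < del by rewrite lt_min invr_gt0 ltr0n/= divr_gt0// mulr_gt0.
have d1 : del <= 2^-1 by rewrite ge_min lexx.
have d2 : del * (3 * (1 + L)) <= eta.
  by rewrite -ler_pdivlMr ?mulr_gt0// ge_min lexx orbT.
have [C HC] := Fth del d0.
exists (2 * del + 2 * C) => z z0.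
have cf : continuous f by exact: slope_sol_continuous fs.
have cdf : continuous (fun x => (lam - beta * V x - G (f x)) / a x).
  move=> x; apply: cvgM.
    apply: cvgB; first by apply: cvgB; [exact: cvg_cst|apply: cvgMr; exact: cV].
    apply: (@continuous_comp _ _ _ f G); first exact: cf.
    exact: locally_lipschitz_continuous.
  by apply: cvgV; [apply: lt0r_neq0; have /andP[] := a01 x|exact: ca].
have [C2 E1 E2] := C2_line_of dF fs cdf.
have eqF x : a x * ((lam - beta * V x - G (f x)) / a x) + G (f x) + beta * V x = lam.
  have : a x != 0 by apply: lt0r_neq0; have /andP[] := a01 x.
  by move=> ax; rewrite mulrCA divff// mulr1; ring.
have dd : 0 < del <= 2^-1 by rewrite d0.
have up := @viscosity_le_barrier R a G (fun x => beta * V x) v F th lam del C M L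
  v_UC (proj1 v_sol) v0 a01' GL C2.
rewrite E2 E1 in up; have {}up := up fM.
have {}up : v z <= F z.2 + 2 * del * sqrt1 z.2 + C + (lam + 2 * del * (1 + L)) * z.1.
  apply: up => //; first by move=> x; rewrite eqF.
  by move=> x; have := HC x; rewrite ler_norml => /andP[h _]; lra.
have lo := @barrier_le_viscosity R a G (fun x => beta * V x) v F th lam del C M L
  v_UC (proj2 v_sol) v0 a01' GL C2.
rewrite E2 E1 in lo; have {}lo := lo fM.
have {}lo : F z.2 - 2 * del * sqrt1 z.2 - C + (lam - 2 * del * (1 + L)) * z.1 <= v z.
  apply: lo => //; first by move=> x; rewrite eqF.
  by move=> x; have := HC x; rewrite ler_norml => /andP[_ h]; lra.
have ds : del * sqrt1 z.2 <= del * (1 + `|z.2|) by rewrite ler_wpM2l ?(ltW d0)// sqrt1_le.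
have dL : 0 <= del * L by rewrite mulr_ge0// ltW.
have dx : del * 3 * `|z.2| <= eta * `|z.2|.
  by rewrite ler_wpM2r//; move: d2 dL; rewrite mulrA mulrDr mulr1 -[del * 3 * L]mulrAC; lra.
have dt : del * (2 * (1 + L)) * z.1 <= eta * z.1.
  by rewrite ler_wpM2r//; move: d2 dL d0; rewrite !mulrDr !mulr1 !mulrA ![del * _ * L]mulrAC; lra.
have := HC z.2; rewrite /affine !ler_norml => /andP[h1 h2].
move: z0; rewrite /closed_half_plane/= => z0.
move: up lo ds dx dt h1 h2.
move: (v z) (F z.2) (sqrt1 z.2) (`|z.2|) (z.1) (z.2) => vz Fz sq nx t x.
by move=> up lo ds dx dt h1 h2; apply/andP; split; lra.
Qed.

Variables (f1 f2 F1 F2 : R -> R) (th1 th2 M : R).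
Hypothesis f1s : slope_sol G a V beta beta f1.
Hypothesis f2s : slope_sol G a V beta beta f2.
Hypothesis f1M : forall x, - M <= f1 x <= 0.
Hypothesis f2M : forall x, 0 <= f2 x <= M.
Hypothesis dF1 : forall x : R, is_derive x (1 : R) F1 (f1 x).
Hypothesis dF2 : forall x : R, is_derive x (1 : R) F2 (f2 x).
Hypothesis F1_near : forall del : R, 0 < del -> exists C : R, forall x : R,
  `|F1 x - th1 * x| <= del * `|x| + C.
Hypothesis F2_near : forall del : R, 0 < del -> exists C : R, forall x : R,
  `|F2 x - th2 * x| <= del * `|x| + C.
Hypothesis hills : forall h C del : R, h < 1 -> 0 < del -> exists B : R, forall x : R,
  exists L1 L2, [/\ [/\ L1 <= L2, C <= Ainv L2 - Ainv L1 &
    forall y, L1 <= y <= L2 -> h <= V y],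
    `|L1 - x| <= del * `|x| + B & `|L2 - x| <= del * `|x| + B].
Hypothesis th12 : th1 <= th <= th2.

Lemma hill_slopes_small (h C s L1 L2 x : R) : 0 < s -> beta * (1 - h) <= s ->
  M < s * (C / 3) -> (forall y, L1 <= y <= L2 -> h <= V y) -> L1 <= x <= L2 ->
  C / 3 <= Ainv x - Ainv L1 -> C / 3 <= Ainv L2 - Ainv x ->
  G (f1 x) <= 2 * s /\ G (f2 x) <= 2 * s.
Proof.
move=> s0 bh MC Vh /andP[Lx xL] A1 A2; split.
  apply: (slope_hill_left f1s f1M s0 xL _ bh).
    by move=> z /andP[z1 z2]; apply: Vh; rewrite (le_trans Lx z1).
  by rewrite (lt_le_trans MC)// ler_pM2l.
apply: (slope_hill G_incr beta_gt0 a01 ca f2s f2M s0 Lx _ bh).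
  by move=> z /andP[z1 z2]; apply: Vh; rewrite z1 (le_trans z2 xL).
by rewrite (lt_le_trans MC)// ler_pM2l.
Qed.

(** In [|z.2|], the distance to the hill costs [3 * (M + |th|) * nu] and the corrections [6 * e],
    each at most half of [eta]; in time the three parts are at most [eta / 4], [eta / 4] and
    [eta / 6]. *)
Lemma hill_error_le (L1 L2 C s e K Lg nu B eta : R) z : closed_half_plane z ->
  L1 <= L2 -> `|L1 - z.2| <= nu * `|z.2| + B -> `|L2 - z.2| <= nu * `|z.2| + B ->
  0 < e -> 0 < Lg -> 0 <= nu <= 1 -> 2 * s <= eta / 4 ->
  6 * M * (prim (@bump R) 1)^-1 / C <= eta / 4 -> 12 * e * (1 + Lg) <= eta ->
  6 * (M + `|th| + 1) * nu <= eta ->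
  hill_error L1 L2 C M s th e K Lg z <=
    eta * (z.1 + `|z.2|) + (3 * (M + `|th|) * B + 2 * e + 2 * e * B + 2 * K).
Proof.
move=> z0 L12 n1 n2 e0 Lg0 /andP[nu0 nu1] hs hC he hnu; rewrite /hill_error /hill_cost.
have M0 : 0 <= M by have /andP[h1 h2] := f2M 0; exact: le_trans h2.
have N0 : 0 <= M + `|th| by rewrite addr_ge0.
move: hnu N0; set N := M + `|th| => hnu N0.
move: hC; set c := _ / C => hC.
have X0 := normr_ge0 z.2; set X := `|z.2| in X0 n1 n2 *.
have a1 : `|L1| <= X + `|L1 - z.2|.
  by rewrite -{1}[L1](subrK z.2) addrC; exact: ler_normD.
have a2 : `|L2| <= X + `|L2 - z.2|.
  by rewrite -{1}[L2](subrK z.2) addrC; exact: ler_normD.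
have a3 : L2 - L1 <= `|L2 - z.2| + `|L1 - z.2|.
  have -> : L2 - L1 = (L2 - z.2) - (L1 - z.2) by ring.
  by apply: le_trans (ler_norm _) _; exact: ler_normB.
have nX : nu * X <= X by rewrite ler_piMl.
have b1 : N * `|L1 - z.2| <= N * (nu * X + B) by rewrite ler_wpM2l.
have b2 : N * (L2 - L1) <= N * (2 * (nu * X + B)).
  by rewrite ler_wpM2l//; move: n1 n2 a3; lra.
have b3 : e * (`|L1| + `|L2|) <= e * (4 * X + 2 * B).
  by rewrite ler_wpM2l ?(ltW e0)//; move: n1 n2 a1 a2 nX; lra.
have b4 : e * sqrt1 z.2 <= e * (1 + X) by rewrite ler_wpM2l ?(ltW e0)// sqrt1_le.
have eL : 0 <= e * Lg by rewrite mulr_ge0// ltW.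
have b5 : (2 * s + c + 2 * e * (1 + Lg)) * z.1 <= eta * z.1.
  by rewrite ler_wpM2r//; move: hs hC he eL e0; lra.
have b6 : (6 * (N + 1) * nu) * X <= eta * X by rewrite ler_wpM2r.
have b7 : (12 * e) * X <= eta * X.
  by rewrite ler_wpM2r//; move: he eL; lra.
have b8 : 0 <= nu * X by rewrite mulr_ge0.
rewrite [`|z.2 - L1|]distrC [eta * (z.1 + X)]mulrDr.
move: b1 b2 b3 b4 b5 b6 b7 b8 X0.
move: (sqrt1 _) (_ * z.1) (eta * z.1) => q u t.
lra.
Qed.

(** The order of choices matters: [s], [h], [C], [nu] and [e] come from [eta], then [K] from the
    correctors and [B] from the density of hills, and only then the point [z] and a hill near it.
    The final constant is thus uniform in [z], although the barrier is not. *)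
Lemma flat_error eta : 0 < eta -> exists C : R, forall z, closed_half_plane z ->
  `|v z - affine beta th z| <= eta * (z.1 + `|z.2|) + C.
Proof.
move=> eta0; have M0 : 0 <= M by have /andP[h1 h2] := f2M 0; exact: le_trans h2.
have [Lg GL] := ball (M + 1); have [Lg0 _] := GL.
have k0 := @bump_mass_gt0 R.
pose s := eta / 8; have s0 : 0 < s by rewrite divr_gt0.
pose h := 1 - s / beta.
have h1 : h < 1 by rewrite gtrDl oppr_lt0 divr_gt0.
have bh : beta * (1 - h) <= s by rewrite /h opprB addrC subrK mulrC divfK ?gt_eqF.
(* The first summand makes a third of the hill long enough to force both values of [G] below
   [2 * s], the second brings the cutoff cost below [eta / 4], and 1 gives strictness. *)
pose C := 3 * M / s + 24 * M * (prim (@bump R) 1)^-1 / eta + 1.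
have C1 : 0 <= 3 * M / s by rewrite divr_ge0 ?mulr_ge0// ltW.
have C2 : 0 <= 24 * M * (prim (@bump R) 1)^-1 / eta.
  by rewrite !mulr_ge0// invr_ge0 ltW.
have C0 : 0 < C by rewrite ltr_wpDl// addr_ge0.
have MC : M < s * (C / 3).
  rewrite mulrA ltr_pdivlMr// mulrC -ltr_pdivrMl// mulrC.
  have -> : s^-1 * (M * 3) = 3 * M / s by rewrite mulrC [M * 3]mulrC.
  by move: C2; rewrite /C; move: (3 * M / s) (_ / eta) => u w; lra.
have kC : 6 * M * (prim (@bump R) 1)^-1 / C <= eta / 4.
  rewrite ler_pdivrMr//.
  have -> : 6 * M * (prim (@bump R) 1)^-1 =
      eta / 4 * (24 * M * (prim (@bump R) 1)^-1 / eta).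
    by move: (_^-1) => k; field; rewrite gt_eqF.
  rewrite ler_wpM2l ?divr_ge0 ?(ltW eta0)// /C.
  by move: C1; move: (3 * M / s) (_ / eta) => u w; lra.
pose N := M + `|th|; have N0 : 0 <= N by rewrite addr_ge0.
have N1 : 0 < 6 * (N + 1) by rewrite mulr_gt0// ltr_wpDl.
pose nu := Num.min 1 (eta / (6 * (N + 1))).
have nu0 : 0 < nu by rewrite lt_min ltr01/= divr_gt0.
have nu1 : nu <= 1 by rewrite ge_min lexx.
have nu2 : 6 * (N + 1) * nu <= eta.
  by rewrite mulrC -ler_pdivlMr// ge_min lexx orbT.
have L1 : 0 < 12 * (1 + Lg) by rewrite mulr_gt0// addr_gt0.
pose e := Num.min 2^-1 (eta / (12 * (1 + Lg))).
have e0 : 0 < e by rewrite lt_min invr_gt0 ltr0n/= divr_gt0.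
have e1 : 0 < e <= 2^-1 by rewrite e0 ge_min lexx.
have e2 : 12 * e * (1 + Lg) <= eta.
  by rewrite mulrAC mulrC -ler_pdivlMr// ge_min lexx orbT.
have [K1 HK1] := F1_near e0; have [K2 HK2] := F2_near e0.
pose K := Num.max K1 K2.
have {}HK1 x : `|F1 x - th1 * x| <= e * `|x| + K.
  by apply: le_trans (HK1 x) _; rewrite lerD2l le_max lexx.
have {}HK2 x : `|F2 x - th2 * x| <= e * `|x| + K.
  by apply: le_trans (HK2 x) _; rewrite lerD2l le_max lexx orbT.
have [B HB] := hills C h1 nu0.
exists (3 * N * B + 2 * e + 2 * e * B + 2 * K) => z z0.
have [L [L' [[LL CL VL] n1 n2]]] := HB z.2.
have s2 : 2 * s <= eta / 4 by rewrite /s; lra.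
have nu01 : 0 <= nu <= 1 by rewrite (ltW nu0).
have err := hill_error_le K z0 LL n1 n2 e0 Lg0 nu01 s2 kC e2 nu2.
have f1M' x : `|f1 x| <= M.
  by have /andP[g1 g2] := f1M x; rewrite ler_norml g1 (le_trans g2).
have f2M' x : `|f2 x| <= M.
  by have /andP[g1 g2] := f2M x; rewrite ger0_norm.
have small x (xi : L <= x <= L') := hill_slopes_small s0 bh MC VL xi.
have up := viscosity_le_hill G_lip G_ge0 G_quasiconvex a01 ca cV C0 LL CL f1s f2s f1M' f2M'
  (ltW s0) small dF1 dF2 (ltW e0) HK1 HK2 v_UC v_sol v0 GL e1 th12 z0.
have small' x : L <= x <= L' -> C / 3 <= Ainv x - Ainv L -> C / 3 <= Ainv L' - Ainv x ->
    G (f2 x) <= 2 * s /\ G (f1 x) <= 2 * s.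
  by move=> xi g1 g2; have [] := small x xi g1 g2.
have lo := hill_le_viscosity G_lip G_ge0 G_quasiconvex a01 ca cV C0 LL CL f2s f1s f2M' f1M'
  (ltW s0) small' dF2 dF1 (ltW e0) HK2 HK1 v_UC v_sol v0 GL e1 th12 z0.
by rewrite ler_norml lerNl opprB (le_trans up err) (le_trans lo err).
Qed.

End SublinearError.

Lemma lipschitz_continuous (R : realType) (f : R -> R) : lipschitz f -> continuous f.
Proof.
move=> fl; apply: locally_lipschitz_continuous => x; exists setT => //.
exact: filterT.
Qed.

Lemma unif_continuous_continuous (R : realType) (f : R -> R) :
  unif_continuous f -> continuous f.
Proof.
move=> uf x; apply/cvg_entourageP => E entE.
have := uf E entE; rewrite /= => fE.
have := nbhs_entourage x fE; apply: filterS => y /=.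
by rewrite /xsection/= inE.
Qed.

Lemma ae_full_measure (R : realType) (d : measure_display) (Omega : measurableType d)
    (P : probability Omega R) (good : Omega -> Prop) : {ae P, forall w, good w} ->
  exists Omega0 : set Omega, [/\ measurable Omega0, P Omega0 = 1%E &
    forall w, Omega0 w -> good w].
Proof.
move=> [N [mN N0 sN]]; exists (~` N); split; first exact: measurableC.
  by rewrite probability_setC// N0 sube0.
by move=> w nNw; apply: contrapT => /sN.
Qed.

Theorem theorem2p4
  (R : realType) (d : measure_display) (Omega : measurableType d)
  (P : probability Omega R) (tau : R -> Omega -> Omega)
  (G : R -> R) (a V : R -> Omega -> R) (beta : R)
  (u : R -> Omega -> R * R -> R)
  (tau_group : measure_preserving_group P tau)
  (P_ergodic : ergodic P tau)
  (beta_gt0 : 0 < beta)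
  (G_ge0 : forall p, 0 <= G p)
  (G_lip : locally_lipschitz G)
  (G_pinfty : G p @[p --> +oo] --> +oo)
  (G_ninfty : G p @[p --> -oo] --> +oo)
  (G0 : G 0 = 0)
  (G_decr : {in `]-oo, 0] &, {homo G : p q / p < q >-> q < p}})
  (G_incr : {in `[0, +oo[ &, {homo G : p q / p < q}})
  (a_bounds : forall x w, 0 < a x w <= 1)
  (V_bounds : forall x w, 0 <= V x w <= 1)
  (a_meas : measurable_fun setT (a 0))
  (V_meas : measurable_fun setT (V 0))
  (a_stat : stationary tau a)
  (V_stat : stationary tau V)
  (V_inf_sup : {ae P, forall w, inf [set V x w | x in setT] = 0 /\
                                sup [set V x w | x in setT] = 1})
  (u_sol : forall theta w,
     unique_UC_viscosity_solution (a ^~ w) G (fun x => beta * V x w)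
       (fun x => theta * x) (u theta w))
  (sqrta_lip : forall w, lipschitz (fun x => Num.sqrt (a x w)))
  (V_unif : forall w, unif_continuous (V ^~ w))
  (hill : forall h C, 0 < h < 1 -> 0 < C ->
     {ae P, forall w, exists L1 L2, [/\ L1 <= L2,
        (C%:E <= \int[lebesgue_measure]_(y in `[L1, L2]) ((a y w)^-1)%:E)%E &
        forall y, y \in `[L1, L2] -> h <= V y w]})
  (u_lip : forall w theta, exists2 l, 0 < l &
     forall t x y, 0 <= t ->
       `|u theta w (t, x) - u theta w (t, y)| <= l * `|x - y|) :
  let H := Hbar P G a V beta in
  let th1 := theta1 P G a V beta beta in
  let th2 := theta2 P G a V beta beta in
  let ueps (eps theta : R) (w : Omega) :=
    fun z : R * R => eps * u theta w (z.1 / eps, z.2 / eps) in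
  let ubar (theta : R) := fun z : R * R => z.1 * H theta + theta * z.2 in
  [/\ [/\ locally_lipschitz H,
          {in `]-oo, th1] &, {homo H : p q / p < q >-> q < p}} &
          {in `[th2, +oo[ &, {homo H : p q / p < q}}],
      forall eps theta w, 0 < eps ->
        unique_UC_viscosity_solution
          (fun x => eps * a (x / eps) w) G (fun x => beta * V (x / eps) w)
          (fun x => theta * x) (ueps eps theta w),
      forall theta,
        classical_solution H (ubar theta) /\
        unique_UC_viscosity_solution (cst 0) H (cst 0)
          (fun x => theta * x) (ubar theta) &
      exists Omega0 : set Omega, [/\ measurable Omega0, P Omega0 = 1%E &
        forall w, Omega0 w -> forall theta,
          cvg_locally_uniformly (fun eps => ueps eps theta w) 0^'+
            (ubar theta)]].

Proof.
move=> H th1 th2 ueps ubar.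
(* Continuity of [a] comes from its being the square of a Lipschitz function. *)
have ca w : continuous (a ^~ w).
  have -> : a ^~ w = fun x => Num.sqrt (a x w) * Num.sqrt (a x w).
    by apply/funext => x; rewrite -expr2 sqr_sqrtr// ltW//; have /andP[] := a_bounds x w.
  by have c := lipschitz_continuous (@sqrta_lip w); move=> x; apply: cvgM; exact: c.
have cV w : continuous (V ^~ w) := unif_continuous_continuous (@V_unif w).
have Hlip : locally_lipschitz H.
  exact: (Hbar_locally_lipschitz tau_group beta_gt0 G_lip G_pinfty G_ninfty G0 G_incr G_decr
    a_bounds V_bounds a_meas V_meas a_stat V_stat ca cV).
split.
- split=> //.
  + exact: (Hbar_decreasing tau_group beta_gt0 G_lip G_ninfty G0 G_decr
      a_bounds V_bounds a_meas V_meas a_stat V_stat ca cV).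
  + exact: (Hbar_increasing tau_group beta_gt0 G_lip G_pinfty G_ninfty G0 G_incr G_decr
      a_bounds V_bounds a_meas V_meas a_stat V_stat ca cV).
- move=> eps theta w eps0.
  exact: (unique_UC_viscosity_solution_scale eps0 (u_sol theta w)).
- by move=> theta; exact: affine_unique Hlip.
have as1 := F1_asymptotics tau_group P_ergodic beta_gt0 G_lip G_ninfty G0 G_decr
  a_bounds V_bounds a_meas V_meas a_stat V_stat ca cV.
have as2 := F2_asymptotics tau_group P_ergodic beta_gt0 G_lip G_pinfty G0 G_incr
  a_bounds V_bounds a_meas V_meas a_stat V_stat ca cV.
have ash := hill_density tau_group P_ergodic a_bounds a_meas V_meas a_stat V_stat ca cV hill.
(* Three almost sure properties, none of them depending on [theta], define the set of
   environments. *)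
apply: ae_full_measure; apply: filterS3 as1 as2 ash => w as1 as2 hills theta.
apply: cvg_locally_uniformly_sublinear => eta eta0.
have [[vUC vsol v0] _] := u_sol theta w.
have G_lip' := locally_lipschitz_opp G_lip.
have s1 l bl := slope1_sol beta_gt0 G_lip G_ninfty G0 G_decr a_bounds V_bounds ca cV (lambda := l) w bl.
have s2 l bl := slope2_sol beta_gt0 G_lip G_pinfty G0 G_incr a_bounds V_bounds ca cV (lambda := l) w bl.
have r1 l x bl := slope1_range beta_gt0 G_lip G_ninfty G0 G_decr a_bounds V_bounds ca cV (lambda := l) x w bl.
have r2 l x bl := slope2_range beta_gt0 G_lip G_pinfty G0 G_incr a_bounds V_bounds ca cV x w bl (lexx l).
have d1 l bl := is_derive_F1 beta_gt0 G_lip G_ninfty G0 G_decr a_bounds V_bounds ca cV (lambda := l) w bl.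
have d2 l bl := is_derive_F2 beta_gt0 G_lip G_pinfty G0 G_incr a_bounds V_bounds ca cV (lambda := l) w bl.
have [[l bl lE]|[/andP[h1 h2] HE]|[l bl lE]] := Hbar_cases tau_group beta_gt0 G_lip G_pinfty
  G_ninfty G0 G_incr G_decr a_bounds V_bounds a_meas V_meas a_stat V_stat ca cV theta.
- have -> : H theta = l.
    rewrite -lE; exact: (Hbar_theta1 tau_group beta_gt0 G_lip G_ninfty G0 G_decr
      a_bounds V_bounds a_meas V_meas a_stat V_stat ca cV).
  apply: (@corrector_error R G (a ^~ w) (V ^~ w) beta G_lip (a_bounds ^~ w) (@ca w) (@cV w)
    (u theta w) theta vUC vsol v0 l (G2_inv (fun p => G (- p)) l) _ _ (d1 l bl) (s1 l bl) _ _ eta eta0).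
    by move=> x; have /andP[g1 g2] := r1 l x bl; rewrite ler0_norm// lerNl.
  by rewrite -lE; exact: as1.
- have -> : H theta = beta by [].
  (* The interpolation uses one bound for both slopes, here the maximum of their separate bounds. *)
  pose M1 := G2_inv (fun p => G (- p)) beta; pose M2 := G2_inv G beta.
  have lb := lexx beta.
  apply: (@flat_error R G (a ^~ w) (V ^~ w) beta beta_gt0 G_lip G_ge0 G_decr G_incr
    (a_bounds ^~ w) (@ca w) (@cV w) (u theta w) theta vUC vsol v0 _ _ _ _ th1 th2 (Num.max M1 M2)
    (s1 beta lb) (s2 beta lb) _ _ (d1 beta lb) (d2 beta lb) (as1 beta lb) (as2 beta lb) hills _
    eta eta0).
  + move=> x; have /andP[g1 ->] := r1 beta x lb; rewrite andbT.
    by apply: le_trans g1; rewrite lerN2 le_max lexx.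
  + move=> x; have /andP[-> g1] := r2 beta x lb; rewrite /=.
    by apply: le_trans g1 _; rewrite le_max lexx orbT.
  + by rewrite (ltW h1) (ltW h2).
- have -> : H theta = l.
    rewrite -lE; exact: (Hbar_theta2 tau_group beta_gt0 G_lip G_pinfty G_ninfty G0 G_incr G_decr
      a_bounds V_bounds a_meas V_meas a_stat V_stat ca cV).
  apply: (@corrector_error R G (a ^~ w) (V ^~ w) beta G_lip (a_bounds ^~ w) (@ca w) (@cV w)
    (u theta w) theta vUC vsol v0 l (G2_inv G l) _ _ (d2 l bl) (s2 l bl) _ _ eta eta0).
    by move=> x; have /andP[g1 g2] := r2 l x bl; rewrite ger0_norm.
  by rewrite -lE; exact: as2.
Qed.
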